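(* Assume hypothesis (H) and that the positive equilibrium $K$ of $u'(t)=-u(t)+g(u(t-h))$ is globally attracting. Let $\psi$ be a solution of this equation on $\mathbb{R}$ with $\psi(-\infty)=0$, $\psi(+\infty)=K$, and let $\lambda$ be the positive root of $z=-1+pe^{-zh}$. Then for every $\delta\in(0,\lambda)$ there exist an interval $\mathcal{E}=(-\varepsilon_0,\varepsilon_0)$ and a continuous map $\varepsilon\mapsto\psi_\varepsilon$ from $\mathcal{E}$ into $C_{\lambda-\delta}(\mathbb{R})$ such that each $\psi_\varepsilon$ is a positive solution on $\mathbb{R}$ of $$\varepsilon^2x''(t)-x'(t)-x(t)+g(x(t-h))=0$$ with $\psi_\varepsilon(-\infty)=0$, $\psi_\varepsilon(+\infty)=K$, and moreover $\psi_0=\psi$ and $\int_{-\infty}^0\psi_\varepsilon(s)\psi'(s)\,ds=\tfrac12\psi(0)^2$. Furthermore, for every $\varepsilon\in\mathcal{E}\setminus\{0\}$ there is $t_0=t_0(\varepsilon)\in\mathbb{R}$ such that, as $t\to-\infty$, $$\psi_\varepsilon(t-t_0)=e^{\lambda_1(\varepsilon)t}+O(e^{2\lambda t}),\qquad \psi_\varepsilon'(t-t_0)=\lambda_1(\varepsilon)e^{\lambda_1(\varepsilon)t}+O(e^{2\lambda t}),$$ and $\psi_\varepsilon'>0$ on some semi-axis $(-\infty,z]$.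
   Context: Hypothesis (H): for $h>0$ and $g:\mathbb{R}_+\to\mathbb{R}_+$, the equation $u'(t)=-u(t)+g(u(t-h))$, $u\ge0$, has exactly two constant solutions $0$ and $K>0$; $K$ is exponentially asymptotically stable and $0$ is hyperbolic; $g\in C^1(\mathbb{R}_+,\mathbb{R}_+)$, $g$ is $C^2$ near $0$ and near $K$, and $p:=g'(0)>1$. Globally attracting: every solution with nonnegative, not identically zero initial function converges to $K$. $\lambda_1(\varepsilon)$ is the smallest positive real root of $\varepsilon^2z^2-z-1+pe^{-zh}=0$. For $\mu>0$, $C_\mu(\mathbb{R})$ is the space of continuous $x:\mathbb{R}\to\mathbb{R}$ such that $\|x\|^-_\mu=\sup_{s\le0}e^{-\mu s}|x(s)|<\infty$ and the limit $x(+\infty)$ exists and is finite, with norm $\|x\|_\mu=\max\{\sup_{s\ge0}|x(s)|,\|x\|^-_\mu\}$. *)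

(* Defs.v *)
From Stdlib Require Import Reals Lra.
From Coquelicot Require Import Coquelicot.
Open Scope R_scope.

Definition deriv_within (D : R -> Prop) (f : R -> R) (l x : R) : Prop :=
  filterlim (fun y => (f y - f x) / (y - x))
    (within (fun y => D y /\ y <> x) (locally x)) (locally l).

Definition cont_within (D : R -> Prop) (f : R -> R) (x : R) : Prop :=
  filterlim f (within D (locally x)) (locally (f x)).

Definition nonneg (y : R) : Prop := 0 <= y.

Definition C1_nonneg (g g' : R -> R) : Prop :=
  forall x, 0 <= x -> deriv_within nonneg g (g' x) x /\ cont_within nonneg g' x.

(** g (with derivative g') is C^2 on the set D *)
Definition C2_on (D : R -> Prop) (g' : R -> R) : Prop :=
  exists g'' : R -> R, forall x, D x ->
    deriv_within D g' (g'' x) x /\ cont_within D g'' x.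

Definition dde_sol (g : R -> R) (h : R) (u : R -> R) : Prop :=
  (forall t, -h <= t -> 0 <= u t) /\
  (forall t, -h <= t -> cont_within (fun s => -h <= s) u t) /\
  (forall t, 0 < t -> is_derive u t (- u t + g (u (t - h)))).

Definition exp_stable_eq (g : R -> R) (h K : R) : Prop :=
  exists d C gam, 0 < d /\ 0 < C /\ 0 < gam /\
    forall u r, dde_sol g h u -> r <= d ->
      (forall s, -h <= s <= 0 -> Rabs (u s - K) <= r) ->
      forall t, 0 <= t -> Rabs (u t - K) <= C * exp (- gam * t) * r.

(** hyperbolicity of 0: the characteristic equation z = -1 + p e^{-zh}
    of the linearization at 0 has no root z = i w on the imaginary axis *)
Definition hyperbolic0 (p h : R) : Prop :=
  forall w : R, ~ (1 - p * cos (w * h) = 0 /\ w + p * sin (w * h) = 0).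

Definition hypH (g g' : R -> R) (h K : R) : Prop :=
  0 < h /\ 0 < K /\
  (forall x, 0 <= x -> 0 <= g x) /\
  (forall c, 0 <= c -> (- c + g c = 0 <-> (c = 0 \/ c = K))) /\
  exp_stable_eq g h K /\
  hyperbolic0 (g' 0) h /\
  C1_nonneg g g' /\
  (exists r, 0 < r /\
     C2_on (fun y => 0 <= y /\ y < r) g' /\
     C2_on (fun y => 0 <= y /\ K - r < y /\ y < K + r) g') /\
  1 < g' 0.

Definition glob_attracting (g : R -> R) (h K : R) : Prop :=
  forall u, dde_sol g h u -> (exists s, -h <= s <= 0 /\ u s <> 0) ->
    is_lim u p_infty K.

Definition char_eq (eps p h z : R) : Prop :=
  eps ^ 2 * z ^ 2 - z - 1 + p * exp (- z * h) = 0.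

Definition is_lambda1 (eps p h l : R) : Prop :=
  0 < l /\ char_eq eps p h l /\ (forall z, 0 < z < l -> ~ char_eq eps p h z).

Definition in_C_mu (mu : R) (x : R -> R) : Prop :=
  (forall t, continuous x t) /\
  (exists M, forall s, s <= 0 -> exp (- mu * s) * Rabs (x s) <= M) /\
  (exists l : R, is_lim x p_infty l).

(** ||x||_mu <= eta, unfolding the sup in the definition of the norm *)
Definition mu_norm_le (mu : R) (x : R -> R) (eta : R) : Prop :=
  (forall s, 0 <= s -> Rabs (x s) <= eta) /\
  (forall s, s <= 0 -> exp (- mu * s) * Rabs (x s) <= eta).

Definition sol2 (g : R -> R) (h eps : R) (x : R -> R) : Prop :=
  exists x' x'' : R -> R, forall t,
    is_derive x t (x' t) /\ (eps <> 0 -> is_derive x' t (x'' t)) /\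
    eps ^ 2 * x'' t - x' t - x t + g (x (t - h)) = 0.

(* Main.v *)
Require Import Defs.
From Stdlib Require Import Reals ZArith Lra Lia FunctionalExtensionality ClassicalEpsilon.
From Coquelicot Require Import Coquelicot.
Open Scope R_scope.

(** Write the perturbed equation as [x = I_e (g (x (. - h)))], where [I_e f] is the bounded
    solution of [e^2 x'' - x' - x + f = 0]; on spaces of functions of size [min (1, exp (k t))]
    the operators [I_e] depend on [e^2] in a Lipschitz way, also at [e = 0].

    At [-oo] the front satisfies [psi = c0 exp (lam t) + O (exp (nu t))] with [c0 > 0] and
    [nu = 3 lam / 2]: the function [y = psi exp (- lam t)] solves [y' = - a (y - y (t - h)) + F], a
    flow which contracts oscillations over windows of length [h].  Solutions are sought as
    [x = c exp (l1 e t) + O (exp (nu t))] with [l1 e] the perturbed rate.  As [nu > lam], the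
    linearization along [psi] is invertible on functions of size [min (1, exp (nu t))]: it is a
    contraction near [-oo], is solved forwards by steps, and stays bounded at [+oo] because the
    exponential stability of [K] passes to the linearization.  The remaining scalar unknown,
    which accounts for translations of [psi], is fixed by the integral condition, and the
    contraction principle gives the branch and its continuity.  The remainder is improved to
    [O (exp (2 lam t))] by iterating the integral equation; positivity near [-oo] follows
    from the leading term, uniformly in [e]. *)

(** As [e] tends to [0] the equation loses its second derivative; in integral form only the bounded
    operators [Iop e] vary, and they depend on [e] through [e ^ 2] alone. The obstacle left is that
    the rate [l1 e] moves: the exponentials of rates [lam] and [l1 e] do not become close in the
    weight [exp (lam t)]. The leading exponential is therefore put explicitly into the unknown, and
    continuity holds after a loss [delta] of weight. The rate [nu] of the correction is placed above
    [5 / 4 * lam], a bound for [l1 e], so that the leading term dominates and [psi'], a kernel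
    element of rate [lam], is excluded; and below [2 * lam], the rate of the quadratic part of [g].
    Since [psi psi'] integrates to [psi(0)^2 / 2], the integral condition says that [psi_e - psi] is
    orthogonal to [psi'] on the negative half-line; its derivative along translations is the
    integral of [psi'^2], hence positive. Trial functions may be negative, so [g] is first extended
    to the whole line. *)

(** * Calculus for real functions: derivatives, continuity, monotonicity *)

Lemma is_derive_eq (f : R -> R) (x l l' : R) : is_derive f x l -> l = l' -> is_derive f x l'.
Proof. intros H <-; exact H. Qed.

Lemma is_derive_Rplus (f g : R -> R) (x l m : R) :
  is_derive f x l -> is_derive g x m -> is_derive (fun t => f t + g t) x (l + m).
Proof. intros; now apply (is_derive_plus f g). Qed.

Lemma is_derive_Rminus (f g : R -> R) (x l m : R) :
  is_derive f x l -> is_derive g x m -> is_derive (fun t => f t - g t) x (l - m).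
Proof. intros; now apply (is_derive_minus f g). Qed.

Lemma is_derive_Rmult (f g : R -> R) (x l m : R) :
  is_derive f x l -> is_derive g x m -> is_derive (fun t => f t * g t) x (l * g x + f x * m).
Proof. intros; apply (is_derive_mult f g); auto. intros; apply Rmult_comm. Qed.

Lemma is_derive_Rscal (c : R) (f : R -> R) (x l : R) :
  is_derive f x l -> is_derive (fun t => c * f t) x (c * l).
Proof. intros; now apply (is_derive_scal f). Qed.

Lemma is_derive_expk (k x : R) : is_derive (fun t => exp (k * t)) x (k * exp (k * x)).
Proof. auto_derive; auto; ring. Qed.

Lemma is_derive_shift (f : R -> R) (c x l : R) :
  is_derive f (x - c) l -> is_derive (fun t => f (t - c)) x l.
Proof.
  intros H. eapply is_derive_eq.
  - apply (is_derive_comp f (fun t => t - c)); [exact H|].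
    instantiate (1 := 1). auto_derive; auto; ring.
  - apply Rmult_1_l.
Qed.

Lemma is_derive_neg (f : R -> R) (x l : R) :
  is_derive f (- x) l -> is_derive (fun t => f (- t)) x (- l).
Proof.
  intros H. eapply is_derive_eq.
  - apply (is_derive_comp f (fun t => - t)); [exact H|].
    instantiate (1 := -1). auto_derive; auto; ring.
  - change (-1 * l = - l); ring.
Qed.

Lemma is_derive_continuous (f : R -> R) (x l : R) : is_derive f x l -> continuous f x.
Proof. intros H; apply (ex_derive_continuous f x); now exists l. Qed.

Lemma cont_Rplus (f g : R -> R) x : continuous f x -> continuous g x -> continuous (fun t => f t + g t) x.
Proof. intros; now apply (continuous_plus f g). Qed.
Lemma cont_Rminus (f g : R -> R) x : continuous f x -> continuous g x -> continuous (fun t => f t - g t) x.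
Proof. intros; now apply (continuous_minus f g). Qed.
Lemma cont_Rmult (f g : R -> R) x : continuous f x -> continuous g x -> continuous (fun t => f t * g t) x.
Proof. intros; now apply (continuous_mult f g). Qed.
Lemma cont_Rscal c (f : R -> R) x : continuous f x -> continuous (fun t => c * f t) x.
Proof. intros; apply cont_Rmult; auto. apply continuous_const. Qed.
Lemma cont_expk k x : continuous (fun t => exp (k * t)) x.
Proof. eapply is_derive_continuous, is_derive_expk. Qed.
Lemma cont_shift (f : R -> R) c x : continuous f (x - c) -> continuous (fun t => f (t - c)) x.
Proof.
  intros H. apply (continuous_comp (fun t => t - c) f); auto.
  apply cont_Rminus; [apply continuous_id|apply continuous_const].
Qed.
Lemma cont_neg (f : R -> R) x : continuous f (- x) -> continuous (fun t => f (- t)) x.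
Proof.
  intros H. apply (continuous_comp (fun t => - t) f); auto.
  apply (is_derive_continuous (fun t => - t) x (-1)); auto_derive; auto; ring.
Qed.

(** Differentiability is asked for only in the open interval: a solution with prescribed history
    need not be differentiable at the initial time, the situation of [relax]. *)
Lemma derive_ge0_le (f f' : R -> R) (a b : R) : a <= b ->
  (forall x, a <= x <= b -> continuous f x) ->
  (forall x, a < x < b -> is_derive f x (f' x) /\ 0 <= f' x) -> f a <= f b.
Proof.
  intros Hab Hc Hd. destruct (Req_dec a b) as [->|Hne]; [lra|].
  assert (pr1 : forall c, a < c < b -> derivable_pt f c).
  { intros c Hx. exists (f' c). apply is_derive_Reals. now apply Hd. }
  assert (pr2 : forall c, a < c < b -> derivable_pt id c).
  { intros c _. apply derivable_pt_id. }
  destruct (MVT f id a b pr1 pr2) as [c [P E]]; [lra| | |].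
  - intros c Hx. apply continuity_pt_filterlim, Hc; lra.
  - intros c _. apply derivable_continuous_pt, derivable_pt_id.
  - rewrite (pr_nu id c (pr2 c P) (derivable_pt_id c)), derive_pt_id in E.
    destruct (Hd c P) as [Hd1 Hd2]. apply is_derive_Reals in Hd1.
    rewrite (derive_pt_eq_0 _ _ _ (pr1 c P) Hd1) in E.
    assert (0 <= (b - a) * f' c) by (apply Rmult_le_pos; lra).
    unfold id in E. lra.
Qed.

Lemma derive_ge0_le_all (f f' : R -> R) (a b : R) : a <= b ->
  (forall x, a <= x <= b -> is_derive f x (f' x) /\ 0 <= f' x) -> f a <= f b.
Proof.
  intros Hab Hd. apply (derive_ge0_le f f'); auto.
  - intros x Hx. apply (is_derive_continuous f x (f' x)). now apply Hd.
  - intros x Hx. apply Hd; lra.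
Qed.

(** * The inverse of [d/dt + a] on functions controlled at [-oo] *)

(** The antiderivative vanishing at [-oo]; meaningful only if [f] is exponentially small at [-oo]. *)
Definition prim (f : R -> R) (t : R) : R :=
  RInt f 0 t - real (Lim_seq (fun n => RInt f 0 (- INR n))).

Lemma is_derive_RInt0 (f : R -> R) (t : R) :
  (forall x, continuous f x) -> is_derive (fun x => RInt f 0 x) t (f t).
Proof.
  intros Hc. apply (is_derive_RInt f (fun x => RInt f 0 x) 0); auto.
  exists (mkposreal 1 Rlt_0_1). intros y _. apply (RInt_correct f).
  apply (ex_RInt_continuous f). auto.
Qed.

Lemma is_derive_prim (f : R -> R) (t : R) :
  (forall x, continuous f x) -> is_derive (prim f) t (f t).
Proof.
  intros Hc. unfold prim. eapply is_derive_eq.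
  - apply is_derive_Rminus; [now apply is_derive_RInt0|].
    apply (is_derive_const (real _)).
  - change (f t - 0 = f t). ring.
Qed.

Lemma exp_mono x y : x <= y -> exp x <= exp y.
Proof. intros [H| ->]; [left; now apply exp_increasing|lra]. Qed.

Lemma exp_neg_small (k e : R) : 0 < k -> 0 < e -> exists T, forall t, t <= T -> exp (k * t) < e.
Proof.
  intros Hk He. exists (ln e / k - 1). intros t Ht.
  rewrite <- (exp_ln e He) at 1. apply exp_increasing.
  assert (k * t <= k * (ln e / k - 1)) by (apply Rmult_le_compat_l; lra).
  replace (k * (ln e / k - 1)) with (ln e - k) in H by (field; lra). lra.
Qed.

Lemma prim_bound (f : R -> R) (M k : R) : 0 < k ->
  (forall x, continuous f x) -> (forall t, t <= 0 -> Rabs (f t) <= M * exp (k * t)) ->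
  forall t, t <= 0 -> Rabs (prim f t) <= M / k * exp (k * t).
Proof.
  intros Hk Hc Hb.
  set (F := fun x => RInt f 0 x).
  assert (HM : 0 <= M).
  { specialize (Hb 0 (Rle_refl 0)). rewrite Rmult_0_r, exp_0 in Hb.
    pose proof (Rabs_pos (f 0)); lra. }
  (* Both [M / k * exp (k x) + F x] and [M / k * exp (k x) - F x] are nondecreasing, which bounds
     the increments of [F] and makes [F (- n)] a Cauchy sequence. *)
  assert (Hinc : forall s t, s <= t -> t <= 0 ->
    Rabs (F t - F s) <= M / k * (exp (k * t) - exp (k * s))).
  { intros s t Hst Ht.
    assert (H1 : F s + M / k * exp (k * s) <= F t + M / k * exp (k * t)).
    { apply (derive_ge0_le_all (fun x => F x + M / k * exp (k * x)) (fun x => f x + M * exp (k * x))); auto.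
      intros x Hx; split.
      - eapply is_derive_eq; [apply is_derive_Rplus; [now apply is_derive_RInt0|
          apply is_derive_Rscal, is_derive_expk]|field; lra].
      - specialize (Hb x ltac:(lra)). apply Rabs_le_between in Hb. lra. }
    assert (H2 : M / k * exp (k * s) - F s <= M / k * exp (k * t) - F t).
    { apply (derive_ge0_le_all (fun x => M / k * exp (k * x) - F x) (fun x => M * exp (k * x) - f x)); auto.
      intros x Hx; split.
      - eapply is_derive_eq; [apply is_derive_Rminus; [
          apply is_derive_Rscal, is_derive_expk|now apply is_derive_RInt0]|field; lra].
      - specialize (Hb x ltac:(lra)). apply Rabs_le_between in Hb. lra. }
    apply Rabs_le. lra. }
  assert (HMk : 0 <= M / k) by (apply Rdiv_le_0_compat; auto).
  assert (Hlim : ex_finite_lim_seq (fun n => F (- INR n))).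
  { apply ex_lim_seq_cauchy_corr. intros eps.
    destruct (exp_neg_small k (eps / (M / k + 1)) Hk) as [T HT].
    { apply Rdiv_lt_0_compat; [apply cond_pos|lra]. }
    destruct (nfloor_ex (Rabs T)) as [N HN]; [apply Rabs_pos|].
    exists (S N).
    assert (Hmn : forall n m, (S N <= n)%nat -> (n <= m)%nat -> Rabs (F (- INR n) - F (- INR m)) < eps).
    { intros n m Hn Hm.
      assert (INR (S N) <= INR n) by now apply le_INR.
      assert (INR n <= INR m) by now apply le_INR.
      rewrite S_INR in H. pose proof (pos_INR N).
      eapply Rle_lt_trans; [apply Hinc; lra|].
      assert (exp (k * - INR n) < eps / (M / k + 1)).
      { apply HT. pose proof (Rle_abs (- T)). rewrite Rabs_Ropp in H2. lra. }
      pose proof (exp_pos (k * - INR m)).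
      apply Rle_lt_trans with (M / k * exp (k * - INR n)).
      { apply Rmult_le_compat_l; lra. }
      apply Rle_lt_trans with (M / k * (eps / (M / k + 1))).
      { apply Rmult_le_compat_l; lra. }
      pose proof (cond_pos eps).
      apply Rmult_lt_reg_r with (M / k + 1); [lra|].
      replace (M / k * (eps / (M / k + 1)) * (M / k + 1)) with (M / k * eps) by (field; split; lra).
      lra. }
    intros n m Hn Hm. destruct (Nat.le_ge_cases n m).
    - now apply Hmn.
    - rewrite Rabs_minus_sym. now apply Hmn. }
  intros t Ht. unfold prim. fold (F t).
  change (fun n => RInt f 0 (- INR n)) with (fun n => F (- INR n)).
  destruct Hlim as [L HL]. rewrite (is_lim_seq_unique _ _ HL). simpl.
  assert (Hab : is_lim_seq (fun n => Rabs (F t - F (- INR n))) (Rabs (F t - L))).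
  { apply (is_lim_seq_abs _ (F t - L)). apply is_lim_seq_minus'; auto. apply is_lim_seq_const. }
  eapply (is_lim_seq_le_loc _ (fun _ => M / k * exp (k * t)) (Rabs (F t - L)) (M / k * exp (k * t)));
    [|exact Hab|apply is_lim_seq_const].
  destruct (nfloor_ex (Rabs t)) as [N HN]; [apply Rabs_pos|].
  exists (S N). intros n Hn.
  assert (INR (S N) <= INR n) by now apply le_INR.
  rewrite S_INR in H. rewrite Rabs_left1 in HN by lra.
  eapply Rle_trans; [apply Hinc; lra|].
  apply Rmult_le_compat_l; auto. pose proof (exp_pos (k * - INR n)); lra.
Qed.

(** The solution of [u' = - a u + f] given by variation of constants from [-oo]; among all solutions
    it is singled out by its growth there. *)
Definition J (a : R) (f : R -> R) (t : R) : R :=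
  exp (- a * t) * prim (fun s => exp (a * s) * f s) t.

(** The growth at [-oo] that [J a] tolerates when [k < a]. *)
Definition ladm (k : R) (f : R -> R) : Prop :=
  (forall t, continuous f t) /\ exists M, forall t, t <= 0 -> Rabs (f t) <= M * exp (- k * t).

Lemma is_derive_J (a : R) (f : R -> R) (t : R) : (forall x, continuous f x) ->
  is_derive (J a f) t (- a * J a f t + f t).
Proof.
  intros Hc. unfold J. eapply is_derive_eq.
  - apply is_derive_Rmult; [apply is_derive_expk|apply is_derive_prim].
    intros x. apply cont_Rmult; auto. apply cont_expk.
  - cbv beta. rewrite <- (Rmult_1_l (f t)) at 2. rewrite <- exp_0.
    replace 0 with (- a * t + a * t) by ring. rewrite exp_plus. ring.
Qed.

Lemma J_ladm (a k : R) (f : R -> R) : k < a -> ladm k f -> ladm k (J a f).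
Proof.
  intros Hk [Hc [M HM]]. split.
  { intros t. eapply is_derive_continuous, is_derive_J; auto. }
  exists (M / (a - k)). intros t Ht. unfold J.
  rewrite Rabs_mult, (Rabs_right (exp _)) by (left; apply exp_pos).
  assert (H := prim_bound (fun s => exp (a * s) * f s) M (a - k) ltac:(lra)).
  assert (Hp : Rabs (prim (fun s => exp (a * s) * f s) t) <= M / (a - k) * exp ((a - k) * t)).
  { apply H; auto.
    - intros x; apply cont_Rmult; auto; apply cont_expk.
    - intros s Hs. rewrite Rabs_mult, (Rabs_right (exp _)) by (left; apply exp_pos).
      replace ((a - k) * s) with (a * s + (- k) * s) by ring. rewrite exp_plus.
      pose proof (exp_pos (a * s)). specialize (HM s Hs). nra. }
  replace (- k * t) with (- a * t + (a - k) * t) by ring. rewrite exp_plus.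
  pose proof (exp_pos (- a * t)). nra.
Qed.

(** Nonnegativity of [V] is all that is needed at [-oo], since [exp (a t) * J a f t] tends to [0] there. *)
Lemma J_le (a k : R) (f V V' : R -> R) : k < a -> ladm k f ->
  (forall t, 0 <= V t) -> (forall t, is_derive V t (V' t)) ->
  (forall t, Rabs (f t) <= V' t + a * V t) ->
  forall t, Rabs (J a f t) <= V t.
Proof.
  intros Hk Hf HV Hd Hle.
  destruct (J_ladm a k f Hk Hf) as [Hc [M HM]]. destruct Hf as [Hcf _].
  (* [e] is a sign: the two values treat the two halves of the absolute value at once. *)
  assert (main : forall e, e = 1 \/ e = -1 -> forall t, 0 <= V t - e * J a f t).
  { intros e He t. apply Rnot_lt_le. intros Hneg.
    set (Y := fun x => exp (a * x) * (V x - e * J a f x)).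
    assert (HY : forall s, s <= t -> Y s <= Y t).
    { intros s Hs. apply (derive_ge0_le_all Y
        (fun x => exp (a * x) * (V' x + a * V x - e * f x))); auto.
      intros x _; split.
      - eapply is_derive_eq.
        + apply is_derive_Rmult; [apply is_derive_expk|].
          apply is_derive_Rminus; [apply Hd|apply is_derive_Rscal, is_derive_J; auto].
        + cbv beta. ring.
      - apply Rmult_le_pos; [left; apply exp_pos|].
        specialize (Hle x). apply Rabs_le_between in Hle. destruct He as [->| ->]; lra. }
    assert (HYt : Y t < 0).
    { unfold Y. pose proof (exp_pos (a * t)). nra. }
    set (M1 := Rabs M + 1).
    destruct (exp_neg_small (a - k) (- Y t / M1)) as [T HT]; [lra| |].
    { apply Rdiv_lt_0_compat; [lra|]. unfold M1. pose proof (Rabs_pos M); lra. }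
    set (s := Rmin (Rmin T t) 0).
    assert (Hs : s <= T /\ s <= t /\ s <= 0).
    { unfold s. pose proof (Rmin_l (Rmin T t) 0); pose proof (Rmin_r (Rmin T t) 0);
      pose proof (Rmin_l T t); pose proof (Rmin_r T t); lra. }
    specialize (HY s ltac:(lra)). specialize (HT s ltac:(lra)). specialize (HM s ltac:(lra)).
    assert (HM1 : 0 < M1) by (unfold M1; pose proof (Rabs_pos M); lra).
    assert (M1 * exp ((a - k) * s) < - Y t).
    { apply Rmult_lt_compat_l with (r := M1) in HT; auto.
      replace (M1 * (- Y t / M1)) with (- Y t) in HT by (field; lra). exact HT. }
    assert (- (M1 * exp ((a - k) * s)) <= Y s).
    { unfold Y. replace ((a - k) * s) with (a * s + (- k) * s) by ring. rewrite exp_plus.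
      pose proof (exp_pos (a * s)); pose proof (exp_pos (- k * s)).
      assert (Rabs (J a f s) <= M1 * exp (- k * s)).
      { eapply Rle_trans; [exact HM|]. apply Rmult_le_compat_r; [lra|].
        unfold M1. pose proof (Rle_abs M); lra. }
      apply Rabs_le_between in H2. specialize (HV s).
      assert (- (M1 * exp (- k * s)) <= V s - e * J a f s) by (destruct He as [->| ->]; lra).
      nra. }
    lra. }
  intros t. pose proof (main 1 (or_introl eq_refl) t); pose proof (main (-1) (or_intror eq_refl) t).
  apply Rabs_le; lra.
Qed.

Lemma ladm_plus k f g : ladm k f -> ladm k g -> ladm k (fun t => f t + g t).
Proof.
  intros [H1 [M1 H2]] [H3 [M2 H4]]. split.
  - intros t; apply cont_Rplus; auto.
  - exists (M1 + M2). intros t Ht. eapply Rle_trans; [apply Rabs_triang|].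
    specialize (H2 t Ht); specialize (H4 t Ht). lra.
Qed.

Lemma ladm_scal k c f : ladm k f -> ladm k (fun t => c * f t).
Proof.
  intros [H1 [M1 H2]]. split.
  - intros t; apply cont_Rscal; auto.
  - exists (Rabs c * M1). intros t Ht. rewrite Rabs_mult, Rmult_assoc.
    apply Rmult_le_compat_l; [apply Rabs_pos|auto].
Qed.

(** The difference of two solutions, times [exp (a t)], is constant, and it is bounded by a multiple
    of [exp ((a - k) t)] near [-oo], so it vanishes. Linearity of [J] and the resolvent identity
    follow by merely checking the differential equation. *)
Lemma J_unique (a k : R) (f u : R -> R) : k < a -> ladm k f -> ladm k u ->
  (forall t, is_derive u t (- a * u t + f t)) -> forall t, u t = J a f t.
Proof.
  intros Hk Hf Hu Hd.
  set (w := fun t => u t + (-1) * J a f t).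
  assert (Hw : ladm k w) by (apply ladm_plus; auto; apply ladm_scal, J_ladm; auto).
  assert (Hwd : forall t, is_derive (fun x => exp (a * x) * w x) t 0).
  { intros t. eapply is_derive_eq.
    - apply is_derive_Rmult; [apply is_derive_expk|]. apply is_derive_Rplus; [apply Hd|].
      apply is_derive_Rscal, is_derive_J, Hf.
    - unfold w. ring. }
  assert (Hconst : forall s t, s <= t -> exp (a * s) * w s = exp (a * t) * w t).
  { intros s t Hst. apply Rle_antisym.
    - apply (derive_ge0_le_all (fun x => exp (a * x) * w x) (fun _ => 0)); auto.
      intros; split; auto; lra.
    - assert (- (exp (a * s) * w s) <= - (exp (a * t) * w t)); [|lra].
      apply (derive_ge0_le_all (fun x => - (exp (a * x) * w x)) (fun _ => 0)); auto.
      intros x _; split; [|lra]. eapply is_derive_eq; [apply (is_derive_opp (fun x => exp (a * x) * w x)); apply Hwd|].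
      apply Ropp_0. }
  destruct Hw as [_ [M HM]].
  intros t. assert (Hz : Rabs (exp (a * t) * w t) <= 0).
  { apply Rnot_lt_le. intros Hp. set (q := Rabs (exp (a * t) * w t)) in *.
    destruct (exp_neg_small (a - k) (q / (Rabs M + 1))) as [T HT]; [lra| |].
    { apply Rdiv_lt_0_compat; auto. pose proof (Rabs_pos M); lra. }
    set (s := Rmin (Rmin T t) 0).
    assert (Hs : s <= T /\ s <= t /\ s <= 0).
    { unfold s. pose proof (Rmin_l (Rmin T t) 0); pose proof (Rmin_r (Rmin T t) 0);
      pose proof (Rmin_l T t); pose proof (Rmin_r T t); lra. }
    specialize (HT s ltac:(lra)). specialize (HM s ltac:(lra)).
    pose proof (Rabs_pos M).
    assert (q <= (Rabs M + 1) * exp ((a - k) * s)).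
    { unfold q. rewrite <- (Hconst s t) by lra.
      rewrite Rabs_mult, (Rabs_right (exp _)) by (left; apply exp_pos).
      replace ((a - k) * s) with (a * s + - k * s) by ring. rewrite exp_plus.
      pose proof (exp_pos (a * s)); pose proof (exp_pos (- k * s)). pose proof (Rle_abs M).
      assert (Rabs (w s) <= (Rabs M + 1) * exp (- k * s)).
      { eapply Rle_trans; [exact HM|]. apply Rmult_le_compat_r; lra. }
      replace ((Rabs M + 1) * (exp (a * s) * exp (- k * s)))
        with (exp (a * s) * ((Rabs M + 1) * exp (- k * s))) by ring.
      apply Rmult_le_compat_l; lra. }
    apply Rmult_lt_compat_l with (r := Rabs M + 1) in HT; [|lra].
    replace ((Rabs M + 1) * (q / (Rabs M + 1))) with q in HT by (field; lra). lra. }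
  assert (exp (a * t) * w t = 0).
  { pose proof (Rabs_pos (exp (a * t) * w t)).
    destruct (Req_dec (exp (a * t) * w t) 0); auto. apply Rabs_pos_lt in H0. lra. }
  pose proof (exp_pos (a * t)). apply Rmult_integral in H as [H|H]; [lra|].
  unfold w in H. lra.
Qed.

Lemma J_plus (a k : R) (f g : R -> R) : k < a -> ladm k f -> ladm k g ->
  forall t, J a (fun s => f s + g s) t = J a f t + J a g t.
Proof.
  intros Hk Hf Hg t. symmetry. revert t. apply (J_unique a k); auto.
  - now apply ladm_plus.
  - apply ladm_plus; now apply J_ladm.
  - intros t. eapply is_derive_eq.
    + apply is_derive_Rplus; apply is_derive_J; [apply Hf|apply Hg].
    + ring.
Qed.

Lemma J_scal (a k c : R) (f : R -> R) : k < a -> ladm k f ->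
  forall t, J a (fun s => c * f s) t = c * J a f t.
Proof.
  intros Hk Hf t. symmetry. revert t. apply (J_unique a k); auto.
  - now apply ladm_scal.
  - apply ladm_scal; now apply J_ladm.
  - intros t. eapply is_derive_eq.
    + apply is_derive_Rscal, is_derive_J, Hf.
    + ring.
Qed.

Lemma J_exp_bound (a k nu M : R) (f : R -> R) : k < a -> ladm k f -> 0 < a + nu ->
  (forall t, Rabs (f t) <= M * exp (nu * t)) ->
  forall t, Rabs (J a f t) <= M / (a + nu) * exp (nu * t).
Proof.
  intros Hk Hf Ha Hb.
  assert (HM : 0 <= M).
  { specialize (Hb 0). rewrite Rmult_0_r, exp_0 in Hb. pose proof (Rabs_pos (f 0)); lra. }
  apply (J_le a k f _ (fun t => M / (a + nu) * (nu * exp (nu * t)))); auto.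
  - intros t. apply Rmult_le_pos; [apply Rdiv_le_0_compat; auto|left; apply exp_pos].
  - intros t. apply is_derive_Rscal, is_derive_expk.
  - intros t. eapply Rle_trans; [apply Hb|]. right. field. lra.
Qed.

(** The resolvent identity for [d/dt]. It turns a change of rate into the explicit factor [b - a]
    and is the source of the Lipschitz dependence of [Iop e] on [e ^ 2]. *)
Lemma J_resolvent (a b k : R) (f : R -> R) : k < a -> k < b -> ladm k f ->
  forall t, J a f t - J b f t = (b - a) * J a (J b f) t.
Proof.
  intros Ha Hb Hf t.
  rewrite <- (J_scal a k) by (auto; now apply J_ladm).
  assert (E : J a f t - J b f t = J a f t + (-1) * J b f t) by ring. rewrite E. revert t E.
  intros t _. revert t. apply (J_unique a k); auto.
  - apply ladm_scal; now apply J_ladm.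
  - apply ladm_plus; [|apply ladm_scal]; now apply J_ladm.
  - intros t. eapply is_derive_eq.
    + apply is_derive_Rplus; [|apply is_derive_Rscal]; apply is_derive_J; apply Hf.
    + ring.
Qed.

(** * The bounded solution operator of the second order equation *)

Definition sg (e : R) : R := sqrt (1 + 4 * e ^ 2).
(** [- al e] and [/ th e] are the roots of [e^2 z^2 - z - 1]. *)
Definition al (e : R) : R := 2 / (1 + sg e).
Definition th (e : R) : R := (sg e - 1) / 2.

(** [J] run backwards in time with rate [/ q]; the operator vanishes in the limit [q = 0]. *)
Definition Jp (q : R) (f : R -> R) (t : R) : R :=
  if Req_EM_T q 0 then 0 else J (/ q) (fun s => f (- s)) (- t).

(** For [e <> 0], the bounded solution of [e^2 x'' - x' - x + f = 0]; [Iop 0] is [J 1]. *)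
Definition Iop (e : R) (f : R -> R) (t : R) : R := / sg e * (J (al e) f t + Jp (th e) f t).

(** Growth that both halves of [Iop] tolerate: bounded at [-oo] for [J (al e)], and at most
    [exp (N t)] at [+oo] for the backward part, whose rate [/ th e] exceeds [N]. *)
Definition adm (N : R) (f : R -> R) : Prop :=
  (forall t, continuous f t) /\ exists M, forall t, Rabs (f t) <= M * (1 + exp (N * t)).

(** Keeps the positive root [/ th e] above [N] and the symbol [1 + z - e ^ 2 * z ^ 2] at least [/ 2]
    for [z] between [- / 4] and [N]. *)
Definition small (N e : R) : Prop := 4 * (N + 1) * e ^ 2 <= 1.

Section RootBounds.
Variables N e : R.
Hypothesis HN : 0 <= N.
Hypothesis He : small N e.

Lemma sq_small : 0 <= e ^ 2 <= / 4.
Proof. unfold small in He. pose proof (pow2_ge_0 e). split; nra. Qed.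

Lemma sg_sq : sg e * sg e = 1 + 4 * e ^ 2.
Proof. unfold sg. apply sqrt_sqrt. pose proof (pow2_ge_0 e). lra. Qed.

Lemma sg_bounds : 1 <= sg e <= 3 / 2.
Proof.
  pose proof sg_sq. pose proof sq_small. assert (0 <= sg e) by apply sqrt_pos. split; nra.
Qed.

Lemma al_bounds : 2 / 3 <= al e <= 1.
Proof.
  pose proof sg_bounds. unfold al. split.
  - apply Rmult_le_reg_r with (1 + sg e); [lra|]. unfold Rdiv at 2. rewrite Rmult_assoc, Rinv_l; lra.
  - apply Rmult_le_reg_r with (1 + sg e); [lra|]. unfold Rdiv. rewrite Rmult_assoc, Rinv_l; lra.
Qed.

Lemma th_bounds : 0 <= th e <= e ^ 2.
Proof. pose proof sg_bounds. pose proof sg_sq. unfold th. nra. Qed.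

Lemma th_N : th e * (N + 1) <= / 4.
Proof. pose proof th_bounds. unfold small in He. nra. Qed.

Lemma th_pos_lt : th e <> 0 -> N < / th e.
Proof.
  intros H. pose proof th_bounds; pose proof th_N.
  apply Rmult_lt_reg_l with (th e); [lra|]. rewrite Rinv_r; nra.
Qed.

Lemma th_eq0 : th e = 0 <-> e = 0.
Proof.
  clear N HN He. pose proof sg_sq. unfold th. split; intros H0.
  - assert (sg e = 1) by lra. rewrite H1 in H. nra.
  - subst e. unfold sg. replace (1 + 4 * 0 ^ 2) with 1 by ring. rewrite sqrt_1. lra.
Qed.

Lemma denom_pos nu : - / 4 <= nu <= N -> / 2 <= 1 + nu - e ^ 2 * nu ^ 2.
Proof.
  intros H. unfold small in He. pose proof sq_small.
  destruct (Rle_dec 0 nu).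
  - assert (e ^ 2 * nu <= / 4) by nra. nra.
  - assert (nu ^ 2 <= 1) by nra. nra.
Qed.
End RootBounds.

Lemma sg_0 : sg 0 = 1.
Proof. unfold sg. replace (1 + 4 * 0 ^ 2) with 1 by ring. apply sqrt_1. Qed.

Lemma sg_lip N e e' : 0 <= N -> small N e -> small N e' ->
  Rabs (sg e - sg e') <= 2 * Rabs (e ^ 2 - e' ^ 2).
Proof.
  intros HN H H'. pose proof (sg_bounds N e HN H); pose proof (sg_bounds N e' HN H').
  assert (E : (sg e - sg e') * (sg e + sg e') = 4 * (e ^ 2 - e' ^ 2)).
  { pose proof (sg_sq e); pose proof (sg_sq e'). nra. }
  assert (E2 : Rabs (sg e - sg e') * (sg e + sg e') = 4 * Rabs (e ^ 2 - e' ^ 2)).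
  { rewrite <- (Rabs_right (sg e + sg e')) at 1 by lra. rewrite <- Rabs_mult, E, Rabs_mult.
    rewrite (Rabs_right 4); lra. }
  pose proof (Rabs_pos (sg e - sg e')). nra.
Qed.

Lemma al_lip N e e' : 0 <= N -> small N e -> small N e' ->
  Rabs (al e - al e') <= Rabs (e ^ 2 - e' ^ 2).
Proof.
  intros HN H H'. pose proof (sg_bounds N e HN H); pose proof (sg_bounds N e' HN H').
  pose proof (sg_lip N e e' HN H H').
  assert (E : al e - al e' = (sg e' - sg e) * (2 / ((1 + sg e) * (1 + sg e')))).
  { unfold al. field. lra. }
  rewrite E, Rabs_mult, Rabs_minus_sym.
  assert (2 / ((1 + sg e) * (1 + sg e')) <= / 2).
  { apply Rmult_le_reg_r with ((1 + sg e) * (1 + sg e')); [nra|].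
    unfold Rdiv. rewrite Rmult_assoc, Rinv_l by nra. nra. }
  assert (0 < 2 / ((1 + sg e) * (1 + sg e'))) by (apply Rdiv_lt_0_compat; nra).
  rewrite (Rabs_right (2 / _)) by lra. pose proof (Rabs_pos (sg e - sg e')). nra.
Qed.

Lemma th_lip N e e' : 0 <= N -> small N e -> small N e' ->
  Rabs (th e - th e') <= Rabs (e ^ 2 - e' ^ 2).
Proof.
  intros HN H H'. pose proof (sg_lip N e e' HN H H'). unfold th.
  replace ((sg e - 1) / 2 - (sg e' - 1) / 2) with ((sg e - sg e') * / 2) by field.
  rewrite Rabs_mult, (Rabs_right (/ 2)); lra.
Qed.

Lemma adm_ladm0 N f : 0 <= N -> adm N f -> ladm 0 f.
Proof.
  intros HN [Hc [M HM]]. split; auto. exists (2 * Rabs M). intros t Ht.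
  replace (- 0 * t) with 0 by ring. rewrite exp_0.
  assert (exp (N * t) <= 1) by (rewrite <- exp_0; apply exp_mono; nra).
  pose proof (exp_pos (N * t)). specialize (HM t). pose proof (Rle_abs M).
  pose proof (Rabs_pos M). nra.
Qed.

Lemma adm_ladm_neg N f : 0 <= N -> adm N f -> ladm N (fun s => f (- s)).
Proof.
  intros HN [Hc [M HM]]. split; [intros t; now apply cont_neg|].
  exists (2 * Rabs M). intros t Ht. specialize (HM (- t)).
  replace (- N * t) with (N * - t) by ring.
  assert (1 <= exp (N * - t)) by (rewrite <- exp_0; apply exp_mono; nra).
  pose proof (Rle_abs M). pose proof (Rabs_pos M). nra.
Qed.

Lemma adm_plus N f g : adm N f -> adm N g -> adm N (fun t => f t + g t).
Proof.
  intros [H1 [M1 H2]] [H3 [M2 H4]]. split.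
  - intros t; apply cont_Rplus; auto.
  - exists (M1 + M2). intros t. eapply Rle_trans; [apply Rabs_triang|].
    specialize (H2 t); specialize (H4 t). lra.
Qed.

Lemma adm_scal N c f : adm N f -> adm N (fun t => c * f t).
Proof.
  intros [H1 [M1 H2]]. split.
  - intros t; apply cont_Rscal; auto.
  - exists (Rabs c * M1). intros t. rewrite Rabs_mult, Rmult_assoc.
    apply Rmult_le_compat_l; [apply Rabs_pos|auto].
Qed.

Lemma adm_exp N nu M f : 0 <= nu <= N -> (forall t, continuous f t) ->
  (forall t, Rabs (f t) <= M * exp (nu * t)) -> adm N f.
Proof.
  intros Hnu Hc Hb. split; auto. exists M. intros t.
  assert (0 <= M).
  { specialize (Hb 0). rewrite Rmult_0_r, exp_0 in Hb. pose proof (Rabs_pos (f 0)); lra. }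
  eapply Rle_trans; [apply Hb|]. apply Rmult_le_compat_l; auto.
  destruct (Rle_dec t 0).
  - assert (exp (nu * t) <= 1) by (rewrite <- exp_0; apply exp_mono; nra).
    pose proof (exp_pos (N * t)). lra.
  - assert (exp (nu * t) <= exp (N * t)) by (apply exp_mono; nra). lra.
Qed.

Section Properties.
Variables N e : R.
Hypothesis HN : 0 <= N.
Hypothesis He : small N e.

Lemma is_derive_Jp f t : th e <> 0 -> (forall x, continuous f x) ->
  is_derive (Jp (th e) f) t (/ th e * Jp (th e) f t - f t).
Proof.
  intros H Hc. unfold Jp. destruct (Req_EM_T (th e) 0); [easy|].
  eapply is_derive_eq.
  - apply is_derive_neg. apply is_derive_J. intros x; now apply cont_neg.
  - cbv beta. rewrite Ropp_involutive. ring.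
Qed.

Lemma Jp_cont f t : (forall x, continuous f x) -> continuous (Jp (th e) f) t.
Proof.
  intros Hc. destruct (Req_EM_T (th e) 0) as [E|E].
  - unfold Jp. destruct (Req_EM_T (th e) 0); [apply continuous_const|easy].
  - eapply is_derive_continuous, is_derive_Jp; auto.
Qed.

Lemma Iop_cont f t : (forall x, continuous f x) -> continuous (Iop e f) t.
Proof.
  intros Hc. unfold Iop. apply cont_Rscal, cont_Rplus; [|now apply Jp_cont].
  eapply is_derive_continuous, is_derive_J; auto.
Qed.

Lemma al_pos : 0 < al e.
Proof. pose proof (al_bounds N e HN He); lra. Qed.

Lemma Jp_plus f g t : adm N f -> adm N g ->
  Jp (th e) (fun s => f s + g s) t = Jp (th e) f t + Jp (th e) g t.
Proof.
  intros Hf Hg. unfold Jp. destruct (Req_EM_T (th e) 0); [ring|].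
  apply (J_plus _ N (fun s => f (- s)) (fun s => g (- s))); try now apply adm_ladm_neg.
  now apply (th_pos_lt N e).
Qed.

Lemma Jp_scal c f t : adm N f -> Jp (th e) (fun s => c * f s) t = c * Jp (th e) f t.
Proof.
  intros Hf. unfold Jp. destruct (Req_EM_T (th e) 0); [ring|].
  apply (J_scal _ N c (fun s => f (- s))); try now apply adm_ladm_neg.
  now apply (th_pos_lt N e).
Qed.

Lemma Iop_plus f g t : adm N f -> adm N g ->
  Iop e (fun s => f s + g s) t = Iop e f t + Iop e g t.
Proof.
  intros Hf Hg. unfold Iop. rewrite Jp_plus by auto.
  rewrite (J_plus _ 0 f g); try apply (adm_ladm0 N); auto using al_pos. ring.
Qed.

Lemma Iop_scal c f t : adm N f -> Iop e (fun s => c * f s) t = c * Iop e f t.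
Proof.
  intros Hf. unfold Iop. rewrite Jp_scal by auto.
  rewrite (J_scal _ 0 c f); try apply (adm_ladm0 N); auto using al_pos. ring.
Qed.

(** The factor is [/ (/ th e - nu)], written so that it also covers the limit [th e = 0]. *)
Lemma Jp_exp_bound nu M f : - / 4 <= nu <= N -> adm N f ->
  (forall t, Rabs (f t) <= M * exp (nu * t)) ->
  forall t, Rabs (Jp (th e) f t) <= M * (th e / (1 - th e * nu)) * exp (nu * t).
Proof.
  intros Hnu Hf Hb t. pose proof (th_bounds N e HN He); pose proof (th_N N e HN He).
  unfold Jp. destruct (Req_EM_T (th e) 0) as [E|E].
  - rewrite Rabs_R0, E. right. unfold Rdiv. ring.
  - assert (th e * nu <= / 4) by nra.
    pose proof (th_pos_lt N e HN He E).
    eapply Rle_trans.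
    + apply (J_exp_bound _ N (- nu) M); try lra.
      * now apply adm_ladm_neg.
      * intros s. replace (- nu * s) with (nu * - s) by ring. apply Hb.
    + replace (- nu * - t) with (nu * t) by ring. right. field. split; lra.
Qed.

(** Both kernels are positive, so the bound is attained on the exponential itself, and partial
    fractions add the two constants to the inverse of the symbol. This exact factor, not the cruder
    one of [Iop_exp_bound2], makes the iteration in [asym_bound] contract. *)
Lemma Iop_exp_bound nu M f : - / 4 <= nu <= N -> adm N f ->
  (forall t, Rabs (f t) <= M * exp (nu * t)) ->
  forall t, Rabs (Iop e f t) <= M / (1 + nu - e ^ 2 * nu ^ 2) * exp (nu * t).
Proof.
  intros Hnu Hf Hb t. pose proof (th_bounds N e HN He); pose proof (th_N N e HN He).
  pose proof (sg_bounds N e HN He). pose proof (al_bounds N e HN He). pose proof (denom_pos N e HN He nu Hnu).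
  unfold Iop. rewrite Rabs_mult, (Rabs_right (/ sg e)) by (left; apply Rinv_0_lt_compat; lra).
  assert (B1 := J_exp_bound (al e) 0 nu M f al_pos (adm_ladm0 N f HN Hf) ltac:(lra) Hb t).
  assert (B2 := Jp_exp_bound nu M f Hnu Hf Hb t).
  assert (th e * nu <= / 4) by nra.
  apply Rle_trans with (/ sg e * (M / (al e + nu) * exp (nu * t) +
    M * (th e / (1 - th e * nu)) * exp (nu * t))).
  - apply Rmult_le_compat_l; [left; apply Rinv_0_lt_compat; lra|].
    eapply Rle_trans; [apply Rabs_triang|]. lra.
  - right. unfold th, al in *.
    assert (E : e ^ 2 = (sg e * sg e - 1) / 4) by (rewrite sg_sq; field). rewrite E in *.
    assert (2 + nu * (1 + sg e) <> 0).
    { intros E2. assert (2 / (1 + sg e) + nu = 0); [|lra].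
      apply Rmult_eq_reg_r with (1 + sg e); [|lra]. 
      replace ((2 / (1 + sg e) + nu) * (1 + sg e)) with (2 + nu * (1 + sg e)) by (field; lra). lra. }
    field. repeat split; try lra; try nra.
Qed.

Lemma Iop_exp_bound2 nu M f : - / 4 <= nu <= N -> adm N f ->
  (forall t, Rabs (f t) <= M * exp (nu * t)) ->
  forall t, Rabs (Iop e f t) <= 2 * M * exp (nu * t).
Proof.
  intros Hnu Hf Hb t. eapply Rle_trans; [apply (Iop_exp_bound nu M); auto|].
  pose proof (denom_pos N e HN He nu Hnu).
  assert (HM : 0 <= M).
  { specialize (Hb 0). rewrite Rmult_0_r, exp_0 in Hb. pose proof (Rabs_pos (f 0)); lra. }
  apply Rmult_le_compat_r; [left; apply exp_pos|]. rewrite (Rmult_comm 2).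
  apply Rmult_le_compat_l; auto. rewrite <- (Rinv_inv 2) at 1. apply Rinv_le_contravar; lra.
Qed.

Definition Iop1 (f : R -> R) (t : R) : R :=
  / sg e * (- al e * J (al e) f t + / th e * Jp (th e) f t).
Definition Iop2 (f : R -> R) (t : R) : R :=
  / sg e * (- al e * (- al e * J (al e) f t + f t) +
            / th e * (/ th e * Jp (th e) f t - f t)).

Lemma is_derive_Iop f t : e <> 0 -> (forall x, continuous f x) ->
  is_derive (Iop e f) t (Iop1 f t).
Proof.
  intros H Hc. assert (th e <> 0) by (intros HH; exact (H (proj1 (th_eq0 e) HH))).
  unfold Iop. eapply is_derive_eq.
  - apply is_derive_Rscal, is_derive_Rplus; [apply is_derive_J|apply is_derive_Jp]; auto.
  - unfold Iop1. ring.
Qed.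

Lemma is_derive_Iop1 f t : e <> 0 -> (forall x, continuous f x) ->
  is_derive (Iop1 f) t (Iop2 f t).
Proof.
  intros H Hc. assert (th e <> 0) by (intros HH; exact (H (proj1 (th_eq0 e) HH))).
  unfold Iop1. eapply is_derive_eq.
  - apply is_derive_Rscal, is_derive_Rplus; apply is_derive_Rscal; [apply is_derive_J|apply is_derive_Jp]; auto.
  - unfold Iop2. ring.
Qed.

Lemma Iop_equation f t : e <> 0 ->
  e ^ 2 * Iop2 f t - Iop1 f t - Iop e f t + f t = 0.
Proof.
  intros H. assert (th e <> 0) by (intros HH; exact (H (proj1 (th_eq0 e) HH))).
  pose proof (sg_bounds N e HN He).
  unfold Iop2, Iop1, Iop. generalize (J (al e) f t) (Jp (th e) f t) (f t). intros u v w.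
  unfold al, th in *.
  assert (E : e ^ 2 = (sg e * sg e - 1) / 4) by (rewrite sg_sq; field). rewrite E.
  field. lra.
Qed.

Lemma Iop1_exp_bound nu M f : - / 4 <= nu <= N -> adm N f ->
  (forall t, Rabs (f t) <= M * exp (nu * t)) ->
  exists C, forall t, Rabs (Iop1 f t) <= C * exp (nu * t).
Proof.
  intros Hnu Hf Hb. pose proof (al_bounds N e HN He).
  assert (B1 := J_exp_bound (al e) 0 nu M f al_pos (adm_ladm0 N f HN Hf) ltac:(lra) Hb).
  assert (B2 := Jp_exp_bound nu M f Hnu Hf Hb).
  exists (Rabs (/ sg e) * (Rabs (- al e) * (M / (al e + nu)) +
          Rabs (/ th e) * (M * (th e / (1 - th e * nu))))).
  intros t. unfold Iop1. rewrite Rabs_mult, Rmult_assoc.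
  apply Rmult_le_compat_l; [apply Rabs_pos|].
  eapply Rle_trans; [apply Rabs_triang|]. rewrite !Rabs_mult, Rmult_plus_distr_r, !Rmult_assoc.
  apply Rplus_le_compat; apply Rmult_le_compat_l; try apply Rabs_pos.
  - apply B1.
  - specialize (B2 t). now rewrite Rmult_assoc in B2.
Qed.

Lemma Iop_expk z t : 0 <= z <= N -> Iop e (fun s => exp (z * s)) t = exp (z * t) / (1 + z - e ^ 2 * z ^ 2).
Proof.
  intros Hz. pose proof (th_bounds N e HN He); pose proof (th_N N e HN He).
  pose proof (sg_bounds N e HN He). pose proof (al_bounds N e HN He).
  pose proof (denom_pos N e HN He z ltac:(lra)).
  assert (Ha : adm N (fun s => exp (z * s))).
  { apply (adm_exp N z 1); auto. intros; apply cont_expk.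
    intros s. rewrite Rabs_right by (left; apply exp_pos). lra. }
  assert (E1 : J (al e) (fun s => exp (z * s)) t = / (al e + z) * exp (z * t)).
  { symmetry. revert t. apply (J_unique (al e) 0); auto using al_pos.
    - now apply (adm_ladm0 N).
    - now apply ladm_scal, (adm_ladm0 N).
    - intros t. eapply is_derive_eq; [apply is_derive_Rscal, is_derive_expk|]. field. lra. }
  assert (th e * z <= / 4) by nra.
  assert (E2 : Jp (th e) (fun s => exp (z * s)) t = th e / (1 - th e * z) * exp (z * t)).
  { unfold Jp. destruct (Req_EM_T (th e) 0) as [E|E].
    - rewrite E. unfold Rdiv. ring.
    - replace (z * t) with (- z * - t) by ring. generalize (- t). clear t E1. intros t.
      symmetry. revert t. apply (J_unique (/ th e) N).
      + now apply (th_pos_lt N e).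
      + now apply (adm_ladm_neg N (fun s => exp (z * s))).
      + apply ladm_scal. replace (fun t => exp (- z * t)) with (fun t => exp (z * - t)).
        now apply (adm_ladm_neg N (fun s => exp (z * s))).
        apply functional_extensionality; intros; f_equal; ring.
      + intros t. eapply is_derive_eq; [apply is_derive_Rscal, is_derive_expk|].
        replace (z * - t) with (- z * t) by ring. field. split; lra. }
  unfold Iop. rewrite E1, E2. unfold th, al in *.
  assert (E : e ^ 2 = (sg e * sg e - 1) / 4) by (rewrite sg_sq; field). rewrite E in *.
  assert (2 + z * (1 + sg e) <> 0) by nra.
  field. repeat split; try lra; try nra.
Qed.
End Properties.

Lemma Iop_0 f t : Iop 0 f t = J 1 f t.
Proof.
  unfold Iop, Jp, th, al. rewrite sg_0.
  destruct (Req_EM_T ((1 - 1) / 2) 0) as [_|n]; [|lra].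
  replace (2 / (1 + 1)) with 1 by field. field.
Qed.

Lemma small_0 N : small N 0.
Proof. unfold small. lra. Qed.

Lemma Rabs_mult_le a b A B : Rabs a <= A -> Rabs b <= B -> Rabs (a * b) <= A * B.
Proof. intros. rewrite Rabs_mult. apply Rmult_le_compat; auto using Rabs_pos. Qed.

Lemma Rabs_sub_le a b : Rabs (a - b) <= Rabs a + Rabs b.
Proof. unfold Rminus. eapply Rle_trans; [apply Rabs_triang|]. rewrite Rabs_Ropp; lra. Qed.

Lemma exp_bound_nonneg f M nu : (forall t, Rabs (f t) <= M * exp (nu * t)) -> 0 <= M.
Proof.
  intros Hb. specialize (Hb 0). rewrite Rmult_0_r, exp_0 in Hb. pose proof (Rabs_pos (f 0)); lra.
Qed.

(** * Lipschitz dependence of the solution operator on [e ^ 2] *)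

Lemma J_diff (a b nu M : R) (f : R -> R) : 2 / 3 <= a -> 2 / 3 <= b -> - / 4 <= nu -> ladm 0 f ->
  (forall t, Rabs (f t) <= M * exp (nu * t)) ->
  forall t, Rabs (J a f t - J b f t) <= 6 * Rabs (a - b) * M * exp (nu * t).
Proof.
  intros Ha Hb Hnu Hf Hbd t. assert (HM := exp_bound_nonneg _ _ _ Hbd).
  rewrite (J_resolvent a b 0) by (auto; lra).
  assert (B1 := J_exp_bound b 0 nu M f ltac:(lra) Hf ltac:(lra) Hbd).
  assert (B2 := J_exp_bound a 0 nu (M / (b + nu)) (J b f) ltac:(lra) (J_ladm b 0 f ltac:(lra) Hf) ltac:(lra) B1 t).
  rewrite Rabs_mult, Rabs_minus_sym.
  apply Rle_trans with (Rabs (a - b) * (M / (b + nu) / (a + nu) * exp (nu * t))).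
  { apply Rmult_le_compat_l; [apply Rabs_pos|auto]. }
  replace (6 * Rabs (a - b) * M * exp (nu * t)) with (Rabs (a - b) * (6 * M * exp (nu * t))) by ring.
  apply Rmult_le_compat_l; [apply Rabs_pos|].
  apply Rmult_le_compat_r; [left; apply exp_pos|].
  replace (M / (b + nu) / (a + nu)) with (M * / ((b + nu) * (a + nu))) by (field; lra).
  rewrite (Rmult_comm 6). apply Rmult_le_compat_l; auto.
  (* Both denominators are at least [2 / 3 - / 4 = 5 / 12], and [25 / 144] exceeds [/ 6]. *)
  rewrite <- (Rinv_inv 6). apply Rinv_le_contravar; nra.
Qed.

Section Diff.
Variables N e e' : R.
Hypothesis HN : 0 <= N.
Hypothesis He : small N e.
Hypothesis He' : small N e'.

Lemma th_div nu : - / 4 <= nu <= N -> 0 < / (1 - th e * nu) <= 4 / 3.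
Proof.
  intros Hnu. pose proof (th_bounds N e HN He); pose proof (th_N N e HN He).
  assert (th e * nu <= / 4) by nra. split.
  - apply Rinv_0_lt_compat; lra.
  - replace (4 / 3) with (/ (3 / 4)) by field. apply Rinv_le_contravar; lra.
Qed.
End Diff.

(** If one of the two rates is infinite, the difference is the other term alone. Otherwise the
    resolvent identity gives the factor [/ th e' - / th e], whose denominator [th e * th e'] is
    cancelled by the two kernel bounds, each proportional to its [th]. *)
Lemma Jp_diff N e e' nu M f : 0 <= N -> small N e -> small N e' -> - / 4 <= nu <= N -> adm N f ->
  (forall t, Rabs (f t) <= M * exp (nu * t)) ->
  forall t, Rabs (Jp (th e) f t - Jp (th e') f t) <= 2 * Rabs (th e - th e') * M * exp (nu * t).
Proof.
  intros HN He He' Hnu Hf Hb t. assert (HM := exp_bound_nonneg _ _ _ Hb).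
  pose proof (th_bounds N e HN He); pose proof (th_bounds N e' HN He').
  pose proof (th_div N e HN He nu Hnu) as D1; pose proof (th_div N e' HN He' nu Hnu) as D2.
  assert (B1 := Jp_exp_bound N e HN He nu M f Hnu Hf Hb t).
  assert (B2 := Jp_exp_bound N e' HN He' nu M f Hnu Hf Hb t).
  pose proof (exp_pos (nu * t)) as Hx.
  destruct (Req_dec (th e) 0) as [E1|E1]; [|destruct (Req_dec (th e') 0) as [E2|E2]].
  - rewrite E1 in *. unfold Jp at 1. destruct (Req_EM_T 0 0); [|easy].
    replace (0 - Jp (th e') f t) with (- Jp (th e') f t) by ring. rewrite Rabs_Ropp.
    eapply Rle_trans; [exact B2|]. apply Rmult_le_compat_r; [lra|].
    replace (0 - th e') with (- th e') by ring. rewrite Rabs_Ropp, (Rabs_right (th e')) by lra.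
    unfold Rdiv. replace (2 * th e' * M) with (M * (th e' * 2)) by ring.
    apply Rmult_le_compat_l; auto. apply Rmult_le_compat_l; lra.
  - rewrite E2 in *. unfold Jp at 2. destruct (Req_EM_T 0 0); [|easy].
    rewrite !Rminus_0_r in *. 
    eapply Rle_trans; [exact B1|]. apply Rmult_le_compat_r; [lra|].
    rewrite (Rabs_right (th e)) by lra.
    unfold Rdiv. replace (2 * th e * M) with (M * (th e * 2)) by ring.
    apply Rmult_le_compat_l; auto. apply Rmult_le_compat_l; lra.
  - unfold Jp. destruct (Req_EM_T (th e) 0) as [|_]; [easy|]. destruct (Req_EM_T (th e') 0) as [|_]; [easy|].
    pose proof (th_pos_lt N e HN He E1) as P1. pose proof (th_pos_lt N e' HN He' E2) as P2.
    assert (Ln := adm_ladm_neg N f HN Hf).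
    rewrite (J_resolvent _ _ N) by auto.
    assert (Hb' : forall s, Rabs (f (- s)) <= M * exp (- nu * s)).
    { intros s. replace (- nu * s) with (nu * - s) by ring. apply Hb. }
    assert (C1 := J_exp_bound (/ th e') N (- nu) M _ P2 Ln ltac:(lra) Hb').
    assert (C2 := J_exp_bound (/ th e) N (- nu) (M / (/ th e' + - nu)) _ P1 (J_ladm _ N _ P2 Ln) ltac:(lra) C1 (- t)).
    replace (- nu * - t) with (nu * t) in C2 by ring.
    rewrite Rabs_mult.
    apply Rle_trans with (Rabs (/ th e' - / th e) * (M / (/ th e' + - nu) / (/ th e + - nu) * exp (nu * t))).
    { apply Rmult_le_compat_l; [apply Rabs_pos|exact C2]. }
    rewrite <- Rmult_assoc. apply Rmult_le_compat_r; [lra|].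
    replace (/ th e' - / th e) with ((th e - th e') * / (th e * th e')) by (field; auto).
    assert (0 < th e * th e') by nra.
    rewrite Rabs_mult, (Rabs_right (/ _)) by (left; now apply Rinv_0_lt_compat).
    assert (1 - th e * nu <> 0) by (intros Q; rewrite Q, Rinv_0 in D1; lra).
    assert (1 - th e' * nu <> 0) by (intros Q; rewrite Q, Rinv_0 in D2; lra).
    replace (Rabs (th e - th e') * / (th e * th e') * (M / (/ th e' + - nu) / (/ th e + - nu)))
      with (Rabs (th e - th e') * M * (/ (1 - th e * nu) * / (1 - th e' * nu))).
    2: { field. repeat split; auto; lra. }
    replace (2 * Rabs (th e - th e') * M) with (Rabs (th e - th e') * M * 2) by ring.
    apply Rmult_le_compat_l; [apply Rmult_le_pos; auto using Rabs_pos|]. nra.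
Qed.

(** [sg], [al] and [th] are Lipschitz in [e ^ 2], also at [e = 0]. The prefactor contributes
    [2 * 4], the forward part [6] and the backward part [2], together below [20]. *)
Lemma Iop_diff N e e' nu M f : 0 <= N -> small N e -> small N e' -> - / 4 <= nu <= N -> adm N f ->
  (forall t, Rabs (f t) <= M * exp (nu * t)) ->
  forall t, Rabs (Iop e f t - Iop e' f t) <= 20 * Rabs (e ^ 2 - e' ^ 2) * M * exp (nu * t).
Proof.
  intros HN He He' Hnu Hf Hb t. assert (HM := exp_bound_nonneg _ _ _ Hb).
  pose proof (exp_pos (nu * t)) as Hx.
  assert (HMx : 0 <= M * exp (nu * t)) by (apply Rmult_le_pos; lra).
  pose proof (sg_bounds N e HN He); pose proof (sg_bounds N e' HN He').
  pose proof (al_bounds N e HN He); pose proof (al_bounds N e' HN He').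
  assert (L0 := adm_ladm0 N f HN Hf).
  assert (D1 := J_diff (al e) (al e') nu M f ltac:(lra) ltac:(lra) ltac:(lra) L0 Hb t).
  assert (D2 := Jp_diff N e e' nu M f HN He He' Hnu Hf Hb t).
  assert (B1 := J_exp_bound (al e) 0 nu M f ltac:(lra) L0 ltac:(lra) Hb t).
  assert (B2 := Jp_exp_bound N e HN He nu M f Hnu Hf Hb t).
  pose proof (th_div N e HN He nu Hnu) as T1. pose proof (th_bounds N e HN He).
  pose proof (sq_small N e HN He).
  pose proof (sg_lip N e e' HN He He') as S1. pose proof (al_lip N e e' HN He He') as S2.
  pose proof (th_lip N e e' HN He He') as S3.
  set (X := M * exp (nu * t)) in *. set (d := Rabs (e ^ 2 - e' ^ 2)) in *.
  assert (Hd : 0 <= d) by apply Rabs_pos.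
  assert (B1' : Rabs (J (al e) f t) <= 3 * X).
  { eapply Rle_trans; [exact B1|]. unfold X. rewrite <- Rmult_assoc. apply Rmult_le_compat_r; [lra|].
    rewrite (Rmult_comm 3 M). apply Rmult_le_compat_l; auto.
    replace 3 with (/ (/ 3)) by field. apply Rinv_le_contravar; lra. }
  assert (B2' : Rabs (Jp (th e) f t) <= X).
  { eapply Rle_trans; [exact B2|]. unfold X.
    rewrite <- (Rmult_1_r M) at 2. apply Rmult_le_compat_r; [lra|]. apply Rmult_le_compat_l; auto.
    unfold Rdiv. nra. }
  assert (D1' : Rabs (J (al e) f t - J (al e') f t) <= 6 * d * X).
  { eapply Rle_trans; [exact D1|]. unfold X. rewrite (Rmult_assoc (6 * _)).
    apply Rmult_le_compat_r; [exact HMx|]. lra. }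
  assert (D2' : Rabs (Jp (th e) f t - Jp (th e') f t) <= 2 * d * X).
  { eapply Rle_trans; [exact D2|]. unfold X. rewrite (Rmult_assoc (2 * _)).
    apply Rmult_le_compat_r; [exact HMx|]. lra. }
  assert (S0 : Rabs (/ sg e - / sg e') <= 2 * d).
  { replace (/ sg e - / sg e') with ((sg e' - sg e) * / (sg e * sg e')) by (field; lra).
    rewrite Rabs_mult, Rabs_minus_sym.
    assert (0 < / (sg e * sg e') <= 1).
    { split; [apply Rinv_0_lt_compat; nra|]. rewrite <- Rinv_1. apply Rinv_le_contravar; nra. }
    rewrite (Rabs_right (/ _)) by lra. pose proof (Rabs_pos (sg e - sg e')). nra. }
  assert (S4 : Rabs (/ sg e') <= 1).
  { rewrite Rabs_right by (left; apply Rinv_0_lt_compat; lra).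
    rewrite <- Rinv_1. apply Rinv_le_contravar; lra. }
  unfold Iop.
  replace (/ sg e * (J (al e) f t + Jp (th e) f t) - / sg e' * (J (al e') f t + Jp (th e') f t))
    with ((/ sg e - / sg e') * (J (al e) f t + Jp (th e) f t) +
          / sg e' * ((J (al e) f t - J (al e') f t) + (Jp (th e) f t - Jp (th e') f t))) by ring.
  eapply Rle_trans; [apply Rabs_triang|].
  assert (Rabs ((/ sg e - / sg e') * (J (al e) f t + Jp (th e) f t)) <= 2 * d * (4 * X)).
  { apply Rabs_mult_le; auto. eapply Rle_trans; [apply Rabs_triang|]. lra. }
  assert (Rabs (/ sg e' * ((J (al e) f t - J (al e') f t) + (Jp (th e) f t - Jp (th e') f t))) <= 1 * (8 * d * X)).
  { apply Rabs_mult_le; auto. eapply Rle_trans; [apply Rabs_triang|]. lra. }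
  replace (20 * d * M * exp (nu * t)) with (20 * (d * X)) by (unfold X; ring).
  assert (0 <= d * X) by (apply Rmult_le_pos; auto). lra.
Qed.

(** * Weights that are exponential on the left and constant on the right *)

Definition wt (k t : R) : R := exp (k * Rmin t 0).

Definition wb (k M : R) (f : R -> R) : Prop :=
  (forall t, continuous f t) /\ forall t, Rabs (f t) <= M * wt k t.

Lemma wt_pos k t : 0 < wt k t.
Proof. apply exp_pos. Qed.

Lemma wt_le1 k t : 0 <= k -> wt k t <= 1.
Proof. intros. unfold wt. rewrite <- exp_0. apply exp_mono. pose proof (Rmin_r t 0). nra. Qed.

Lemma wt_le_exp k t : 0 <= k -> wt k t <= exp (k * t).
Proof. intros. unfold wt. apply exp_mono. pose proof (Rmin_l t 0). nra. Qed.

Lemma wt_neg k t : t <= 0 -> wt k t = exp (k * t).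
Proof. intros. unfold wt. now rewrite Rmin_left. Qed.

Lemma wt_nonneg k t : 0 <= t -> wt k t = 1.
Proof. intros. unfold wt. rewrite Rmin_right by lra. rewrite Rmult_0_r. apply exp_0. Qed.

Lemma wt_anti k k' t : k' <= k -> wt k t <= wt k' t.
Proof. intros. unfold wt. apply exp_mono. pose proof (Rmin_r t 0). nra. Qed.

Lemma wt_mult k k' t : wt k t * wt k' t = wt (k + k') t.
Proof. unfold wt. rewrite <- exp_plus. f_equal; ring. Qed.

Lemma wt_shift k t h : 0 <= k -> 0 <= h -> wt k (t - h) <= wt k t.
Proof.
  intros. unfold wt. apply exp_mono. apply Rmult_le_compat_l; auto.
  apply Rle_min_compat_r. lra.
Qed.

Lemma cont_min0 t : continuous (fun x => Rmin x 0) t.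
Proof.
  intros. apply continuity_pt_filterlim.
  apply continuity_pt_ext with (fun x => (x - Rabs x) / 2).
  - intros x. unfold Rmin. destruct (Rle_dec x 0).
    + rewrite Rabs_left1; lra.
    + rewrite Rabs_right; lra.
  - apply continuity_pt_div.
    + apply continuity_pt_minus; [apply derivable_continuous_pt, derivable_pt_id|apply Rcontinuity_abs].
    + apply continuity_pt_const. intros ? ?; auto.
    + lra.
Qed.

Lemma wt_cont k t : continuous (wt k) t.
Proof.
  intros. unfold wt. apply (continuous_comp (fun x => Rmin x 0) (fun x => exp (k * x))).
  - apply cont_min0.
  - apply cont_expk.
Qed.

(** For [k >= 0] the weight is the minimum of the exponentials of rates [k] and [0], so estimates of
    [J] and [Iop] at these two pure rates transfer to [wb]. *)
Lemma wb_intro k M f : (forall t, continuous f t) -> 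
  (forall t, Rabs (f t) <= M * exp (k * t)) -> (forall t, Rabs (f t) <= M) -> wb k M f.
Proof.
  intros Hc H1 H2. split; auto. intros t. destruct (Rle_dec t 0).
  - rewrite wt_neg; auto.
  - rewrite wt_nonneg by lra. rewrite Rmult_1_r. auto.
Qed.

Lemma wb_pos k M f : wb k M f -> 0 <= M.
Proof.
  intros [_ H]. specialize (H 0). rewrite wt_nonneg in H by lra. pose proof (Rabs_pos (f 0)); lra.
Qed.

Lemma wb_exp k M f : 0 <= k -> wb k M f -> forall t, Rabs (f t) <= M * exp (k * t).
Proof.
  intros Hk H t. pose proof (wb_pos _ _ _ H). eapply Rle_trans; [apply H|].
  apply Rmult_le_compat_l; auto. now apply wt_le_exp.
Qed.

Lemma wb_bd k M f : 0 <= k -> wb k M f -> forall t, Rabs (f t) <= M.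
Proof.
  intros Hk H t. pose proof (wb_pos _ _ _ H). eapply Rle_trans; [apply H|].
  pose proof (wt_le1 k t Hk). nra.
Qed.

Lemma wb_weak k k' M M' f : k' <= k -> M <= M' -> wb k M f -> wb k' M' f.
Proof.
  intros Hk HM H. pose proof (wb_pos _ _ _ H). split; [apply H|].
  intros t. eapply Rle_trans; [apply H|]. pose proof (wt_anti k k' t Hk). pose proof (wt_pos k t).
  apply Rmult_le_compat; lra.
Qed.

Lemma wb_plus k M M' f g : wb k M f -> wb k M' g -> wb k (M + M') (fun t => f t + g t).
Proof.
  intros [H1 H2] [H3 H4]. split.
  - intros t; apply cont_Rplus; auto.
  - intros t. eapply Rle_trans; [apply Rabs_triang|]. specialize (H2 t); specialize (H4 t). lra.
Qed.

Lemma wb_scal k M c f : wb k M f -> wb k (Rabs c * M) (fun t => c * f t).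
Proof.
  intros [H1 H2]. split.
  - intros t; apply cont_Rscal; auto.
  - intros t. rewrite Rabs_mult, Rmult_assoc. apply Rmult_le_compat_l; [apply Rabs_pos|auto].
Qed.

Lemma wb_minus k M M' f g : wb k M f -> wb k M' g -> wb k (M + M') (fun t => f t - g t).
Proof.
  intros [H1 H2] [H3 H4]. split.
  - intros t; apply cont_Rminus; auto.
  - intros t. unfold Rminus. eapply Rle_trans; [apply Rabs_triang|]. rewrite Rabs_Ropp.
    specialize (H2 t); specialize (H4 t). lra.
Qed.

Lemma wb_mult k k' M M' f g : wb k M f -> wb k' M' g -> wb (k + k') (M * M') (fun t => f t * g t).
Proof.
  intros [H1 H2] [H3 H4]. split.
  - intros t; apply cont_Rmult; auto.
  - intros t. rewrite <- wt_mult. replace (M * M' * (wt k t * wt k' t)) with ((M * wt k t) * (M' * wt k' t)) by ring.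
    now apply Rabs_mult_le.
Qed.

Lemma wb_shift k M f h : 0 <= k -> 0 <= h -> wb k M f -> wb k M (fun t => f (t - h)).
Proof.
  intros Hk Hh H. pose proof (wb_pos _ _ _ H). split.
  - intros t. apply cont_shift, H.
  - intros t. eapply Rle_trans; [apply H|]. apply Rmult_le_compat_l; auto. now apply wt_shift.
Qed.

Lemma wb_wt k : wb k 1 (wt k).
Proof.
  split; [apply wt_cont|]. intros t. rewrite Rabs_right; [lra|left; apply wt_pos].
Qed.

Lemma wb_ext k M f g : (forall t, f t = g t) -> wb k M f -> wb k M g.
Proof. intros E H. replace g with f; auto. now apply functional_extensionality. Qed.

Lemma wb_adm N k M f : 0 <= k <= N -> wb k M f -> adm N f.
Proof. intros Hk H. apply (adm_exp N k M); auto. apply H. apply wb_exp; auto; lra. Qed.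

Lemma wb_J1 k M f : 0 <= k -> wb k M f -> wb k M (J 1 f).
Proof.
  intros Hk H. pose proof (wb_pos _ _ _ H).
  assert (L : ladm 0 f) by (apply (adm_ladm0 k); auto; apply (wb_adm k k M); auto; lra).
  apply wb_intro.
  - intros t. eapply is_derive_continuous, is_derive_J, H.
  - intros t. eapply Rle_trans; [apply (J_exp_bound 1 0 k M); auto; try lra; now apply wb_exp|].
    apply Rmult_le_compat_r; [left; apply exp_pos|]. unfold Rdiv.
    rewrite <- (Rmult_1_r M) at 2. apply Rmult_le_compat_l; auto.
    rewrite <- Rinv_1. apply Rinv_le_contravar; lra.
  - intros t. eapply Rle_trans; [apply (J_exp_bound 1 0 0 M); auto; try lra|].
    + intros s. rewrite Rmult_0_l, exp_0, Rmult_1_r. now apply (wb_bd k).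
    + rewrite Rmult_0_l, exp_0. right; field.
Qed.

Lemma wb_Iop N e k M f : small N e -> 0 <= k <= N -> wb k M f -> wb k (2 * M) (Iop e f).
Proof.
  intros He Hk H. assert (Ha := wb_adm N k M f Hk H). apply wb_intro.
  - intros t. apply Iop_cont, H.
  - apply (Iop_exp_bound2 N e); auto; try lra. apply wb_exp; auto; lra.
  - intros t. replace (2 * M) with (2 * M * exp (0 * t)) by (rewrite Rmult_0_l, exp_0; ring).
    apply (Iop_exp_bound2 N e); auto; try lra.
    intros s. rewrite Rmult_0_l, exp_0, Rmult_1_r. apply (wb_bd k); auto; lra.
Qed.

Lemma wb_Iop_diff N e e' k M f : small N e -> small N e' -> 0 <= k <= N -> wb k M f ->
  wb k (20 * Rabs (e ^ 2 - e' ^ 2) * M) (fun t => Iop e f t - Iop e' f t).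
Proof.
  intros He He' Hk H. assert (Ha := wb_adm N k M f Hk H). apply wb_intro.
  - intros t. apply cont_Rminus; apply Iop_cont, H.
  - apply (Iop_diff N e e'); auto; try lra. apply wb_exp; auto; lra.
  - intros t. rewrite <- (Rmult_1_r (20 * _ * _)), <- exp_0, <- (Rmult_0_l t).
    apply (Iop_diff N e e'); auto; try lra.
    intros s. rewrite Rmult_0_l, exp_0, Rmult_1_r. apply (wb_bd k); auto; lra.
Qed.

Lemma xexp_bound x : 0 <= x -> x * exp (- x) <= 1.
Proof.
  intros Hx. pose proof (exp_ineq1_le x). pose proof (exp_pos (- x)).
  assert (exp x * exp (- x) = 1) by (rewrite <- exp_plus, Rplus_opp_r; apply exp_0). nra.
Qed.

(** Differentiating the exponential in its rate brings down a factor [t], which is absorbed at the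
    price of the loss [d] in the exponent. This is where the loss [delta] of the theorem comes
    from. *)
Lemma wt_diff l d z z' t : 0 < d <= l -> l <= z -> l <= z' ->
  Rabs (wt z t - wt z' t) <= / d * Rabs (z - z') * wt (l - d) t.
Proof.
  intros Hd.
  assert (main : forall z z', l <= z -> z <= z' ->
    Rabs (wt z t - wt z' t) <= / d * Rabs (z - z') * wt (l - d) t).
  { clear z z'. intros z z' Hz Hzz.
    rewrite Rabs_right by (pose proof (wt_anti z' z t Hzz); lra).
    rewrite (Rabs_left1 (z - z')) by lra.
    unfold wt. set (u := Rmin t 0). assert (Hu : u <= 0) by apply Rmin_r.
    replace (z' * u) with (z * u + (z' - z) * u) by ring. rewrite exp_plus.
    assert (1 - exp ((z' - z) * u) <= (z' - z) * - u).
    { pose proof (exp_ineq1_le ((z' - z) * u)). lra. }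
    assert (exp (z * u) <= exp ((l - d) * u) * exp (- (d * - u))).
    { rewrite <- exp_plus. apply exp_mono. nra. }
    pose proof (xexp_bound (d * - u) ltac:(nra)).
    pose proof (exp_pos (z * u)); pose proof (exp_pos ((l - d) * u)); pose proof (exp_pos (- (d * - u))).
    apply Rle_trans with (exp (z * u) * ((z' - z) * - u)); [nra|].
    apply Rle_trans with (exp ((l - d) * u) * exp (- (d * - u)) * ((z' - z) * - u)).
    { apply Rmult_le_compat_r; auto. nra. }
    replace (exp ((l - d) * u) * exp (- (d * - u)) * ((z' - z) * - u))
      with (/ d * (z' - z) * exp ((l - d) * u) * (d * - u * exp (- (d * - u)))) by (field; lra).
    replace (/ d * - (z - z') * exp ((l - d) * u)) with (/ d * (z' - z) * exp ((l - d) * u) * 1) by ring.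
    apply Rmult_le_compat_l; auto.
    repeat apply Rmult_le_pos; try lra. left; apply Rinv_0_lt_compat; lra. }
  intros Hz Hz'. destruct (Rle_dec z z').
  - now apply main.
  - rewrite Rabs_minus_sym, (Rabs_minus_sym z). apply main; lra.
Qed.

(** * Decay of the unperturbed front at minus infinity *)

Lemma pow_small (r e : R) : 0 <= r < 1 -> 0 < e -> exists n, forall m, (n <= m)%nat -> r ^ m < e.
Proof.
  intros Hr He. destruct (pow_lt_1_zero r) with (y := e) as [n Hn]; auto.
  { rewrite Rabs_right; lra. }
  exists n. intros m Hm. specialize (Hn m Hm). apply Rabs_def2 in Hn. lra.
Qed.

Lemma geom_limit (u : nat -> R) (A r : R) : 0 <= r < 1 ->
  (forall n, Rabs (u (S n) - u n) <= A * r ^ n) ->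
  exists L, forall n, Rabs (u n - L) <= A / (1 - r) * r ^ n.
Proof.
  intros Hr Hu.
  assert (HA : 0 <= A).
  { specialize (Hu 0%nat). simpl in Hu. pose proof (Rabs_pos (u 1%nat - u 0%nat)). lra. }
  assert (HAr : 0 <= A / (1 - r)) by (apply Rdiv_le_0_compat; lra).
  assert (Hd : forall n k, Rabs (u (n + k)%nat - u n) <= A / (1 - r) * (r ^ n - r ^ (n + k))).
  { intros n k. induction k as [|k IH].
    - rewrite Nat.add_0_r, Rminus_diag, Rabs_R0. lra.
    - replace (u (n + S k)%nat - u n) with ((u (S (n + k)) - u (n + k)%nat) + (u (n + k)%nat - u n))
        by (rewrite Nat.add_succ_r; ring).
      eapply Rle_trans; [apply Rabs_triang|]. specialize (Hu (n + k)%nat).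
      replace (A / (1 - r) * (r ^ n - r ^ (n + S k)))
        with (A * r ^ (n + k) + A / (1 - r) * (r ^ n - r ^ (n + k))).
      + lra.
      + rewrite Nat.add_succ_r. simpl. field. lra. }
  assert (Hd2 : forall n k, Rabs (u (n + k)%nat - u n) <= A / (1 - r) * r ^ n).
  { intros n k. eapply Rle_trans; [apply Hd|]. apply Rmult_le_compat_l; auto.
    assert (0 <= r ^ (n + k)) by (apply pow_le; lra). lra. }
  assert (Hl : ex_finite_lim_seq u).
  { apply ex_lim_seq_cauchy_corr. intros eps.
    destruct (pow_small r (eps / (A / (1 - r) + 1) / 2) Hr) as [N HN].
    { repeat apply Rdiv_lt_0_compat; try apply cond_pos; lra. }
    exists N. intros n m Hn Hm.
    replace n with (N + (n - N))%nat by lia. replace m with (N + (m - N))%nat by lia.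
    replace (u (N + (n - N))%nat - u (N + (m - N))%nat) with
      ((u (N + (n - N))%nat - u N) + - (u (N + (m - N))%nat - u N)) by ring.
    eapply Rle_lt_trans; [apply Rabs_triang|]. rewrite Rabs_Ropp.
    pose proof (Hd2 N (n - N)%nat); pose proof (Hd2 N (m - N)%nat).
    specialize (HN N (Nat.le_refl N)).
    assert (A / (1 - r) * r ^ N <= (A / (1 - r)) * (eps / (A / (1 - r) + 1) / 2)) by (apply Rmult_le_compat_l; lra).
    assert ((A / (1 - r)) * (eps / (A / (1 - r) + 1) / 2) < eps / 2); [|lra].
    pose proof (cond_pos eps). set (B := A / (1 - r)) in *.
    apply Rmult_lt_reg_r with (2 * (B + 1)); [lra|].
    replace (B * (eps / (B + 1) / 2) * (2 * (B + 1))) with (B * eps) by (field; lra). nra. }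
  destruct Hl as [L HL]. exists L. intros n. rewrite Rabs_minus_sym.
  assert (Hab : is_lim_seq (fun k => Rabs (u (n + k)%nat - u n)) (Rabs (L - u n))).
  { apply (is_lim_seq_abs _ (L - u n)). apply is_lim_seq_minus'; [|apply is_lim_seq_const].
    apply (is_lim_seq_ext (fun k => u (k + n)%nat)); [intros; f_equal; lia|].
    now apply (is_lim_seq_incr_n u n L). }
  apply (is_lim_seq_le (fun k => Rabs (u (n + k)%nat - u n)) (fun _ => A / (1 - r) * r ^ n)
    (Rabs (L - u n)) (A / (1 - r) * r ^ n)); auto. apply is_lim_seq_const.
Qed.

(** With [k = exp (- a * h)], the value [y tau] keeps at least the weight [k] during the window: the
    lower bound rises by [k * (y tau - m)] and the upper one falls by [k * (M - y tau)]. The two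
    gains add up to [k * (M - m)] whatever [y tau] is. *)
Lemma window_step (a h tau m M f : R) (y F : R -> R) : 0 < a -> 0 < h ->
  (forall t, tau <= t <= tau + h -> is_derive y t (- a * (y t - y (t - h)) + F t)) ->
  (forall t, tau - h <= t <= tau -> m <= y t <= M) ->
  (forall t, tau <= t <= tau + h -> Rabs (F t) <= f) ->
  exists m' M', (forall t, tau <= t <= tau + h -> m' <= y t <= M') /\
    M' - m' <= (1 - exp (- a * h)) * (M - m) + 2 * f / a /\ m - f / a <= m' /\ M' <= M + f / a.
Proof.
  intros Ha Hh Hd Hw HF.
  assert (Hf : 0 <= f).
  { specialize (HF tau ltac:(lra)). pose proof (Rabs_pos (F tau)); lra. }
  assert (Hfa : 0 <= f / a) by (apply Rdiv_le_0_compat; auto).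
  pose proof (Hw tau ltac:(lra)) as Hy.
  set (k := exp (- a * h)). assert (Hk : 0 < k) by apply exp_pos.
  exists (m - f / a + k * (y tau - m)), (M + f / a - k * (M - y tau)).
  assert (Hexp : forall t, tau <= t <= tau + h -> k * exp (a * t) <= exp (a * tau)).
  { intros t Ht. unfold k. rewrite <- exp_plus. apply exp_mono. nra. }
  assert (L1 : forall t, tau <= t <= tau + h -> m - f / a + k * (y tau - m) <= y t).
  { intros t Ht. 
    assert (Q : exp (a * tau) * (y tau - m + f / a) <= exp (a * t) * (y t - m + f / a)).
    { apply (derive_ge0_le_all (fun x => exp (a * x) * (y x - m + f / a))
        (fun x => exp (a * x) * (a * (y (x - h) - m) + (F x + f)))); [lra|].
      intros x Hx. split.
      - eapply is_derive_eq.
        + apply is_derive_Rmult; [apply is_derive_expk|].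
          apply (is_derive_Rplus (fun x => y x - m) (fun _ => f / a)); [|apply @is_derive_const].
          apply (is_derive_Rminus y (fun _ => m)); [|apply @is_derive_const]. apply Hd; lra.
        + cbv beta. change (@zero R_AbsRing) with 0. change (@zero R_NormedModule) with 0. simpl. field. lra.
      - apply Rmult_le_pos; [left; apply exp_pos|].
        specialize (HF x ltac:(lra)). apply Rabs_le_between in HF.
        specialize (Hw (x - h) ltac:(lra)). nra. }
    specialize (Hexp t Ht). pose proof (exp_pos (a * t)).
    assert (k * exp (a * t) * (y tau - m) <= exp (a * t) * (y t - m + f / a)).
    { eapply Rle_trans; [|exact Q]. apply Rle_trans with (exp (a * tau) * (y tau - m)).
      - apply Rmult_le_compat_r; lra.
      - apply Rmult_le_compat_l; [left; apply exp_pos|lra]. }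
    assert (k * (y tau - m) <= y t - m + f / a).
    { apply Rmult_le_reg_l with (exp (a * t)); auto. lra. }
    lra. }
  assert (L2 : forall t, tau <= t <= tau + h -> y t <= M + f / a - k * (M - y tau)).
  { intros t Ht. 
    assert (Q : exp (a * tau) * (M + f / a - y tau) <= exp (a * t) * (M + f / a - y t)).
    { apply (derive_ge0_le_all (fun x => exp (a * x) * (M + f / a - y x))
        (fun x => exp (a * x) * (a * (M - y (x - h)) + (f - F x)))); [lra|].
      intros x Hx. split.
      - eapply is_derive_eq.
        + apply is_derive_Rmult; [apply is_derive_expk|].
          apply (is_derive_Rminus (fun _ => M + f / a) y); [apply @is_derive_const|]. apply Hd; lra.
        + cbv beta. change (@zero R_AbsRing) with 0. change (@zero R_NormedModule) with 0. simpl. field. lra.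
      - apply Rmult_le_pos; [left; apply exp_pos|].
        specialize (HF x ltac:(lra)). apply Rabs_le_between in HF.
        specialize (Hw (x - h) ltac:(lra)). nra. }
    specialize (Hexp t Ht). pose proof (exp_pos (a * t)).
    assert (k * exp (a * t) * (M - y tau) <= exp (a * t) * (M + f / a - y t)).
    { eapply Rle_trans; [|exact Q]. apply Rle_trans with (exp (a * tau) * (M - y tau)).
      - apply Rmult_le_compat_r; lra.
      - apply Rmult_le_compat_l; [left; apply exp_pos|lra]. }
    assert (k * (M - y tau) <= M + f / a - y t).
    { apply Rmult_le_reg_l with (exp (a * t)); auto. lra. }
    lra. }
  split; [|split; [|split]].
  - intros t Ht; split; auto.
  - replace (2 * f / a) with (f / a + f / a) by (field; lra). lra.
  - assert (0 <= k * (y tau - m)) by (apply Rmult_le_pos; lra). lra.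
  - assert (0 <= k * (M - y tau)) by (apply Rmult_le_pos; lra). lra.
Qed.

(** On a window the ratio [max / min] relaxes to [1] up to the relative size of the forcing;
    an ancient solution has had time to relax completely. *)
Lemma ratio_improve (a h rho0 r : R) : 0 < a -> 0 < h -> 0 <= rho0 -> 0 < r ->
  exists i, 0 < i /\ forall (y F : R -> R) (T : R),
  (forall t, t <= T -> is_derive y t (- a * (y t - y (t - h)) + F t)) ->
  (forall t, t <= T -> Rabs (F t) <= i * y (t - h)) ->
  (forall tau, tau <= T -> exists m M, 0 < m /\ M <= (1 + rho0) * m /\
     forall t, tau - h <= t <= tau -> m <= y t <= M) ->
  forall tau s t, tau <= T -> tau - h <= s <= tau -> tau - h <= t <= tau -> y s <= (1 + 2 * r) * y t.
Proof.
  intros Ha Hh Hrho Hr.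
  set (k := exp (- a * h)).
  assert (Hk : 0 < k < 1).
  { split; [apply exp_pos|]. rewrite <- exp_0. apply exp_increasing. nra. }
  (* [D] is chosen so that the relative forcing [i1] below satisfies [i1 * (2 + rho0 + 2 * r) = Rmin
     (k / 2 * r) (/ 2)], which is all that the induction consumes. *)
  set (D := (1 + rho0 + r) * (2 + rho0 + 2 * r)).
  assert (HD : 0 < D) by (unfold D; nra).
  set (i := a * Rmin (k / 2 * r) (/ 2) / D).
  assert (Hmin : 0 < Rmin (k / 2 * r) (/ 2)) by (apply Rmin_pos; nra).
  exists i. split; [unfold i; apply Rdiv_lt_0_compat; nra|].
  intros y F T Hd HF Hh0.
  set (i1 := i * (1 + rho0 + r) / a).
  assert (Hi : 0 < i) by (unfold i; apply Rdiv_lt_0_compat; nra).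
  assert (Hi1 : 0 < i1) by (unfold i1; apply Rdiv_lt_0_compat; nra).
  assert (Hi1' : i1 * (2 + rho0 + 2 * r) = Rmin (k / 2 * r) (/ 2)).
  { unfold i1, i, D. field. repeat split; lra. }
  assert (Q1 : i1 * (2 + rho0 + 2 * r) <= k / 2 * r) by (rewrite Hi1'; apply Rmin_l).
  assert (Q2 : i1 * (2 + rho0 + 2 * r) <= / 2) by (rewrite Hi1'; apply Rmin_r).
  assert (Q3 : i1 <= / 4) by nra.
  (* A window contracts the excess ratio by [1 - k]; half of this gain pays for the forcing, so the
     excess tends to [r] with factor [1 - k / 2]. *)
  assert (claim : forall j tau, tau <= T -> exists m M, 0 < m /\ M <= (1 + (r + (1 - k / 2) ^ j * rho0)) * m /\
     forall t, tau - h <= t <= tau -> m <= y t <= M).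
  { induction j as [|j IH]; intros tau Htau.
    - destruct (Hh0 tau Htau) as [m [M [H1 [H2 H3]]]]. exists m, M. split; [|split]; auto. simpl.
      rewrite Rmult_1_l. eapply Rle_trans; [exact H2|]. apply Rmult_le_compat_r; lra.
    - destruct (IH (tau - h) ltac:(lra)) as [m [M [H1 [H2 H3]]]].
      assert (Hp : 0 <= (1 - k / 2) ^ j <= 1).
      { split; [apply pow_le; lra|]. apply Rle_trans with (1 ^ j); [apply pow_incr; lra|rewrite pow1; lra]. }
      set (rj := r + (1 - k / 2) ^ j * rho0) in *.
      assert (Hrj : r <= rj <= rho0 + r) by (unfold rj; nra).
      assert (HmM : m <= M) by (specialize (H3 (tau - h) ltac:(lra)); lra).
      destruct (window_step a h (tau - h) m M (i * M) y F) as [m' [M' [G1 [G2 [G3 G4]]]]]; auto.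
      { intros t Ht. apply Hd; lra. }
      { intros t Ht. eapply Rle_trans; [apply HF; lra|]. apply Rmult_le_compat_l; [lra|].
        apply H3; lra. }
      replace (tau - h + h) with tau in G1 by ring.
      assert (HiM : i * M / a <= i1 * m).
      { unfold i1. replace (i * (1 + rho0 + r) / a * m) with (i * ((1 + rho0 + r) * m) / a) by (field; lra).
        apply Rmult_le_compat_r; [left; now apply Rinv_0_lt_compat|]. apply Rmult_le_compat_l; [lra|]. nra. }
      replace (2 * (i * M) / a) with (2 * (i * M / a)) in G2 by (field; lra).
      assert (Hm' : (1 - i1) * m <= m') by lra.
      assert (Hm'0 : 0 < m') by nra.
      exists m', M'. split; [|split]; auto.
      replace (r + (1 - k / 2) ^ S j * rho0) with ((1 - k / 2) * rj + k / 2 * r) by (unfold rj; simpl; ring).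
      fold k in G2.
      assert (M' - m' <= ((1 - k) * rj + 2 * i1) * m).
      { assert ((1 - k) * (M - m) <= (1 - k) * (rj * m)) by (apply Rmult_le_compat_l; lra). lra. }
      assert (((1 - k) * rj + 2 * i1) <= (1 - i1) * ((1 - k / 2) * rj + k / 2 * r)).
      { assert (i1 * ((1 - k / 2) * rj + k / 2 * r) <= i1 * (rho0 + 2 * r)) by (apply Rmult_le_compat_l; nra).
        assert (0 <= k / 2 * rj) by nra. lra. }
      assert (((1 - k) * rj + 2 * i1) * m <= ((1 - k / 2) * rj + k / 2 * r) * ((1 - i1) * m)).
      { replace (((1 - k / 2) * rj + k / 2 * r) * ((1 - i1) * m)) with
          ((1 - i1) * ((1 - k / 2) * rj + k / 2 * r) * m) by ring. apply Rmult_le_compat_r; lra. }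
      assert (0 <= (1 - k / 2) * rj + k / 2 * r) by nra.
      assert (((1 - k / 2) * rj + k / 2 * r) * ((1 - i1) * m) <= ((1 - k / 2) * rj + k / 2 * r) * m')
        by (apply Rmult_le_compat_l; auto).
      lra. }
  intros tau s t Htau Hs Ht.
  destruct (pow_small (1 - k / 2) (r / (rho0 + 1))) as [j Hj]; [lra|apply Rdiv_lt_0_compat; lra|].
  destruct (claim j tau Htau) as [m [M [H1 [H2 H3]]]].
  specialize (Hj j (Nat.le_refl j)).
  assert ((1 - k / 2) ^ j * rho0 <= r).
  { assert (0 <= (1 - k / 2) ^ j) by (apply pow_le; lra).
    apply Rle_trans with ((1 - k / 2) ^ j * (rho0 + 1)); [nra|].
    apply Rmult_lt_compat_r with (r := rho0 + 1) in Hj; [|lra].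
    replace (r / (rho0 + 1) * (rho0 + 1)) with r in Hj by (field; lra). lra. }
  pose proof (H3 s Hs); pose proof (H3 t Ht).
  apply Rle_trans with M; [lra|]. apply Rle_trans with ((1 + 2 * r) * m).
  - eapply Rle_trans; [exact H2|]. apply Rmult_le_compat_r; lra.
  - apply Rmult_le_compat_l; lra.
Qed.

Lemma steps_back (h T t : R) : 0 < h -> t <= T -> exists n : nat, T - INR (S n) * h <= t <= T - INR n * h.
Proof.
  intros Hh Ht. destruct (nfloor_ex ((T - t) / h)) as [n [Hn1 Hn2]].
  { apply Rdiv_le_0_compat; lra. }
  exists n. rewrite S_INR.
  apply Rmult_le_compat_r with (r := h) in Hn1; [|lra].
  apply Rmult_lt_compat_r with (r := h) in Hn2; [|lra].
  replace ((T - t) / h * h) with (T - t) in * by (field; lra). lra.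
Qed.

(** Chaining the ratio bound over consecutive windows limits both growth and decay towards [-oo] to
    the rate [d], which is small when [q] is close to [1]. The second inequality is the one that
    excludes a vanishing leading coefficient in [psi_asym]. *)
Lemma exp_control (h T d q : R) (y : R -> R) : 0 < h -> 0 <= d -> 1 <= q -> q <= exp (d * h) ->
  (forall t, t <= T -> 0 < y t) ->
  (forall tau s t, tau <= T -> tau - h <= s <= tau -> tau - h <= t <= tau -> y s <= q * y t) ->
  forall t, t <= T -> y t <= y T * exp (d * (T - t + h)) /\ y T <= y t * exp (d * (T - t + h)).
Proof.
  intros Hh Hd0 Hq1 Hq Hy Hw.
  assert (claim : forall n t, T - INR (S n) * h <= t <= T - INR n * h ->
    y t <= y T * q ^ (S n) /\ y T <= y t * q ^ (S n)).
  { induction n as [|n IH]; intros t Ht.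
    - simpl in Ht. simpl. rewrite Rmult_1_r. split.
      + rewrite Rmult_comm. apply (Hw T); lra.
      + rewrite Rmult_comm. apply (Hw T); lra.
    - destruct (IH (t + h)) as [I1 I2].
      { rewrite !S_INR in *. lra. }
      assert (t + h <= T). { rewrite !S_INR in Ht. pose proof (pos_INR n).
        assert (0 <= INR n * h) by (apply Rmult_le_pos; lra). lra. }
      assert (y t <= q * y (t + h)) by (apply (Hw (t + h)); lra).
      assert (y (t + h) <= q * y t) by (apply (Hw (t + h)); lra).
      assert (0 < q ^ S n) by (apply pow_lt; lra).
      change (q ^ S (S n)) with (q * q ^ S n). set (Q := q ^ S n) in *. split.
      + apply Rle_trans with (q * (y T * Q)); [|right; ring].
        eapply Rle_trans; [eassumption|]. apply Rmult_le_compat_l; lra.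
      + apply Rle_trans with (q * y t * Q); [|right; ring].
        eapply Rle_trans; [exact I2|]. apply Rmult_le_compat_r; lra. }
  intros t Ht. destruct (steps_back h T t Hh Ht) as [n Hn].
  destruct (claim n t Hn) as [C1 C2].
  assert (E : q ^ S n <= exp (d * (T - t + h))).
  { apply Rle_trans with (exp (d * h) ^ S n); [apply pow_incr; lra|].
    assert (forall m, exp (d * h) ^ m = exp (d * h * INR m)).
    { induction m as [|m IHm]; [now rewrite Rmult_0_r, exp_0|].
      rewrite S_INR, Rmult_plus_distr_l, exp_plus, <- IHm. simpl. rewrite Rmult_1_r. ring. }
    rewrite H. apply exp_mono. rewrite S_INR in *. nra. }
  pose proof (Hy t Ht); pose proof (Hy T (Rle_refl T)).
  assert (0 < q ^ S n) by (apply pow_lt; lra).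
  split; (eapply Rle_trans; [eassumption|]); apply Rmult_le_compat_l; lra.
Qed.

(** The oscillation shrinks by [1 - exp (- a * h)] per window, while the a priori bound grows by
    [exp (d * h)] for each window further back. As the product is below [1], starting from ever
    earlier windows leaves only the contribution of the forcing. *)
Lemma osc_limit (a h T d gam C1 Cf : R) (y F : R -> R) : 0 < a -> 0 < h -> 0 < gam -> 0 <= d ->
  (1 - exp (- a * h)) * exp (d * h) < 1 ->
  (forall t, t <= T -> is_derive y t (- a * (y t - y (t - h)) + F t)) ->
  (forall t, t <= T -> Rabs (F t) <= Cf * exp (gam * t)) ->
  (forall t, t <= T -> 0 <= y t <= C1 * exp (- d * t)) ->
  exists c0 C, forall t, t <= T -> Rabs (y t - c0) <= C * exp (gam * t).
Proof.
  intros Ha Hh Hg Hd Hth Hy HF Hb.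
  set (theta := 1 - exp (- a * h)) in *.
  assert (Ht0 : 0 < theta < 1).
  { assert (exp (- a * h) < 1) by (rewrite <- exp_0; apply exp_increasing; nra).
    pose proof (exp_pos (- a * h)). unfold theta; lra. }
  assert (HCf : 0 <= Cf).
  { specialize (HF T (Rle_refl T)). pose proof (Rabs_pos (F T)). pose proof (exp_pos (gam * T)). nra. }
  assert (HC1 : 0 <= C1).
  { specialize (Hb T (Rle_refl T)). pose proof (exp_pos (- d * T)). nra. }
  (* [X] solves [X = theta * X + 2 * Cf / a], so the forcing term reproduces itself along the
     induction. *)
  set (X := 2 * Cf / a / (1 - theta)).
  assert (HX : 0 <= X).
  { unfold X. repeat apply Rdiv_le_0_compat; lra. }
  assert (claim : forall j tau, tau <= T -> exists m M,
    M - m <= theta ^ j * C1 * exp (- d * (tau - INR (S j) * h)) + X * exp (gam * tau) /\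
    forall t, tau - h <= t <= tau -> m <= y t <= M).
  { induction j as [|j IH]; intros tau Htau.
    - exists 0, (C1 * exp (- d * (tau - INR 1 * h))). split.
      + simpl. pose proof (exp_pos (gam * tau)). nra.
      + intros t Ht. specialize (Hb t ltac:(lra)). split; [lra|].
        eapply Rle_trans; [apply Hb|]. apply Rmult_le_compat_l; auto. apply exp_mono. simpl. nra.
    - destruct (IH (tau - h) ltac:(lra)) as [m [M [H1 H2]]].
      destruct (window_step a h (tau - h) m M (Cf * exp (gam * tau)) y F) as [m' [M' [G1 [G2 _]]]]; auto.
      { intros t Ht. apply Hy; lra. }
      { intros t Ht. eapply Rle_trans; [apply HF; lra|]. apply Rmult_le_compat_l; auto. apply exp_mono. nra. }
      replace (tau - h + h) with tau in G1 by ring.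
      exists m', M'. split; auto.
      replace (tau - h - INR (S j) * h) with (tau - INR (S (S j)) * h) in H1 by (rewrite (S_INR (S j)); ring).
      eapply Rle_trans; [exact G2|]. fold theta.
      assert (theta * (M - m) <= theta * (theta ^ j * C1 * exp (- d * (tau - INR (S (S j)) * h)) +
               X * exp (gam * tau))).
      { apply Rmult_le_compat_l; [lra|]. eapply Rle_trans; [exact H1|]. apply Rplus_le_compat_l.
        apply Rmult_le_compat_l; auto. apply exp_mono; nra. }
      simpl pow.
      replace (X * exp (gam * tau)) with (theta * (X * exp (gam * tau)) + 2 * (Cf * exp (gam * tau)) / a).
      { lra. }
      unfold X. field. lra. }
  (* Letting [j] tend to infinity in [claim] removes the a priori bound. The summable oscillations
     then make the values at [T - n h] converge geometrically. *)
  assert (osc : forall tau s t, tau <= T -> tau - h <= s <= tau -> tau - h <= t <= tau ->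
    Rabs (y s - y t) <= X * exp (gam * tau)).
  { intros tau s t Htau Hs Ht. apply Rnot_lt_le. intros Hlt.
    set (gap := Rabs (y s - y t) - X * exp (gam * tau)) in *.
    set (A := C1 * exp (- d * (tau - h)) + 1).
    assert (HA : 0 < A) by (unfold A; pose proof (exp_pos (- d * (tau - h))); nra).
    destruct (pow_small (theta * exp (d * h)) (gap / A)) as [j Hj].
    { split; auto. pose proof (exp_pos (d * h)). nra. }
    { apply Rdiv_lt_0_compat; unfold gap; lra. }
    specialize (Hj j (Nat.le_refl j)).
    destruct (claim j tau Htau) as [m [M [H1 H2]]].
    pose proof (H2 s Hs); pose proof (H2 t Ht).
    assert (Rabs (y s - y t) <= M - m) by (apply Rabs_le; lra).
    assert (E : theta ^ j * C1 * exp (- d * (tau - INR (S j) * h)) =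
      (theta * exp (d * h)) ^ j * (C1 * exp (- d * (tau - h)))).
    { assert (Hp : forall m, exp (d * h) ^ m = exp (d * h * INR m)).
      { clear. induction m as [|m IHm]; [now rewrite Rmult_0_r, exp_0|].
        rewrite S_INR, Rmult_plus_distr_l, exp_plus, <- IHm. simpl. rewrite Rmult_1_r. ring. }
      rewrite Rpow_mult_distr, Hp.
      replace (- d * (tau - INR (S j) * h)) with (d * h * INR j + - d * (tau - h)) by (rewrite S_INR; ring).
      rewrite exp_plus. ring. }
    rewrite E in H1.
    assert (0 <= (theta * exp (d * h)) ^ j) by (apply pow_le; pose proof (exp_pos (d * h)); nra).
    assert ((theta * exp (d * h)) ^ j * (C1 * exp (- d * (tau - h))) <= (theta * exp (d * h)) ^ j * A).
    { apply Rmult_le_compat_l; auto. unfold A; lra. }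
    apply Rmult_lt_compat_r with (r := A) in Hj; auto.
    replace (gap / A * A) with gap in Hj by (field; lra). unfold gap in *. lra. }
  set (r := exp (- gam * h)).
  assert (Hr : 0 <= r < 1).
  { split; [left; apply exp_pos|]. unfold r. rewrite <- exp_0. apply exp_increasing. nra. }
  assert (Hpow : forall n, exp (gam * (T - INR n * h)) = exp (gam * T) * r ^ n).
  { induction n as [|n IHn]; [simpl; rewrite Rmult_1_r; f_equal; ring|].
    rewrite S_INR. replace (gam * (T - (INR n + 1) * h)) with (- gam * h + gam * (T - INR n * h)) by ring.
    rewrite exp_plus, IHn. fold r. simpl. ring. }
  destruct (geom_limit (fun n => y (T - INR n * h)) (X * exp (gam * T)) r Hr) as [c0 Hc0].
  { intros n. rewrite Rmult_assoc, <- Hpow. pose proof (pos_INR n).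
    apply osc; rewrite ?S_INR; nra. }
  exists c0, (exp (gam * h) * (X + X / (1 - r))).
  intros t Ht. destruct (steps_back h T t Hh Ht) as [n Hn].
  replace (y t - c0) with ((y t - y (T - INR n * h)) + (y (T - INR n * h) - c0)) by ring.
  eapply Rle_trans; [apply Rabs_triang|].
  assert (O1 : Rabs (y t - y (T - INR n * h)) <= X * exp (gam * (T - INR n * h))).
  { pose proof (pos_INR n). rewrite S_INR in Hn. apply osc; nra. }
  assert (O2 := Hc0 n). cbv beta in O2.
  replace (X * exp (gam * T) / (1 - r) * r ^ n) with (X / (1 - r) * exp (gam * (T - INR n * h))) in O2
    by (rewrite Hpow; field; lra).
  assert (Hxr : 0 <= X + X / (1 - r)).
  { apply Rplus_le_le_0_compat; auto. apply Rdiv_le_0_compat; lra. }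
  apply Rle_trans with ((X + X / (1 - r)) * exp (gam * (T - INR n * h))); [lra|].
  replace (exp (gam * h) * (X + X / (1 - r)) * exp (gam * t)) with
    ((X + X / (1 - r)) * exp (gam * (t + h))) by (rewrite Rmult_plus_distr_l, exp_plus; ring).
  apply Rmult_le_compat_l; auto. apply exp_mono. rewrite S_INR in Hn. nra.
Qed.

Lemma exp_gt1 x : 0 < x -> 1 < exp x.
Proof. intros. rewrite <- exp_0. now apply exp_increasing. Qed.

Lemma exp_rate (th0 h m : R) : 0 < th0 < 1 -> 0 < h -> 0 < m ->
  exists d, 0 < d <= m /\ th0 * exp (d * h) < 1.
Proof.
  intros Ht Hh Hm. set (d1 := - ln th0 / (2 * h)).
  assert (Hln : ln th0 < 0) by (rewrite <- ln_1; apply ln_increasing; lra).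
  assert (Hd1 : 0 < d1) by (unfold d1; apply Rdiv_lt_0_compat; lra).
  exists (Rmin m d1). split; [split; [now apply Rmin_pos|apply Rmin_l]|].
  rewrite <- (exp_ln th0) at 1 by lra. rewrite <- exp_plus, <- exp_0. apply exp_increasing.
  assert (Rmin m d1 * h <= d1 * h) by (apply Rmult_le_compat_r; [lra|apply Rmin_r]).
  replace (d1 * h) with (- ln th0 / 2) in H by (unfold d1; field; lra). lra.
Qed.

Lemma psi_asym (h p lam CN T0 : R) (psi G : R -> R) :
  0 < h -> 0 < lam -> 0 < p -> lam + 1 = p * exp (- lam * h) ->
  (forall t, 0 < psi t) -> (forall t, is_derive psi t (- psi t + G (psi (t - h)))) ->
  (forall t, 0 <= G (psi t)) ->
  (forall t, t <= T0 -> Rabs (G (psi t) - p * psi t) <= CN * (psi t) ^ 2) ->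
  is_lim psi m_infty 0 ->
  exists c0 C T, 0 < c0 /\ forall t, t <= T -> Rabs (psi t - c0 * exp (lam * t)) <= C * exp (3 / 2 * lam * t).
Proof.
  intros Hh Hl Hp Hchar Hpos Hd HG HN Hlim.
  set (a := lam + 1) in *. assert (Ha : 0 < a) by (unfold a; lra).
  set (y := fun t => psi t * exp (- lam * t)).
  set (F := fun t => exp (- lam * t) * (G (psi (t - h)) - p * psi (t - h))).
  assert (Hy : forall t, 0 < y t).
  { intros t. apply Rmult_lt_0_compat; auto. apply exp_pos. }
  assert (Hyd : forall t, is_derive y t (- a * (y t - y (t - h)) + F t)).
  { intros t. eapply is_derive_eq.
    - apply is_derive_Rmult; [apply Hd|apply is_derive_expk].
    - unfold y, F. replace (- lam * (t - h)) with (- lam * t + lam * h) by ring. rewrite exp_plus.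
      assert (E : p = a * exp (lam * h)).
      { rewrite Hchar, Rmult_assoc, <- exp_plus.
        replace (- lam * h + lam * h) with 0 by ring. rewrite exp_0. ring. }
      rewrite E. unfold a. ring. }
  assert (Hmono : forall s t, s <= t -> psi s <= exp (t - s) * psi t).
  { intros s t Hst.
    assert (exp (1 * s) * psi s <= exp (1 * t) * psi t).
    { apply (derive_ge0_le_all (fun x => exp (1 * x) * psi x) (fun x => exp (1 * x) * G (psi (x - h)))); auto.
      intros x _. split.
      - eapply is_derive_eq; [apply is_derive_Rmult; [apply is_derive_expk|apply Hd]|]. cbv beta. ring.
      - apply Rmult_le_pos; auto. left; apply exp_pos. }
    rewrite !Rmult_1_l in H. unfold Rminus. rewrite exp_plus, exp_Ropp.
    pose proof (exp_pos s). apply Rmult_le_reg_l with (exp s); auto.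
    replace (exp s * (exp t * / exp s * psi t)) with (exp t * psi t) by (field; lra). auto. }
  (* Near [-oo], [psi' <= (p + 1) * psi (t - h) <= L * psi t], by [Hmono]. Together with [Hmono]
     this is a crude Harnack inequality: over a window [y] changes at most by the factor [R0] either
     way, the starting ratio for [ratio_improve]. *)
  set (L := (p + 1) * exp h).
  assert (HL : 0 < L) by (unfold L; apply Rmult_lt_0_compat; [lra|apply exp_pos]).
  set (R0 := exp ((L + lam + 1) * h)).
  assert (HR0 : 1 < R0) by (apply exp_gt1; apply Rmult_lt_0_compat; lra).
  (* With [d <= lam / 8] the error rate [lam - 2 d] stays above [lam / 2], which yields
     [3 / 2 * lam] for [psi], and [lam - 3 d] stays positive, which is used for [0 < c0]. *)
  destruct (exp_rate (1 - exp (- a * h)) h (lam / 8)) as [d [Hdd Hth]]; auto; [|lra|].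
  { assert (exp (- a * h) < 1) by (rewrite <- exp_0; apply exp_increasing; nra).
    pose proof (exp_pos (- a * h)). lra. }
  destruct (ratio_improve a h (R0 * R0 - 1) (d * h / 2)) as [i [Hi Hratio]]; auto; try nra.
  set (CN1 := Rabs CN + 1). assert (HCN1 : 0 < CN1) by (unfold CN1; pose proof (Rabs_pos CN); lra).
  assert (HT1 : exists T1, forall t, t <= T1 -> psi t <= Rmin i 1 / CN1).
  { assert (Hq : 0 < Rmin i 1 / CN1) by (apply Rdiv_lt_0_compat; [apply Rmin_pos; lra|lra]).
    apply is_lim_spec in Hlim. destruct (Hlim (mkposreal _ Hq)) as [M HM]. simpl in HM.
    exists (M - 1). intros t Ht. specialize (HM t ltac:(lra)). rewrite Rminus_0_r in HM.
    rewrite Rabs_right in HM by (apply Rle_ge; left; auto). lra. }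
  destruct HT1 as [T1 HT1].
  set (T := Rmin (Rmin T0 T1) 0).
  assert (HT : T <= T0 /\ T <= T1 /\ T <= 0).
  { unfold T. pose proof (Rmin_l (Rmin T0 T1) 0); pose proof (Rmin_r (Rmin T0 T1) 0);
      pose proof (Rmin_l T0 T1); pose proof (Rmin_r T0 T1); lra. }
  assert (HNrel : forall t, t <= T -> Rabs (G (psi t) - p * psi t) <= Rmin i 1 * psi t).
  { intros t Ht. eapply Rle_trans; [apply HN; lra|]. specialize (HT1 t ltac:(lra)).
    assert (CN1 * psi t <= Rmin i 1).
    { apply Rmult_le_compat_l with (r := CN1) in HT1; [|lra].
      replace (CN1 * (Rmin i 1 / CN1)) with (Rmin i 1) in HT1 by (field; lra). auto. }
    specialize (Hpos t). replace (CN * psi t ^ 2) with (CN * psi t * psi t) by ring.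
    apply Rmult_le_compat_r; [lra|]. pose proof (Rle_abs CN). unfold CN1 in H. nra. }
  assert (Hgrow : forall s t, s <= t -> t <= T -> psi t <= exp (L * (t - s)) * psi s).
  { intros s t Hst Ht.
    assert (- (exp (- L * s) * psi s) <= - (exp (- L * t) * psi t)).
    { apply (derive_ge0_le_all (fun x => - (exp (- L * x) * psi x))
        (fun x => exp (- L * x) * (L * psi x + psi x - G (psi (x - h))))); auto.
      intros x Hx. split.
      - eapply is_derive_eq; [apply (is_derive_opp (fun x => exp (- L * x) * psi x)), is_derive_Rmult;
          [apply is_derive_expk|apply Hd]|]. cbv beta. match goal with |- opp ?x = _ => change (opp x) with (- x) end. ring.
      - apply Rmult_le_pos; [left; apply exp_pos|].
        pose proof (HNrel (x - h) ltac:(lra)). apply Rabs_le_between in H.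
        pose proof (Hpos (x - h)). pose proof (Hpos x). pose proof (Rmin_r i 1).
        assert (Rmin i 1 * psi (x - h) <= 1 * psi (x - h)) by (apply Rmult_le_compat_r; lra).
        pose proof (Hmono (x - h) x ltac:(lra)). replace (x - (x - h)) with h in H4 by ring.
        assert ((p + 1) * psi (x - h) <= (p + 1) * (exp h * psi x)) by (apply Rmult_le_compat_l; lra).
        unfold L. lra. }
    replace (L * (t - s)) with (L * t + - L * s) by ring. rewrite exp_plus.
    pose proof (exp_pos (L * t)).
    assert (E : exp (L * t) * exp (- L * t) = 1).
    { rewrite <- exp_plus. replace (L * t + - L * t) with 0 by ring. apply exp_0. }
    apply Rle_trans with (exp (L * t) * (exp (- L * t) * psi t)).
    - rewrite <- Rmult_assoc, E. lra.
    - rewrite Rmult_assoc. apply Rmult_le_compat_l; lra. }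
  assert (Hratio' : forall tau s t, tau <= T -> tau - h <= s <= tau -> tau - h <= t <= tau ->
    y s <= (1 + 2 * (d * h / 2)) * y t).
  { apply (Hratio y F T).
    - intros; apply Hyd.
    - intros t Ht. unfold F, y. rewrite Rabs_mult, (Rabs_right (exp _)) by (left; apply exp_pos).
      pose proof (HNrel (t - h) ltac:(lra)).
      replace (- lam * (t - h)) with (- lam * t + lam * h) by ring. rewrite exp_plus.
      pose proof (exp_pos (- lam * t)). pose proof (Rmin_l i 1). pose proof (Hpos (t - h)).
      assert (1 <= exp (lam * h)) by (rewrite <- exp_0; apply exp_mono; nra).
      apply Rle_trans with (exp (- lam * t) * (i * psi (t - h))).
      + apply Rmult_le_compat_l; [lra|]. eapply Rle_trans; [exact H|]. apply Rmult_le_compat_r; lra.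
      + replace (i * (psi (t - h) * (exp (- lam * t) * exp (lam * h)))) with
          (exp (- lam * t) * (i * psi (t - h)) * exp (lam * h)) by ring.
        rewrite <- (Rmult_1_r (exp (- lam * t) * (i * psi (t - h)))) at 1.
        apply Rmult_le_compat_l; auto. repeat apply Rmult_le_pos; lra.
    - intros tau Htau. exists (y tau / R0), (y tau * R0). pose proof (Hy tau). split; [|split].
      + apply Rdiv_lt_0_compat; lra.
      + right. field. lra.
      + intros t Ht. split.
        * apply Rmult_le_reg_r with R0; [lra|]. unfold Rdiv. rewrite Rmult_assoc, Rinv_l, Rmult_1_r by lra.
          unfold y. pose proof (Hgrow t tau ltac:(lra) Htau).
          pose proof (Hpos t). pose proof (exp_pos (- lam * t)). pose proof (exp_pos (- lam * tau)).
          assert (exp (- lam * tau) <= exp (- lam * t)) by (apply exp_mono; nra).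
          assert (exp (L * (tau - t)) <= R0) by (apply exp_mono; nra).
          apply Rle_trans with (R0 * psi t * exp (- lam * t)); [|right; ring].
          apply Rmult_le_compat; try lra. left; auto.
          eapply Rle_trans; [exact H0|]. apply Rmult_le_compat_r; lra.
        * unfold y. pose proof (Hmono t tau ltac:(lra)).
          pose proof (Hpos tau). pose proof (exp_pos (- lam * t)). pose proof (exp_pos (- lam * tau)).
          apply Rle_trans with (exp (tau - t) * psi tau * exp (- lam * t)); [apply Rmult_le_compat_r; lra|].
          replace (exp (tau - t) * psi tau * exp (- lam * t)) with
            (psi tau * (exp (tau - t) * exp (- lam * t))) by ring.
          rewrite <- exp_plus, Rmult_assoc. apply Rmult_le_compat_l; [lra|].
          unfold R0. rewrite <- exp_plus. apply exp_mono. nra. }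
  assert (Hctl := exp_control h T d (1 + 2 * (d * h / 2)) y Hh ltac:(lra) ltac:(nra)).
  assert (Hctl' : forall t, t <= T -> y t <= y T * exp (d * (T - t + h)) /\ y T <= y t * exp (d * (T - t + h))).
  { apply Hctl; auto. pose proof (exp_ineq1_le (d * h)). lra. }
  clear Hctl Hratio.
  set (B := y T * exp (d * (T + h))).
  assert (HB : 0 < B) by (apply Rmult_lt_0_compat; auto; apply exp_pos).
  assert (HyB : forall t, t <= T -> 0 <= y t <= B * exp (- d * t)).
  { intros t Ht. split; [left; auto|]. destruct (Hctl' t Ht) as [H _].
    eapply Rle_trans; [exact H|]. unfold B. rewrite Rmult_assoc, <- exp_plus. right. do 2 f_equal. ring. }
  assert (HCN : 0 <= Rabs CN) by apply Rabs_pos.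
  (* [psi] is of size [exp ((lam - d) t)] and [F] is quadratic in [psi] up to the factor
     [exp (- lam t)], hence the rate [lam - 2 d] of the forcing. *)
  destruct (osc_limit a h T d (lam - 2 * d) B (Rabs CN * (B * B) * exp (2 * d * h)) y F) as [c0 [C HC]]; auto; try lra.
  { intros t Ht. unfold F. rewrite Rabs_mult, (Rabs_right (exp _)) by (left; apply exp_pos).
    pose proof (HN (t - h) ltac:(lra)).
    assert (E : psi (t - h) = y (t - h) * exp (lam * (t - h))).
    { unfold y. rewrite Rmult_assoc, <- exp_plus. replace (- lam * (t - h) + lam * (t - h)) with 0 by ring.
      rewrite exp_0. ring. }
    pose proof (HyB (t - h) ltac:(lra)) as [Y1 Y2].
    assert (P2 : psi (t - h) <= B * exp ((lam - d) * (t - h))).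
    { rewrite E. replace ((lam - d) * (t - h)) with (- d * (t - h) + lam * (t - h)) by ring.
      rewrite exp_plus.
      replace (B * (exp (- d * (t - h)) * exp (lam * (t - h)))) with
        ((B * exp (- d * (t - h))) * exp (lam * (t - h))) by ring.
      apply Rmult_le_compat_r; [left; apply exp_pos|exact Y2]. }
    pose proof (Hpos (t - h)).
    apply Rle_trans with (exp (- lam * t) * (Rabs CN * ((B * exp ((lam - d) * (t - h))) * (B * exp ((lam - d) * (t - h)))))).
    - apply Rmult_le_compat_l; [left; apply exp_pos|]. eapply Rle_trans; [exact H|].
      apply Rle_trans with (Rabs CN * psi (t - h) ^ 2).
      + apply Rmult_le_compat_r; [apply pow2_ge_0|apply Rle_abs].
      + apply Rmult_le_compat_l; auto. simpl. rewrite Rmult_1_r. apply Rmult_le_compat; lra.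
    - replace (exp (- lam * t) * (Rabs CN * (B * exp ((lam - d) * (t - h)) * (B * exp ((lam - d) * (t - h))))))
        with (Rabs CN * (B * B) * (exp (- lam * t) * (exp ((lam - d) * (t - h)) * exp ((lam - d) * (t - h))))) by ring.
      rewrite (Rmult_assoc (Rabs CN * (B * B))). apply Rmult_le_compat_l; [apply Rmult_le_pos; [lra|]; apply Rmult_le_pos; lra|].
      rewrite <- !exp_plus. apply exp_mono. nra. }
  exists c0, C, T. split.
  - apply Rnot_le_lt. intros Hc.
    assert (HC0 : 0 <= C).
    { specialize (HC T (Rle_refl T)). pose proof (Rabs_pos (y T - c0)). pose proof (exp_pos ((lam - 2 * d) * T)). nra. }
    (* [y >= c exp (d t)] is incompatible with [y <= C exp ((lam - 2 d) t)] *)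
    destruct (exp_neg_small (lam - 3 * d) (y T / ((C + 1) * exp (d * (T + h))))) as [T2 HT2]; [lra| |].
    { apply Rdiv_lt_0_compat; auto. pose proof (exp_pos (d * (T + h))). nra. }
    set (t := Rmin T T2). assert (t <= T /\ t <= T2) as [Ht1 Ht2] by (split; [apply Rmin_l|apply Rmin_r]).
    destruct (Hctl' t Ht1) as [_ Hlow]. specialize (HC t Ht1). specialize (HT2 t Ht2).
    apply Rabs_le_between in HC.
    pose proof (exp_pos (d * (T + h))) as E0. pose proof (exp_pos ((lam - 2 * d) * t)) as E1.
    assert (y t <= (C + 1) * exp ((lam - 2 * d) * t)) by nra.
    assert (y T <= (C + 1) * exp ((lam - 2 * d) * t) * exp (d * (T - t + h))).
    { eapply Rle_trans; [exact Hlow|]. apply Rmult_le_compat_r; [left; apply exp_pos|auto]. }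
    replace ((C + 1) * exp ((lam - 2 * d) * t) * exp (d * (T - t + h))) with
      ((C + 1) * exp (d * (T + h)) * exp ((lam - 3 * d) * t)) in H0.
    2: { rewrite !Rmult_assoc, <- !exp_plus. do 2 f_equal. ring. }
    assert (HQ : 0 < (C + 1) * exp (d * (T + h))) by nra.
    apply Rmult_lt_compat_l with (r := (C + 1) * exp (d * (T + h))) in HT2; auto.
    replace ((C + 1) * exp (d * (T + h)) * (y T / ((C + 1) * exp (d * (T + h))))) with (y T) in HT2 by (field; lra).
    lra.
  - intros t Ht. replace (psi t - c0 * exp (lam * t)) with ((y t - c0) * exp (lam * t)).
    2: { unfold y. rewrite Rmult_minus_distr_r, Rmult_assoc, <- exp_plus.
         replace (- lam * t + lam * t) with 0 by ring. rewrite exp_0. ring. }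
    rewrite Rabs_mult, (Rabs_right (exp _)) by (left; apply exp_pos).
    assert (HC0 : 0 <= C).
    { specialize (HC T (Rle_refl T)). pose proof (Rabs_pos (y T - c0)). pose proof (exp_pos ((lam - 2 * d) * T)). nra. }
    apply Rle_trans with (C * exp ((lam - 2 * d) * t) * exp (lam * t)).
    + apply Rmult_le_compat_r; [left; apply exp_pos|auto].
    + rewrite Rmult_assoc, <- exp_plus. apply Rmult_le_compat_l; auto. apply exp_mono. nra.
Qed.

(** * Linear extension of the nonlinearity *)

(** Functions met by the contraction may take negative values, where [g] carries no information.
    With the slope [p = g' 0] the extension stays [C^1] and has no nonlinear part on the left; as
    the branch turns out positive, it solves the original equation. *)
Definition Gext (g : R -> R) (p u : R) : R := if Rle_dec 0 u then g u else p * u.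
Definition dGext (g' : R -> R) (p u : R) : R := if Rle_dec 0 u then g' u else p.

Lemma Gext_pos g p u : 0 <= u -> Gext g p u = g u.
Proof. intros. unfold Gext. destruct (Rle_dec 0 u); [auto|lra]. Qed.
Lemma dGext_pos g' p u : 0 <= u -> dGext g' p u = g' u.
Proof. intros. unfold dGext. destruct (Rle_dec 0 u); [auto|lra]. Qed.
Lemma Gext_neg g p u : g 0 = 0 -> u <= 0 -> Gext g p u = p * u.
Proof.
  intros H Hu. unfold Gext. destruct (Rle_dec 0 u); [|auto].
  replace u with 0 by lra. rewrite H; ring.
Qed.

Lemma within_eps (D : R -> Prop) (f : R -> R) (l x : R) :
  filterlim f (within D (locally x)) (locally l) ->
  forall eps, 0 < eps -> exists d, 0 < d /\ forall y, Rabs (y - x) < d -> D y -> Rabs (f y - l) < eps.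
Proof.
  intros H eps He. apply (proj1 (filterlim_locally f l)) with (eps := mkposreal eps He) in H.
  destruct H as [d Hd]. exists d. split; [apply cond_pos|]. intros y Hy HD. apply (Hd y); auto.
Qed.

Lemma cont_eps (f : R -> R) (x : R) :
  (forall eps, 0 < eps -> exists d, 0 < d /\ forall y, Rabs (y - x) < d -> Rabs (f y - f x) < eps) ->
  continuous f x.
Proof.
  intros H. apply filterlim_locally. intros [eps He]. destruct (H eps He) as [d [Hd1 Hd2]].
  exists (mkposreal d Hd1). intros y Hy. apply (Hd2 y). exact Hy.
Qed.

Lemma eps_cont (f : R -> R) (x : R) : continuous f x ->
  (forall eps, 0 < eps -> exists d, 0 < d /\ forall y, Rabs (y - x) < d -> Rabs (f y - f x) < eps).
Proof.
  intros H eps He. apply (proj1 (filterlim_locally f (f x))) with (eps := mkposreal eps He) in H.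
  destruct H as [d Hd]. exists d. split; [apply cond_pos|]. intros y Hy. apply (Hd y); auto.
Qed.

Section Extension.
Variables g g' : R -> R.
Hypothesis Hg0 : g 0 = 0.
Hypothesis HC1 : C1_nonneg g g'.
Let p := g' 0.

Lemma Gext_derive u : is_derive (Gext g p) u (dGext g' p u).
Proof.
  apply is_derive_Reals. intros eps He.
  destruct (Rle_dec 0 u) as [Hu|Hu].
  - rewrite dGext_pos by auto. destruct (HC1 u Hu) as [H1 _].
    destruct (within_eps _ _ _ _ H1 eps He) as [d [Hd Hb]].
    destruct (Req_dec u 0) as [E|E].
    + exists (mkposreal d Hd). intros k Hk Hkd. simpl in Hkd. subst u.
      destruct (Rle_dec 0 k).
      * rewrite !Gext_pos by lra. specialize (Hb (0 + k)). replace (0 + k - 0) with k in Hb by ring.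
        apply Hb; auto. unfold Defs.nonneg; split; lra.
      * rewrite (Gext_neg g p (0 + k)), (Gext_neg g p 0) by lra. fold p.
        replace ((p * (0 + k) - p * 0) / k - p) with 0 by (field; lra). rewrite Rabs_R0; auto.
    + assert (Hm : 0 < Rmin d u) by (apply Rmin_pos; lra).
      exists (mkposreal _ Hm). intros k Hk Hkd. simpl in Hkd.
      pose proof (Rmin_l d u); pose proof (Rmin_r d u).
      assert (- u < k) by (apply Rabs_def2 in Hkd; lra).
      rewrite !Gext_pos by lra. specialize (Hb (u + k)). replace (u + k - u) with k in Hb by ring.
      apply Hb; [lra|]. unfold Defs.nonneg; split; lra.
  - assert (Hm : 0 < - u) by lra. exists (mkposreal _ Hm). intros k Hk Hkd. simpl in Hkd.
    apply Rabs_def2 in Hkd. rewrite !Gext_neg by lra.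
    unfold dGext. destruct (Rle_dec 0 u); [lra|].
    replace ((p * (u + k) - p * u) / k - p) with 0 by (field; lra). rewrite Rabs_R0; auto.
Qed.

Lemma dGext_cont u : continuous (dGext g' p) u.
Proof.
  apply cont_eps. intros eps He. destruct (Rle_dec 0 u) as [Hu|Hu].
  - destruct (HC1 u Hu) as [_ H1]. destruct (within_eps _ _ _ _ H1 eps He) as [d [Hd Hb]].
    destruct (Req_dec u 0) as [E|E].
    + exists d. split; auto. intros y Hy. rewrite (dGext_pos g' p u) by lra.
      destruct (Rle_dec 0 y).
      * rewrite dGext_pos by lra. apply Hb; auto.
      * unfold dGext. destruct (Rle_dec 0 y); [lra|]. subst u. unfold p. rewrite Rminus_diag, Rabs_R0; auto.
    + exists (Rmin d u). split; [apply Rmin_pos; lra|]. intros y Hy.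
      pose proof (Rmin_l d u); pose proof (Rmin_r d u).
      assert (0 < y) by (assert (Q : Rabs (y - u) < u) by lra; apply Rabs_def2 in Q; lra).
      rewrite !dGext_pos by lra. apply Hb; [lra|]. unfold Defs.nonneg; lra.
  - exists (- u). split; [lra|]. intros y Hy. apply Rabs_def2 in Hy.
    unfold dGext. destruct (Rle_dec 0 u); [lra|]. destruct (Rle_dec 0 y); [lra|].
    rewrite Rminus_diag, Rabs_R0; auto.
Qed.

Lemma Gext_0 : Gext g p 0 = 0.
Proof. rewrite Gext_pos; auto; lra. Qed.

Lemma cont_bounded (f : R -> R) (a b : R) : (forall x, continuous f x) ->
  exists M, 0 <= M /\ forall x, a <= x <= b -> Rabs (f x) <= M.
Proof.
  clear. intros Hc. destruct (Rle_dec a b) as [Hab|Hab].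
  - destruct (continuity_ab_maj (fun x => Rabs (f x)) a b Hab) as [Mx [H1 H2]].
    + intros c _. apply (continuity_pt_comp f Rabs); [|apply Rcontinuity_abs].
      apply continuity_pt_filterlim, Hc.
    + exists (Rabs (f Mx)). split; [apply Rabs_pos|auto].
  - exists 0. split; [lra|]. intros; lra.
Qed.

(** Near [0] the one-sided derivative of [g'] at [0] bounds the difference quotient; away from [0],
    boundedness of [dGext] on the interval suffices since [Rabs u >= d] there. *)
Lemma dGext_quad (r0 : R) : 0 < r0 -> C2_on (fun y => 0 <= y /\ y < r0) g' ->
  forall B, exists C, 0 <= C /\ forall u, Rabs u <= B -> Rabs (dGext g' p u - p) <= C * Rabs u.
Proof.
  intros Hr [g'' H2] B. destruct (H2 0 ltac:(lra)) as [H3 _].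
  destruct (within_eps _ _ _ _ H3 1 Rlt_0_1) as [d0 [Hd0 Hb]].
  set (d := Rmin d0 r0). assert (Hd : 0 < d) by (apply Rmin_pos; auto).
  destruct (cont_bounded (dGext g' p) (- B) B dGext_cont) as [M [HM0 HM]].
  set (A := Rabs (g'' 0) + 1). assert (HA : 0 < A) by (unfold A; pose proof (Rabs_pos (g'' 0)); lra).
  set (D := (M + Rabs p) / d).
  assert (HD : 0 <= D) by (unfold D; apply Rdiv_le_0_compat; auto; pose proof (Rabs_pos p); lra).
  exists (A + D). split; [lra|]. intros u Hu. pose proof (Rabs_pos u).
  destruct (Rle_dec d (Rabs u)) as [Hdu|Hdu].
  - apply Rle_trans with (M + Rabs p).
    + unfold Rminus. eapply Rle_trans; [apply Rabs_triang|]. rewrite Rabs_Ropp.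
      apply Rplus_le_compat_r. apply HM. apply Rabs_le_between; auto.
    + apply Rle_trans with (D * d); [right; unfold D; field; lra|]. nra.
  - destruct (Rle_dec u 0) as [Hneg|Hneg].
    + unfold dGext. destruct (Rle_dec 0 u).
      * replace u with 0 by lra. fold p. rewrite Rminus_diag, Rabs_R0. nra.
      * rewrite Rminus_diag, Rabs_R0. nra.
    + rewrite (Rabs_right u) in * by lra. rewrite dGext_pos by lra.
      specialize (Hb u). rewrite !Rminus_0_r in Hb. rewrite (Rabs_right u) in Hb by lra.
      pose proof (Rmin_l d0 r0); pose proof (Rmin_r d0 r0). fold d in H0, H1.
      assert (Hq : Rabs ((g' u - p) / u - g'' 0) < 1) by (apply Hb; lra).
      assert (Hq2 : Rabs ((g' u - p) / u) <= A).
      { replace ((g' u - p) / u) with (((g' u - p) / u - g'' 0) + g'' 0) by ring.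
        eapply Rle_trans; [apply Rabs_triang|]. unfold A. lra. }
      replace (g' u - p) with ((g' u - p) / u * u) by (field; lra).
      rewrite Rabs_mult, (Rabs_right u) by lra. apply Rmult_le_compat_r; lra.
Qed.
End Extension.

Lemma mvt_between (f f' : R -> R) (u v : R) : (forall x, is_derive f x (f' x)) ->
  exists c, Rmin u v <= c <= Rmax u v /\ f u - f v = f' c * (u - v).
Proof.
  intros Hd. destruct (MVT_gen f v u f') as [c [H1 H2]].
  - intros; apply Hd.
  - intros x _. apply continuity_pt_filterlim. eapply is_derive_continuous, Hd.
  - exists c. rewrite Rmin_comm, Rmax_comm. split; auto.
Qed.

Lemma between_abs u v c B : Rmin u v <= c <= Rmax u v -> Rabs u <= B -> Rabs v <= B -> Rabs c <= B.
Proof.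
  intros Hc Hu Hv. apply Rabs_le_between in Hu, Hv. apply Rabs_le.
  destruct (Rle_dec u v).
  - rewrite Rmin_left, Rmax_right in Hc by lra. lra.
  - rewrite Rmin_right, Rmax_left in Hc by lra. lra.
Qed.

(** * Method of steps *)

Lemma cont_max0 t : continuous (fun x => Rmax x 0) t.
Proof.
  apply (continuous_ext (fun x => x - Rmin x 0)).
  - intros x. unfold Rmin, Rmax. destruct (Rle_dec x 0); [change (x - x = 0); ring|change (x - 0 = x); ring].
  - apply cont_Rminus; [apply continuous_id|apply cont_min0].
Qed.

Section Steps.
Variables (h : R) (Gp phi : R -> R).
Hypothesis Hh : 0 < h.
Hypothesis HG : forall x, continuous Gp x.
Hypothesis HG0 : forall x, 0 <= Gp x.
Hypothesis Hphi : forall x, continuous phi x.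
Hypothesis Hphi0 : 0 <= phi 0.

Definition voc (u : R -> R) (t : R) : R :=
  exp (- 1 * t) * (phi 0 + RInt (fun s => exp (1 * s) * Gp (u (s - h))) 0 t).

(** Equal to [phi] on the left and to [voc u] on the right; written with [Rmin] and [Rmax], its
    continuity at the junction is that of a composition. *)
Definition step_map (u : R -> R) (t : R) : R :=
  phi (Rmin t 0) - phi 0 + voc u (Rmax t 0).

Lemma voc_integrand_cont u : (forall x, continuous u x) ->
  forall x, continuous (fun s => exp (1 * s) * Gp (u (s - h))) x.
Proof.
  intros Hu x. apply cont_Rmult; [apply cont_expk|].
  apply (continuous_comp (fun s => u (s - h)) Gp); auto. now apply cont_shift.
Qed.

Lemma voc_derive u t : (forall x, continuous u x) -> is_derive (voc u) t (- voc u t + Gp (u (t - h))).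
Proof.
  intros Hu. unfold voc. eapply is_derive_eq.
  - apply is_derive_Rmult; [apply is_derive_expk|].
    apply (is_derive_Rplus (fun _ => phi 0)); [apply @is_derive_const|].
    apply is_derive_RInt0. now apply voc_integrand_cont.
  - cbv beta. change (@zero R_AbsRing) with 0. change (@zero R_NormedModule) with 0. simpl.
    assert (E : exp (-1 * t) * exp (1 * t) = 1).
    { rewrite <- exp_plus. replace (-1 * t + 1 * t) with 0 by ring. apply exp_0. }
    transitivity (- (exp (-1 * t) * (phi 0 + RInt (fun s => exp (1 * s) * Gp (u (s - h))) 0 t)) +
       exp (-1 * t) * exp (1 * t) * Gp (u (t - h))); [ring|rewrite E; ring].
Qed.

Lemma voc_nonneg u t : (forall x, continuous u x) -> 0 <= t -> 0 <= voc u t.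
Proof.
  intros Hu Ht. unfold voc. apply Rmult_le_pos; [left; apply exp_pos|].
  apply Rplus_le_le_0_compat; auto. apply RInt_ge_0; auto.
  - apply (ex_RInt_continuous (V := R_CompleteNormedModule)). intros; now apply voc_integrand_cont.
  - intros x _. apply Rmult_le_pos; auto. left; apply exp_pos.
Qed.

Lemma step_map_neg u t : t <= 0 -> step_map u t = phi t.
Proof.
  intros Ht. unfold step_map. rewrite Rmin_left, Rmax_right by auto.
  unfold voc. rewrite RInt_point, Rmult_0_r, exp_0. change (@zero _) with 0. simpl. ring.
Qed.

Lemma step_map_pos u t : 0 <= t -> step_map u t = voc u t.
Proof. intros Ht. unfold step_map. rewrite Rmin_right, Rmax_left by auto. ring. Qed.

Lemma step_map_cont u : (forall x, continuous u x) -> forall t, continuous (step_map u) t.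
Proof.
  intros Hu t. unfold step_map. apply cont_Rplus; [apply cont_Rminus|].
  - apply (continuous_comp (fun x => Rmin x 0) phi); auto. apply cont_min0.
  - apply continuous_const.
  - apply (continuous_comp (fun x => Rmax x 0) (voc u)); [apply cont_max0|].
    eapply is_derive_continuous, voc_derive; auto.
Qed.

Lemma step_map_local u v t : (forall s, s <= t - h -> u s = v s) -> step_map u t = step_map v t.
Proof.
  intros E. destruct (Rle_dec t 0).
  - now rewrite !step_map_neg.
  - rewrite !step_map_pos by lra. unfold voc. do 2 f_equal.
    apply RInt_ext. rewrite Rmin_left, Rmax_right by lra. intros x Hx. rewrite E; auto. lra.
Qed.

Fixpoint approx (n : nat) : R -> R :=
  match n with O => step_map phi | S m => step_map (approx m) end.

Lemma approx_cont n : forall t, continuous (approx n) t.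
Proof. induction n; simpl; intros t; now apply step_map_cont. Qed.

Lemma approx_S n t : t <= INR n * h -> approx (S n) t = approx n t.
Proof.
  revert t. induction n as [|n IH]; intros t Ht.
  - simpl in Ht. simpl. rewrite !step_map_neg; lra.
  - change (approx (S (S n)) t) with (step_map (approx (S n)) t).
    change (approx (S n) t) with (step_map (approx n) t).
    apply step_map_local. intros s Hs. apply IH. rewrite S_INR in Ht. lra.
Qed.

Lemma approx_stable n m t : (n <= m)%nat -> t <= INR n * h -> approx m t = approx n t.
Proof.
  intros Hnm Ht. induction Hnm as [|m Hnm IH]; auto.
  rewrite approx_S; auto. apply le_INR in Hnm. nra.
Qed.

(** The iterates stabilize on [t <= n h], so any index with this property gives the same value; the
    index taken here is one of them. *)
Definition steps_sol (t : R) : R := approx (Z.to_nat (up (Rabs t / h))) t.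

Lemma steps_sol_eq n t : t <= INR n * h -> steps_sol t = approx n t.
Proof.
  intros Ht. unfold steps_sol. set (N := Z.to_nat (up (Rabs t / h))).
  assert (HN : t <= INR N * h).
  { assert (Hq : 0 <= Rabs t / h) by (apply Rdiv_le_0_compat; auto using Rabs_pos).
    destruct (archimed (Rabs t / h)) as [Ha _].
    assert (Hz : (0 <= up (Rabs t / h))%Z) by (apply le_IZR; lra).
    unfold N. rewrite INR_IZR_INZ, Z2Nat.id by auto.
    apply Rmult_gt_compat_r with (r := h) in Ha; auto.
    replace (Rabs t / h * h) with (Rabs t) in Ha by (field; lra).
    pose proof (Rle_abs t). lra. }
  destruct (Nat.le_ge_cases n N).
  - now apply approx_stable.
  - symmetry. now apply approx_stable.
Qed.

Lemma nat_above t : exists n, t < INR n * h.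
Proof.
  destruct (nfloor_ex (Rabs t / h)) as [n [_ Hn]].
  { apply Rdiv_le_0_compat; auto using Rabs_pos. }
  exists (S n). rewrite S_INR. apply Rmult_lt_compat_r with (r := h) in Hn; auto.
  replace (Rabs t / h * h) with (Rabs t) in Hn by (field; lra). pose proof (Rle_abs t). lra.
Qed.

Lemma steps_sol_loc n t : t < INR n * h -> locally t (fun y => approx n y = steps_sol y).
Proof.
  intros Ht. assert (Hp : 0 < INR n * h - t) by lra. exists (mkposreal _ Hp). intros y Hy.
  symmetry. apply steps_sol_eq. change (Rabs (y - t) < INR n * h - t) in Hy. apply Rabs_def2 in Hy. lra.
Qed.

Lemma steps_sol_cont t : continuous steps_sol t.
Proof.
  destruct (nat_above t) as [n Hn].
  apply (continuous_ext_loc _ (approx n)); [now apply steps_sol_loc|apply approx_cont].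
Qed.

Lemma steps_sol_derive t : 0 < t -> is_derive steps_sol t (- steps_sol t + Gp (steps_sol (t - h))).
Proof.
  intros Ht. destruct (nat_above t) as [n Hn].
  assert (Hn' : t < INR (S n) * h) by (rewrite S_INR; lra).
  apply (is_derive_ext_loc (approx (S n))); [now apply steps_sol_loc|].
  rewrite (steps_sol_eq (S n) t), (steps_sol_eq n (t - h)) by lra.
  apply (is_derive_ext_loc (voc (approx n))).
  - exists (mkposreal t Ht). intros y Hy. change (Rabs (y - t) < t) in Hy. apply Rabs_def2 in Hy.
    simpl. rewrite step_map_pos; [auto|lra].
  - simpl. rewrite step_map_pos by lra. apply voc_derive, approx_cont.
Qed.

Lemma steps_sol_init t : t <= 0 -> steps_sol t = phi t.
Proof.
  intros Ht. rewrite (steps_sol_eq 0) by (simpl; lra). simpl. now apply step_map_neg.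
Qed.

Lemma steps_sol_nonneg t : 0 <= t -> 0 <= steps_sol t.
Proof.
  intros Ht. destruct (nat_above t) as [n Hn].
  assert (Hn' : t < INR (S n) * h) by (rewrite S_INR; lra).
  rewrite (steps_sol_eq (S n) t) by lra. simpl. rewrite step_map_pos by auto.
  apply voc_nonneg; auto. apply approx_cont.
Qed.
End Steps.

(** Exponential stability speaks of solutions of the nonlinear equation, so a solution with given
    history has to be produced before the hypothesis can be applied. *)
Lemma dde_exists (g Gp phi : R -> R) (h : R) : 0 < h ->
  (forall x, continuous Gp x) -> (forall x, 0 <= Gp x) -> (forall x, 0 <= x -> Gp x = g x) ->
  (forall x, continuous phi x) -> (forall t, - h <= t <= 0 -> 0 <= phi t) ->
  exists u, dde_sol g h u /\ (forall t, continuous u t) /\ forall t, t <= 0 -> u t = phi t.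
Proof.
  intros Hh HG HG0 Hg Hphi Hpos.
  assert (Hphi0 : 0 <= phi 0) by (apply Hpos; lra).
  exists (steps_sol h Gp phi).
  assert (Hc : forall t, continuous (steps_sol h Gp phi) t) by (intros; now apply steps_sol_cont).
  assert (Hn : forall t, - h <= t -> 0 <= steps_sol h Gp phi t).
  { intros t Ht. destruct (Rle_dec t 0).
    - rewrite steps_sol_init by auto. apply Hpos; lra.
    - apply steps_sol_nonneg; auto. lra. }
  split; [split; [|split]|split]; auto.
  - intros t Ht. apply filterlim_filter_le_1 with (2 := Hc t). apply filter_le_within.
  - intros t Ht. rewrite <- (Hg (steps_sol h Gp phi (t - h))) by (apply Hn; lra).
    now apply steps_sol_derive.
  - intros t Ht. now apply steps_sol_init.
Qed.

(** * Stability of the linearization at the positive equilibrium *)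

Lemma relax (v v' : R -> R) (t0 t1 B : R) :
  (forall t, continuous v t) -> (forall t, t0 < t < t1 -> is_derive v t (v' t)) ->
  (forall t, t0 < t < t1 -> Rabs (v' t + v t) <= B) -> Rabs (v t0) <= B ->
  forall t, t0 <= t <= t1 -> Rabs (v t) <= B.
Proof.
  intros Hc Hd HF H0 t Ht. apply Rabs_le_between in H0.
  pose proof (exp_pos (1 * t)). pose proof (exp_pos (1 * t0)).
  assert (A1 : exp (1 * t0) * (B - v t0) <= exp (1 * t) * (B - v t)).
  { apply (derive_ge0_le (fun x => exp (1 * x) * (B - v x)) (fun x => exp (1 * x) * (B - (v' x + v x)))); [lra| |].
    - intros x _. apply cont_Rmult; [apply cont_expk|]. apply cont_Rminus; auto. apply continuous_const.
    - intros x Hx. split.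
      + eapply is_derive_eq; [apply is_derive_Rmult; [apply is_derive_expk|];
          apply (is_derive_Rminus (fun _ => B)); [apply @is_derive_const|apply Hd; lra]|].
        change (@zero _) with 0. simpl. ring.
      + apply Rmult_le_pos; [left; apply exp_pos|]. specialize (HF x ltac:(lra)).
        apply Rabs_le_between in HF. lra. }
  assert (A2 : exp (1 * t0) * (B + v t0) <= exp (1 * t) * (B + v t)).
  { apply (derive_ge0_le (fun x => exp (1 * x) * (B + v x)) (fun x => exp (1 * x) * (B + (v' x + v x)))); [lra| |].
    - intros x _. apply cont_Rmult; [apply cont_expk|]. apply cont_Rplus; auto. apply continuous_const.
    - intros x Hx. split.
      + eapply is_derive_eq; [apply is_derive_Rmult; [apply is_derive_expk|];
          apply (is_derive_Rplus (fun _ => B)); [apply @is_derive_const|apply Hd; lra]|].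
        change (@zero _) with 0. simpl. ring.
      + apply Rmult_le_pos; [left; apply exp_pos|]. specialize (HF x ltac:(lra)).
        apply Rabs_le_between in HF. lra. }
  assert (0 <= exp (1 * t0) * (B - v t0)) by (apply Rmult_le_pos; lra).
  assert (0 <= exp (1 * t0) * (B + v t0)) by (apply Rmult_le_pos; lra).
  apply Rabs_le. split.
  - assert (0 <= B + v t); [|lra]. apply Rmult_le_reg_l with (exp (1 * t)); auto. lra.
  - assert (0 <= B - v t); [|lra]. apply Rmult_le_reg_l with (exp (1 * t)); auto. lra.
Qed.

(** A Gronwall estimate by windows: on each one the delayed term is already bounded, and [relax]
    shows that the bound grows at most by the factor [2 + Q]. *)
Lemma delay_growth (h tau Q P m : R) (e e' : R -> R) (j : nat) : 0 < h -> 0 <= Q -> 0 <= P -> 0 <= m ->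
  (forall t, continuous e t) ->
  (forall t, tau < t < tau + INR j * h -> is_derive e t (e' t)) ->
  (forall t, tau < t < tau + INR j * h -> Rabs (e' t + e t) <= Q * Rabs (e (t - h)) + P) ->
  (forall t, tau - h <= t <= tau -> Rabs (e t) <= m) ->
  forall t, tau - h <= t <= tau + INR j * h -> Rabs (e t) <= (2 + Q) ^ j * (m + P).
Proof.
  intros Hh HQ HP Hm Hc. revert e'. induction j as [|j IH]; intros e' Hd HF H0 t Ht.
  - simpl in *. specialize (H0 t ltac:(lra)). lra.
  - rewrite S_INR in *.
    assert (IH' : forall s, tau - h <= s <= tau + INR j * h -> Rabs (e s) <= (2 + Q) ^ j * (m + P)).
    { apply (IH e'); auto; intros s Hs; [apply Hd|apply HF]; lra. }
    set (B := (2 + Q) ^ j * (m + P)) in *.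
    assert (HB : m + P <= B).
    { unfold B. assert (1 <= (2 + Q) ^ j) by (apply pow_R1_Rle; lra).
      rewrite <- (Rmult_1_l (m + P)) at 1. apply Rmult_le_compat_r; lra. }
    replace ((2 + Q) ^ S j * (m + P)) with ((2 + Q) * B) by (unfold B; simpl; ring).
    assert (0 <= Q * B) by (apply Rmult_le_pos; lra).
    destruct (Rle_dec t (tau + INR j * h)).
    + specialize (IH' t ltac:(lra)). lra.
    + apply (relax e e' (tau + INR j * h) (tau + (INR j + 1) * h)); auto; try lra.
      * intros s Hs. apply Hd. pose proof (pos_INR j). nra.
      * intros s Hs. pose proof (pos_INR j).
        assert (0 <= INR j * h) by (apply Rmult_le_pos; lra).
        eapply Rle_trans; [apply HF; lra|]. specialize (IH' (s - h) ltac:(lra)).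
        assert (Q * Rabs (e (s - h)) <= Q * B) by (apply Rmult_le_compat_l; lra). lra.
      * pose proof (pos_INR j). assert (0 <= INR j * h) by (apply Rmult_le_pos; lra).
        specialize (IH' (tau + INR j * h) ltac:(lra)). lra.
Qed.

(** A perturbed solution [v] of the linearization is compared on a fixed time span with
    the difference quotient [(u - K) / s], [u] being the nonlinear solution with initial
    function [K + s v]; the latter decays by exponential stability. *)
Lemma stab_window (g Gp : R -> R) (h K k : R) : 0 < h -> 0 < K -> exp_stable_eq g h K ->
  (forall x, continuous Gp x) -> (forall x, 0 <= Gp x) -> (forall x, 0 <= x -> Gp x = g x) ->
  (forall z, 0 < z -> exists r, 0 < r /\ forall u, 0 <= u -> Rabs (u - K) <= r ->
      Rabs (g u - K - k * (u - K)) <= z * Rabs (u - K)) ->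
  exists (n : nat) C i, 0 <= C /\ 0 < i /\ forall tau m M (v y q : R -> R), 0 <= m -> 0 <= M ->
    (forall t, continuous v t) ->
    (forall t, tau <= t -> Rabs (q t - k) <= i) ->
    (forall t, tau < t -> is_derive v t (- v t + q t * y (t - h))) ->
    (forall t, tau - h <= t -> Rabs (y t - v t) <= M) ->
    (forall t, tau - h <= t <= tau -> Rabs (v t) <= m) ->
    (forall t, tau - h <= t <= tau + INR (S n) * h -> Rabs (v t) <= C * (m + M)) /\
    (forall t, tau + INR n * h <= t <= tau + INR (S n) * h -> Rabs (v t) <= m / 4 + C * M).
Proof.
  intros Hh HK [d0 [C0 [gam [Hd0 [HC0 [Hgam Hst]]]]]] HGc HG0 HGg Hder.
  assert (Hr : 0 <= exp (- gam * h) < 1).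
  { split; [left; apply exp_pos|]. rewrite <- exp_0. apply exp_increasing. nra. }
  (* After [n] windows the nonlinear solution is within [/ 16] of its initial deviation from [K]. *)
  destruct (pow_small (exp (- gam * h)) (/ (16 * C0)) Hr) as [n Hn].
  { apply Rinv_0_lt_compat; lra. }
  specialize (Hn n (Nat.le_refl n)).
  assert (Hpow : forall j, exp (- gam * h) ^ j = exp (- gam * (INR j * h))).
  { induction j as [|j IHj]; [simpl; rewrite Rmult_0_l, Rmult_0_r, exp_0; auto|].
    rewrite S_INR. replace (- gam * ((INR j + 1) * h)) with (- gam * h + - gam * (INR j * h)) by ring.
    rewrite exp_plus, <- IHj. reflexivity. }
  rewrite Hpow in Hn.
  set (Q := Rabs k + 1). assert (HQ : 1 <= Q) by (unfold Q; pose proof (Rabs_pos k); lra).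
  set (C1 := (2 + Q) ^ S n * (1 + Q)).
  assert (HC1 : 1 <= C1).
  { unfold C1. assert (1 <= (2 + Q) ^ S n) by (apply pow_R1_Rle; lra). nra. }
  (* [E] is the amplification of the comparison error over [n + 1] windows. [i] and [z] are scaled
     so that the perturbed coefficient and the nonlinear remainder each cost [/ 16]; with the decay
     of [u] this makes [3 / 16], below [/ 4]. *)
  set (E := (2 + Rabs k) ^ S n).
  assert (HE : 1 <= E) by (apply pow_R1_Rle; pose proof (Rabs_pos k); lra).
  set (i := / (16 * E * C1)).
  assert (HEC : 1 <= E * C1) by nra.
  assert (Hi : 0 < i <= 1).
  { unfold i. split; [apply Rinv_0_lt_compat; lra|]. rewrite <- Rinv_1. apply Rinv_le_contravar; lra. }
  assert (HiE : E * (i * C1) = / 16) by (unfold i; field; lra).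
  set (z := / (16 * E * (C0 + 1))).
  assert (Hz : 0 < z) by (unfold z; apply Rinv_0_lt_compat; nra).
  assert (HzE : E * (z * (C0 + 1)) = / 16) by (unfold z; field; lra).
  destruct (Hder z Hz) as [rho [Hrho Hlin]].
  assert (HEQ : 0 <= E * Q) by nra.
  exists n, (C1 + 1 + E * Q), i. split; [lra|]. split; [lra|].
  intros tau m M v y q Hm HM Hvc Hq Hvd Hy Hv0.
  assert (Hgrow : forall t, tau - h <= t <= tau + INR (S n) * h -> Rabs (v t) <= C1 * (m + M)).
  { intros t Ht. apply Rle_trans with ((2 + Q) ^ S n * (m + Q * M)).
    - apply (delay_growth h tau Q (Q * M) m v (fun t => - v t + q t * y (t - h)) (S n)); auto; try lra.
      + apply Rmult_le_pos; lra.
      + intros s Hs. apply Hvd; lra.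
      + intros s Hs. replace (- v s + q s * y (s - h) + v s) with (q s * y (s - h)) by ring.
        rewrite <- Rmult_plus_distr_l. apply Rabs_mult_le.
        * replace (q s) with ((q s - k) + k) by ring. eapply Rle_trans; [apply Rabs_triang|].
          specialize (Hq s ltac:(lra)). unfold Q. lra.
        * replace (y (s - h)) with (v (s - h) + (y (s - h) - v (s - h))) by ring.
          eapply Rle_trans; [apply Rabs_triang|]. specialize (Hy (s - h) ltac:(lra)). lra.
    - unfold C1. rewrite Rmult_assoc. apply Rmult_le_compat_l; [apply pow_le; lra|]. nra. }
  (* The scale keeps [K + s v] nonnegative, inside the stability radius [d0], and, along its
     evolution, inside the radius [rho] of the linear approximation; [m + 1] covers [m = 0]. *)
  set (s := Rmin (Rmin d0 rho) K / ((C0 + 1) * (m + 1))).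
  assert (Hmin : 0 < Rmin (Rmin d0 rho) K) by (repeat apply Rmin_pos; lra).
  assert (Hs : 0 < s) by (unfold s; apply Rdiv_lt_0_compat; nra).
  assert (Hsm : s * ((C0 + 1) * m) <= Rmin (Rmin d0 rho) K).
  { apply Rle_trans with (s * ((C0 + 1) * (m + 1))); [apply Rmult_le_compat_l; nra|].
    right. unfold s. field. lra. }
  pose proof (Rmin_l (Rmin d0 rho) K); pose proof (Rmin_r (Rmin d0 rho) K).
  pose proof (Rmin_l d0 rho); pose proof (Rmin_r d0 rho).
  assert (Hsm1 : s * m <= s * ((C0 + 1) * m)) by (apply Rmult_le_compat_l; [lra|];
    assert (0 <= C0 * m) by (apply Rmult_le_pos; lra); lra).
  destruct (dde_exists g Gp (fun t => K + s * v (t - - tau)) h) as [u [Hu [Huc Hu0]]]; auto.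
  { intros x. apply cont_Rplus; [apply continuous_const|]. apply cont_Rscal, cont_shift, Hvc. }
  { intros t Ht. replace (t - - tau) with (t + tau) by ring. specialize (Hv0 (t + tau) ltac:(lra)).
    apply Rabs_le_between in Hv0. assert (s * (- m) <= s * v (t + tau)) by (apply Rmult_le_compat_l; lra). lra. }
  assert (Hinit : forall t, t <= 0 -> u t - K = s * v (t + tau)).
  { intros t Ht. rewrite Hu0 by auto. replace (t - - tau) with (t + tau) by ring. ring. }
  assert (Hdec : forall t, 0 <= t -> Rabs (u t - K) <= C0 * exp (- gam * t) * (s * m)).
  { apply (Hst u (s * m)); [auto|lra|]. intros t Ht. rewrite Hinit by lra.
    rewrite Rabs_mult, (Rabs_right s) by lra. apply Rmult_le_compat_l; [lra|]. apply Hv0; lra. }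
  assert (Hall : forall t, - h <= t -> Rabs (u t - K) <= s * ((C0 + 1) * m)).
  { intros t Ht. destruct (Rle_dec t 0).
    - rewrite Hinit by lra. rewrite Rabs_mult, (Rabs_right s) by lra. apply Rmult_le_compat_l; [lra|].
      specialize (Hv0 (t + tau) ltac:(lra)). nra.
    - eapply Rle_trans; [apply Hdec; lra|].
      assert (exp (- gam * t) <= 1) by (rewrite <- exp_0; apply exp_mono; nra).
      pose proof (exp_pos (- gam * t)).
      replace (s * ((C0 + 1) * m)) with ((C0 + 1) * (s * m)) by ring.
      apply Rmult_le_compat_r; [apply Rmult_le_pos; lra|]. nra. }
  set (P := i * (C1 * (m + M)) + Q * M + z * ((C0 + 1) * m)).
  assert (HP : 0 <= P).
  { unfold P. assert (0 <= i * (C1 * (m + M))) by (apply Rmult_le_pos; [lra|]; apply Rmult_le_pos; lra).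
    assert (0 <= Q * M) by nra. assert (0 <= z * ((C0 + 1) * m)) by (apply Rmult_le_pos; [lra|]; apply Rmult_le_pos; lra). lra. }
  assert (He : forall t, 0 - h <= t <= 0 + INR (S n) * h ->
    Rabs (v (t - - tau) - / s * (u t - K)) <= E * (0 + P)).
  { destruct Hu as [Hu1 [_ Hu3]].
    apply (delay_growth h 0 (Rabs k) P 0 (fun t => v (t - - tau) - / s * (u t - K))
      (fun t => (- v (t - - tau) + q (t - - tau) * y (t - - tau - h)) - / s * (- u t + g (u (t - h)))) (S n)); auto;
      try lra; try apply Rabs_pos.
    - intros t. apply cont_Rminus; [apply cont_shift, Hvc|]. apply cont_Rscal, cont_Rminus; auto. apply continuous_const.
    - intros t Ht. apply is_derive_Rminus.
      + apply (is_derive_shift v (- tau)). apply Hvd. lra.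
      + apply is_derive_Rscal. eapply is_derive_eq;
          [apply (is_derive_Rminus u (fun _ => K)); [apply Hu3; lra|apply @is_derive_const]|].
        change (@zero _) with 0. simpl. ring.
    - intros t Ht. replace (t - - tau - h) with (t - h - - tau) by ring. replace (t - - tau) with (t + tau) by ring.
      replace (t - h - - tau) with (t - h + tau) by ring.
      set (x := v (t - h + tau)). set (w := u (t - h)). set (Y := y (t - h + tau)).
      replace (- v (t + tau) + q (t + tau) * Y - / s * (- u t + g w) + (v (t + tau) - / s * (u t - K)))
        with (k * (x - / s * (w - K)) + ((q (t + tau) - k) * x + q (t + tau) * (Y - x) -
              / s * (g w - K - k * (w - K)))) by ring.
      eapply Rle_trans; [apply Rabs_triang|]. rewrite Rabs_mult. apply Rplus_le_compat_l.
      unfold Rminus at 1. eapply Rle_trans; [apply Rabs_triang|]. rewrite Rabs_Ropp.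
      unfold P. apply Rplus_le_compat.
      + eapply Rle_trans; [apply Rabs_triang|]. apply Rplus_le_compat.
        * apply Rabs_mult_le; [apply Hq; lra|]. apply Hgrow. lra.
        * apply Rabs_mult_le.
          -- replace (q (t + tau)) with ((q (t + tau) - k) + k) by ring. eapply Rle_trans; [apply Rabs_triang|].
             specialize (Hq (t + tau) ltac:(lra)). unfold Q. lra.
          -- apply Hy. lra.
      + rewrite Rabs_mult, (Rabs_right (/ s)) by (apply Rle_ge; left; now apply Rinv_0_lt_compat).
        pose proof (Hall (t - h) ltac:(lra)) as Hw. fold w in Hw.
        assert (Hl : Rabs (g w - K - k * (w - K)) <= z * Rabs (w - K)).
        { apply Hlin; [apply Hu1; lra|lra]. }
        apply Rmult_le_reg_l with s; auto. rewrite <- Rmult_assoc, Rinv_r, Rmult_1_l by lra.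
        eapply Rle_trans; [exact Hl|]. replace (s * (z * ((C0 + 1) * m))) with (z * (s * ((C0 + 1) * m))) by ring.
        apply Rmult_le_compat_l; lra.
    - intros t Ht. rewrite Hinit by lra. replace (t - - tau) with (t + tau) by ring.
      replace (v (t + tau) - / s * (s * v (t + tau))) with 0 by (field; lra). rewrite Rabs_R0; lra. }
  assert (HEP : E * (0 + P) = / 16 * (m + M) + E * Q * M + / 16 * m).
  { transitivity (E * (i * C1) * (m + M) + E * Q * M + E * (z * (C0 + 1)) * m); [unfold P; ring|].
    rewrite HiE, HzE. ring. }
  rewrite HEP in He. split.
  - intros t Ht. eapply Rle_trans; [now apply Hgrow|]. apply Rmult_le_compat_r; lra.
  - intros t Ht. specialize (He (t - tau)). 
    pose proof (pos_INR n). assert (0 <= INR n * h) by (apply Rmult_le_pos; lra).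
    specialize (He ltac:(lra)). replace (t - tau - - tau) with t in He by ring.
    pose proof (Hdec (t - tau) ltac:(lra)) as Hd1.
    assert (Hx : C0 * exp (- gam * (t - tau)) <= / 16).
    { apply Rle_trans with (C0 * exp (- gam * (INR n * h))).
      - apply Rmult_le_compat_l; [lra|]. apply exp_mono. nra.
      - apply Rle_trans with (C0 * / (16 * C0)); [apply Rmult_le_compat_l; lra|]. right. field. lra. }
    assert (Hd2 : Rabs (/ s * (u (t - tau) - K)) <= / 16 * m).
    { rewrite Rabs_mult, (Rabs_right (/ s)) by (apply Rle_ge; left; now apply Rinv_0_lt_compat).
      apply Rmult_le_reg_l with s; auto. rewrite <- Rmult_assoc, Rinv_r, Rmult_1_l by lra.
      eapply Rle_trans; [exact Hd1|]. replace (s * (/ 16 * m)) with (/ 16 * (s * m)) by ring.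
      apply Rmult_le_compat_r; [apply Rmult_le_pos; lra|auto]. }
    replace (v t) with ((v t - / s * (u (t - tau) - K)) + / s * (u (t - tau) - K)) by ring.
    eapply Rle_trans; [apply Rabs_triang|].
    assert (0 <= C1 * M) by (apply Rmult_le_pos; lra). lra.
Qed.

(** Robust exponential stability of [v' = - v + k v (. - h)]: [q] is a perturbation of [k] and
    [y - v] an inhomogeneity. *)
Definition stable_lin (h k : R) : Prop :=
  exists L C i, 0 < L /\ 0 <= C /\ 0 < i /\ forall tau m M (v y q : R -> R), 0 <= m -> 0 <= M ->
    (forall t, continuous v t) ->
    (forall t, tau <= t -> Rabs (q t - k) <= i) ->
    (forall t, tau < t -> is_derive v t (- v t + q t * y (t - h))) ->
    (forall t, tau - h <= t -> Rabs (y t - v t) <= M) ->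
    (forall t, tau - h <= t <= tau -> Rabs (v t) <= m) ->
    forall j t, tau + INR j * L - h <= t -> Rabs (v t) <= C * ((/ 4) ^ j * m + M).

(** Iteration of [stab_window] over spans of length [L]: the recursion [m -> m / 4 + C * M]
    preserves bounds of the form [(/ 4) ^ j * m + 2 * C * M]. *)
Lemma stab_decay (g Gp : R -> R) (h K k : R) : 0 < h -> 0 < K -> exp_stable_eq g h K ->
  (forall x, continuous Gp x) -> (forall x, 0 <= Gp x) -> (forall x, 0 <= x -> Gp x = g x) ->
  (forall z, 0 < z -> exists r, 0 < r /\ forall u, 0 <= u -> Rabs (u - K) <= r ->
      Rabs (g u - K - k * (u - K)) <= z * Rabs (u - K)) ->
  stable_lin h k.
Proof.
  intros Hh HK Hst H1 H2 H3 H4.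
  destruct (stab_window g Gp h K k Hh HK Hst H1 H2 H3 H4) as [n [C [i [HC [Hi Hw]]]]].
  set (L := INR (S n) * h).
  assert (HL : 0 < L) by (unfold L; apply Rmult_lt_0_compat; auto; apply lt_0_INR; lia).
  exists L, (C * (2 * C + 1) + C), i. repeat split; auto; [nra|].
  intros tau m M v y q Hm HM Hvc Hq Hvd Hy Hv0.
  assert (claim : forall j, 
    (forall t, tau + INR j * L - h <= t <= tau + INR j * L -> Rabs (v t) <= (/ 4) ^ j * m + 2 * C * M) /\
    (forall t, tau + INR j * L - h <= t <= tau + INR (S j) * L -> Rabs (v t) <= C * ((/ 4) ^ j * m + 2 * C * M + M))).
  { assert (HCM : 0 <= C * M) by nra.
    assert (win : forall j, (forall t, tau + INR j * L - h <= t <= tau + INR j * L -> Rabs (v t) <= (/ 4) ^ j * m + 2 * C * M) ->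
      (forall t, tau + INR j * L - h <= t <= tau + INR (S j) * L -> Rabs (v t) <= C * ((/ 4) ^ j * m + 2 * C * M + M)) /\
      (forall t, tau + INR (S j) * L - h <= t <= tau + INR (S j) * L -> Rabs (v t) <= (/ 4) ^ S j * m + 2 * C * M)).
    { intros j Hj. assert (Hp : 0 <= (/ 4) ^ j * m) by (apply Rmult_le_pos; auto; apply pow_le; lra).
      pose proof (pos_INR j). assert (0 <= INR j * L) by (apply Rmult_le_pos; lra).
      destruct (Hw (tau + INR j * L) ((/ 4) ^ j * m + 2 * C * M) M v y q) as [W1 W2]; auto; try lra.
      - intros t Ht; apply Hq; lra.
      - intros t Ht; apply Hvd; lra.
      - intros t Ht; apply Hy; lra.
      - split.
        + intros t Ht. apply W1. rewrite S_INR in Ht. fold L. lra.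
        + intros t Ht. eapply Rle_trans; [apply W2|].
          * rewrite S_INR in Ht. fold L. replace (INR n * h) with (L - h) by (unfold L; rewrite S_INR; ring). lra.
          * simpl. lra. }
    induction j as [|j IH].
    - assert (B : forall t, tau + INR 0 * L - h <= t <= tau + INR 0 * L -> Rabs (v t) <= (/ 4) ^ 0 * m + 2 * C * M).
      { intros t Ht. simpl in *. specialize (Hv0 t ltac:(lra)). lra. }
      split; auto. now apply win.
    - destruct IH as [IH _]. apply win in IH as [_ IH]. split; auto. now apply win. }
  intros j t Ht.
  destruct (nfloor_ex ((t - (tau + INR j * L - h)) / L)) as [k0 [K1 K2]].
  { apply Rdiv_le_0_compat; lra. }
  apply Rmult_le_compat_r with (r := L) in K1; [|lra].
  apply Rmult_lt_compat_r with (r := L) in K2; [|lra].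
  replace ((t - (tau + INR j * L - h)) / L * L) with (t - (tau + INR j * L - h)) in * by (field; lra).
  destruct (claim (j + k0)%nat) as [_ Hc].
  eapply Rle_trans; [apply Hc|].
  - rewrite S_INR, plus_INR. lra.
  - assert ((/ 4) ^ (j + k0) <= (/ 4) ^ j).
    { rewrite pow_add. assert (0 <= (/ 4) ^ j) by (apply pow_le; lra).
      assert ((/ 4) ^ k0 <= 1 ^ k0) by (apply pow_incr; lra). rewrite pow1 in H0. nra. }
    assert ((/ 4) ^ (j + k0) * m <= (/ 4) ^ j * m) by (apply Rmult_le_compat_r; auto).
    assert (0 <= (/ 4) ^ j * m) by (apply Rmult_le_pos; auto; apply pow_le; lra).
    apply Rle_trans with (C * ((/ 4) ^ j * m + 2 * C * M + M)); [apply Rmult_le_compat_l; lra|].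
    assert (0 <= C * C * ((/ 4) ^ j * m)) by (apply Rmult_le_pos; auto; apply Rmult_le_pos; auto).
    assert (0 <= C * ((/ 4) ^ j * m)) by (apply Rmult_le_pos; auto).
    assert (0 <= C * M) by (apply Rmult_le_pos; auto). nra.
Qed.

(** * Contractions in weighted spaces *)

Lemma fun_choice (A B : Type) (P : A -> B -> Prop) :
  (forall x, exists y, P x y) -> exists f : A -> B, forall x, P x (f x).
Proof.
  intros H. exists (fun x => proj1_sig (constructive_indefinite_description _ (H x))).
  intros x. exact (proj2_sig (constructive_indefinite_description _ (H x))).
Qed.

Lemma small_all (x A r : R) : 0 <= r < 1 -> (forall n : nat, x <= A * r ^ n) -> x <= 0.
Proof.
  intros Hr H. apply Rnot_lt_le. intros Hx.
  assert (HA : 0 < A) by (specialize (H 0%nat); simpl in H; lra).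
  destruct (pow_small r (x / A) Hr) as [n Hn]; [now apply Rdiv_lt_0_compat|].
  specialize (Hn n (Nat.le_refl n)). specialize (H n).
  apply Rmult_lt_compat_l with (r := A) in Hn; auto.
  replace (A * (x / A)) with x in Hn by (field; lra). lra.
Qed.

Section Contraction.
Variable w : R -> R.
Hypothesis Hw : forall t, 0 < w t.
Hypothesis Hwc : forall t, continuous w t.

Definition inball (eta s : R) (y : R -> R) : Prop :=
  Rabs s <= eta /\ (forall t, continuous y t) /\ forall t, Rabs (y t) <= eta * w t.

(** Distance is expressed by bounds [L], so no supremum is formed. A scalar travels with the
    function because the branch problem has one scalar unknown. *)
Definition near (L s : R) (y : R -> R) (s' : R) (y' : R -> R) : Prop :=
  Rabs (s - s') <= L /\ forall t, Rabs (y t - y' t) <= L * w t.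

Definition lip_on (k eta : R) (T : R * (R -> R) -> R * (R -> R)) : Prop :=
  forall s y s' y' L, inball eta s y -> inball eta s' y' -> near L s y s' y' ->
    near (k * L) (fst (T (s, y))) (snd (T (s, y))) (fst (T (s', y'))) (snd (T (s', y'))).

Lemma near_sym L s y s' y' : near L s y s' y' -> near L s' y' s y.
Proof. intros [H1 H2]. split; [rewrite Rabs_minus_sym; auto|]. intros t. rewrite Rabs_minus_sym; auto. Qed.

Lemma near_trans L L' s y s' y' s'' y'' : near L s y s' y' -> near L' s' y' s'' y'' ->
  near (L + L') s y s'' y''.
Proof.
  intros [H1 H2] [H3 H4]. split.
  - replace (s - s'') with ((s - s') + (s' - s'')) by ring. eapply Rle_trans; [apply Rabs_triang|]. lra.
  - intros t. replace (y t - y'' t) with ((y t - y' t) + (y' t - y'' t)) by ring.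
    eapply Rle_trans; [apply Rabs_triang|]. specialize (H2 t); specialize (H4 t). lra.
Qed.

Lemma near_geom_eq A r s y s' y' : 0 <= r < 1 -> (forall n, near (A * r ^ n) s y s' y') ->
  s = s' /\ y = y'.
Proof.
  intros Hr H. split.
  - assert (Rabs (s - s') <= 0) by (apply (small_all _ A r Hr); intros n; apply H).
    pose proof (Rabs_pos (s - s')). assert (E : Rabs (s - s') = 0) by lra. 
    destruct (Req_dec (s - s') 0); [lra|]. now apply Rabs_no_R0 in H2.
  - apply functional_extensionality. intros t.
    assert (Rabs (y t - y' t) <= 0).
    { apply (small_all _ (A * w t) r Hr). intros n. destruct (H n) as [_ H2]. specialize (H2 t).
      replace (A * w t * r ^ n) with (A * r ^ n * w t) by ring. auto. }
    pose proof (Rabs_pos (y t - y' t)). assert (E : Rabs (y t - y' t) = 0) by lra. 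
    destruct (Req_dec (y t - y' t) 0); [lra|]. now apply Rabs_no_R0 in H2.
Qed.

Lemma contraction_unique k eta T s y s' y' : 0 <= k < 1 -> lip_on k eta T ->
  inball eta s y -> inball eta s' y' -> T (s, y) = (s, y) -> T (s', y') = (s', y') -> s = s' /\ y = y'.
Proof.
  intros Hk HT B B' F F'. apply (near_geom_eq (2 * eta) k s y s' y' Hk).
  induction n as [|n IH].
  - destruct B as [B1 [_ B2]], B' as [B1' [_ B2']]. simpl. split.
    + unfold Rminus. eapply Rle_trans; [apply Rabs_triang|]. rewrite Rabs_Ropp. lra.
    + intros t. unfold Rminus. eapply Rle_trans; [apply Rabs_triang|]. rewrite Rabs_Ropp.
      specialize (B2 t); specialize (B2' t). lra.
  - specialize (HT s y s' y' _ B B' IH). rewrite F, F' in HT. simpl in HT.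
    replace (2 * eta * k ^ S n) with (k * (2 * eta * k ^ n)) by (simpl; ring). auto.
Qed.

Lemma cont_weighted_limit (yn : nat -> R -> R) (y : R -> R) (A r : R) : 0 <= r < 1 ->
  (forall n t, continuous (yn n) t) -> (forall n t, Rabs (yn n t - y t) <= A * r ^ n * w t) ->
  forall t, continuous y t.
Proof.
  intros Hr Hc Hb t0. apply cont_eps. intros eps He.
  destruct (eps_cont w t0 (Hwc t0) 1 Rlt_0_1) as [d1 [Hd1 Hw1]].
  set (B := (Rabs A + 1) * (w t0 + 1)). assert (HB : 0 < B) by (unfold B; pose proof (Hw t0); pose proof (Rabs_pos A); nra).
  destruct (pow_small r (eps / 3 / B) Hr) as [n Hn]; [repeat apply Rdiv_lt_0_compat; lra|].
  specialize (Hn n (Nat.le_refl n)).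
  destruct (eps_cont (yn n) t0 (Hc n t0) (eps / 3)) as [d2 [Hd2 Hy2]]; [lra|].
  assert (Hsm : forall t, Rabs (t - t0) < d1 -> Rabs (yn n t - y t) <= eps / 3).
  { intros t Ht. eapply Rle_trans; [apply Hb|]. specialize (Hw1 t Ht). apply Rabs_def2 in Hw1.
    assert (0 <= r ^ n) by (apply pow_le; lra). pose proof (Hw t). pose proof (Rle_abs A). pose proof (Rabs_pos A).
    apply Rle_trans with ((Rabs A + 1) * r ^ n * (w t0 + 1)).
    - apply Rle_trans with ((Rabs A + 1) * r ^ n * w t).
      + apply Rmult_le_compat_r; [lra|]. apply Rmult_le_compat_r; lra.
      + apply Rmult_le_compat_l; [apply Rmult_le_pos; lra|lra].
    - replace ((Rabs A + 1) * r ^ n * (w t0 + 1)) with (B * r ^ n) by (unfold B; ring).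
      apply Rle_trans with (B * (eps / 3 / B)); [apply Rmult_le_compat_l; lra|]. right. field. lra. }
  exists (Rmin d1 d2). split; [now apply Rmin_pos|]. intros t Ht.
  pose proof (Rmin_l d1 d2); pose proof (Rmin_r d1 d2).
  pose proof (Hsm t ltac:(lra)). pose proof (Hsm t0 ltac:(rewrite Rminus_diag, Rabs_R0; lra)).
  specialize (Hy2 t ltac:(lra)).
  replace (y t - y t0) with (- (yn n t - y t) + ((yn n t - yn n t0) + (yn n t0 - y t0))) by ring.
  eapply Rle_lt_trans; [apply Rabs_triang|]. rewrite Rabs_Ropp.
  assert (Rabs (yn n t - yn n t0 + (yn n t0 - y t0)) < 2 * (eps / 3)); [|lra].
  eapply Rle_lt_trans; [apply Rabs_triang|]. lra.
Qed.

Lemma contraction_exists k eta T : 0 <= k < 1 -> 0 <= eta -> lip_on k eta T ->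
  (forall s y, inball eta s y -> forall t, continuous (snd (T (s, y))) t) ->
  near ((1 - k) * eta) (fst (T (0, fun _ => 0))) (snd (T (0, fun _ => 0))) 0 (fun _ => 0) ->
  exists s y, inball eta s y /\ T (s, y) = (s, y).
Proof.
  intros Hk Heta HT Hc H0.
  assert (B0 : inball eta 0 (fun _ => 0)).
  { split; [rewrite Rabs_R0; lra|]. split; [intros; apply continuous_const|].
    intros t. rewrite Rabs_R0. pose proof (Hw t). nra. }
  (* The share [k * eta] from the contraction and [(1 - k) * eta] from the image of the centre add
     up to the radius. *)
  assert (Hball : forall s y, inball eta s y -> inball eta (fst (T (s, y))) (snd (T (s, y)))).
  { intros s y B. assert (near eta s y 0 (fun _ => 0)).
    { destruct B as [B1 [_ B2]]. split; [now rewrite Rminus_0_r|]. intros t. now rewrite Rminus_0_r. }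
    assert (N := near_trans _ _ _ _ _ _ _ _ (HT s y 0 (fun _ => 0) eta B B0 H) H0).
    replace (k * eta + (1 - k) * eta) with eta in N by ring. destruct N as [N1 N2].
    rewrite Rminus_0_r in N1. split; auto. split; auto. intros t. specialize (N2 t). now rewrite Rminus_0_r in N2. }
  set (z := fun n => Nat.iter n T (0, fun _ => 0)).
  assert (Hz : forall n, inball eta (fst (z n)) (snd (z n))).
  { induction n as [|n IH]; [exact B0|]. change (z (S n)) with (T (z n)).
    rewrite (surjective_pairing (z n)). now apply Hball. }
  assert (Hstep : forall n, near (eta * k ^ n) (fst (z (S n))) (snd (z (S n))) (fst (z n)) (snd (z n))).
  { induction n as [|n IH].
    - change (z 1%nat) with (T (0, fun _ => 0)). simpl. rewrite Rmult_1_r.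
      destruct H0 as [H1 H2]. split; [eapply Rle_trans; [exact H1|]; nra|].
      intros t. eapply Rle_trans; [apply H2|]. apply Rmult_le_compat_r; [left; auto|nra].
    - change (z (S (S n))) with (T (z (S n))). change (z (S n)) with (T (z n)) at 3 4.
      rewrite (surjective_pairing (z (S n))), (surjective_pairing (z n)).
      replace (eta * k ^ S n) with (k * (eta * k ^ n)) by (simpl; ring).
      apply HT; auto. }
  destruct (geom_limit (fun n => fst (z n)) eta k Hk) as [s Hs].
  { intros n. apply Hstep. }
  destruct (fun_choice R R (fun t L => forall n, Rabs (snd (z n) t - L) <= eta * w t / (1 - k) * k ^ n)) as [y Hy].
  { intros t. apply (geom_limit (fun n => snd (z n) t) (eta * w t) k Hk). intros n.
    replace (eta * w t * k ^ n) with (eta * k ^ n * w t) by ring. apply Hstep. }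
  assert (Hy' : forall n t, Rabs (snd (z n) t - y t) <= eta / (1 - k) * k ^ n * w t).
  { intros n t. eapply Rle_trans; [apply Hy|]. right. field. lra. }
  assert (Hlim : forall n, near (eta / (1 - k) * k ^ n) (fst (z n)) (snd (z n)) s y).
  { intros n. split; auto. }
  assert (Hyc : forall t, continuous y t).
  { apply (cont_weighted_limit (fun n => snd (z n)) y (eta / (1 - k)) k Hk); auto. intros n. apply Hz. }
  assert (B : inball eta s y).
  { split; [|split]; auto.
    - assert (Rabs s - eta <= 0); [|lra]. apply (small_all _ (eta / (1 - k)) k Hk). intros n.
      destruct (Hz n) as [Z1 _]. specialize (Hs n). cbv beta in Hs.
      replace s with (- (fst (z n) - s) + fst (z n)) by ring.
      pose proof (Rabs_triang (- (fst (z n) - s)) (fst (z n))). rewrite Rabs_Ropp in H. lra.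
    - intros t. assert (Rabs (y t) - eta * w t <= 0); [|lra].
      apply (small_all _ (eta / (1 - k) * w t) k Hk). intros n.
      destruct (Hz n) as [_ [_ Z1]]. specialize (Z1 t). specialize (Hy' n t).
      replace (y t) with (- (snd (z n) t - y t) + snd (z n) t) by ring.
      pose proof (Rabs_triang (- (snd (z n) t - y t)) (snd (z n) t)). rewrite Rabs_Ropp in H.
      replace (eta / (1 - k) * w t * k ^ n) with (eta / (1 - k) * k ^ n * w t) by ring. lra. }
  exists s, y. split; auto.
  rewrite (surjective_pairing (T (s, y))).
  destruct (near_geom_eq (2 * (eta / (1 - k))) k (fst (T (s, y))) (snd (T (s, y))) s y Hk) as [E1 E2].
  { intros n. assert (N1 := near_sym _ _ _ _ _ (HT _ _ _ _ _ (Hz n) B (Hlim n))).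
    rewrite <- surjective_pairing in N1. change (T (z n)) with (z (S n)) in N1.
    assert (N2 := near_trans _ _ _ _ _ _ _ _ N1 (Hlim (S n))).
    replace (k * (eta / (1 - k) * k ^ n) + eta / (1 - k) * k ^ S n) with (k * (2 * (eta / (1 - k)) * k ^ n)) in N2
      by (simpl; ring).
    assert (HH : 0 <= 2 * (eta / (1 - k)) * k ^ n).
    { apply Rmult_le_pos; [|apply pow_le; lra]. apply Rmult_le_pos; [lra|]. apply Rdiv_le_0_compat; lra. }
    destruct N2 as [N2 N3]. split.
    - eapply Rle_trans; [exact N2|]. nra.
    - intros t. eapply Rle_trans; [apply N3|]. apply Rmult_le_compat_r; [left; auto|nra]. }
  now rewrite E1, E2.
Qed.
End Contraction.

(** * Inversion of the linearization along the front *)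

Section LinearInverse.
Variables (h lam p k Q : R) (q : R -> R).
Hypothesis Hh : 0 < h.
Hypothesis Hlam : 0 < lam.
Hypothesis Hp : 0 < p.
Hypothesis Hchar : lam + 1 = p * exp (- lam * h).
Hypothesis Hqc : forall t, continuous q t.
Hypothesis HQ : forall t, Rabs (q t) <= Q.
Hypothesis Hqm : forall e, 0 < e -> exists T, forall t, t <= T -> Rabs (q t - p) <= e.
Hypothesis Hqp : forall e, 0 < e -> exists T, forall t, T <= t -> Rabs (q t - k) <= e.
Hypothesis Hstab : stable_lin h k.

Let nu := 3 / 2 * lam.
(** For the constant coefficient [q = p] the operator [Bop] acts on [exp (nu t)] with factor
    [p * exp (- nu * h) / (1 + nu)]. Replacing [nu] by [lam] in the exponent gives [k0], still below
    [1]; the margin [exp ((nu - lam) * h)] is what [q] may lose against [p]. *)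
Let k0 := (1 + lam) / (1 + nu).
Definition Bop (y : R -> R) : R -> R := J 1 (fun s => q s * y (s - h)).

Lemma k0_bounds : 0 < k0 < 1.
Proof.
  unfold k0, nu. split; [apply Rdiv_lt_0_compat; lra|].
  apply Rmult_lt_reg_r with (1 + 3 / 2 * lam); [lra|]. unfold Rdiv. rewrite Rmult_assoc, Rinv_l; lra.
Qed.

Lemma Q_pos : 0 <= Q.
Proof. specialize (HQ 0). pose proof (Rabs_pos (q 0)); lra. Qed.

Lemma Bop_ladm y M : (forall t, continuous y t) -> (forall t, t <= 0 -> Rabs (y t) <= M) ->
  ladm 0 (fun s => q s * y (s - h)).
Proof.
  intros Hc Hb. split.
  - intros t. apply cont_Rmult; auto. now apply cont_shift.
  - exists (Q * M). intros t Ht. replace (- 0 * t) with 0 by ring. rewrite exp_0, Rmult_1_r.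
    apply Rabs_mult_le; auto. apply Hb; lra.
Qed.

(** The weight is [exp (nu t)] at [-oo], where [q] is close to [p], and grows so fast
    elsewhere that the size of [q] does not matter. *)
Lemma weight_exists : exists C Lam, 0 < C /\ nu <= Lam /\
  forall (y : R -> R) M, (forall t, continuous y t) ->
    (forall t, Rabs (y t) <= M * (exp (nu * t) + C * exp (Lam * t))) ->
    forall t, Rabs (Bop y t) <= k0 * M * (exp (nu * t) + C * exp (Lam * t)).
Proof.
  pose proof k0_bounds as Hk. pose proof Q_pos as HQ0.
  assert (Hnu : lam < nu) by (unfold nu; lra).
  assert (Hx : 1 < exp ((nu - lam) * h)) by (apply exp_gt1; nra).
  destruct (Hqm (p * exp ((nu - lam) * h) - p)) as [T HT]; [nra|].
  (* Makes [2 * Q <= k0 * (1 + Lam)]: at the rate [Lam] a coefficient of size [Q] is harmless even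
     with a factor [2] to spare. *)
  set (Lam := nu + 2 * Q / k0).
  assert (HL : nu <= Lam).
  { unfold Lam. assert (0 <= 2 * Q / k0) by (apply Rdiv_le_0_compat; lra). lra. }
  assert (HL2 : 2 * Q <= k0 * (1 + Lam)).
  { unfold Lam. replace (k0 * (1 + (nu + 2 * Q / k0))) with (k0 * (1 + nu) + 2 * Q) by (field; lra).
    assert (0 <= k0 * (1 + nu)) by (apply Rmult_le_pos; lra). lra. }
  (* The two exponentials of the weight coincide at [t = T]; to the right of [T] the one of rate
     [Lam] dominates. *)
  set (C := exp (- (Lam - nu) * T)). assert (HC : 0 < C) by apply exp_pos.
  exists C, Lam. split; [auto|]. split; [auto|]. intros y M Hyc Hyb.
  assert (HM : 0 <= M).
  { specialize (Hyb 0). pose proof (Rabs_pos (y 0)). pose proof (exp_pos (nu * 0)). pose proof (exp_pos (Lam * 0)).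
    assert (0 < exp (nu * 0) + C * exp (Lam * 0)) by nra. nra. }
  apply (J_le 1 0 _ (fun t => k0 * M * (exp (nu * t) + C * exp (Lam * t)))
    (fun t => k0 * M * (nu * exp (nu * t) + C * (Lam * exp (Lam * t))))); [lra| | | |].
  - apply (Bop_ladm y (M * (1 + C))); auto. intros t Ht. eapply Rle_trans; [apply Hyb|].
    apply Rmult_le_compat_l; auto.
    assert (exp (nu * t) <= 1) by (rewrite <- exp_0; apply exp_mono; nra).
    assert (exp (Lam * t) <= 1) by (rewrite <- exp_0; apply exp_mono; nra). nra.
  - intros t. pose proof (exp_pos (nu * t)). pose proof (exp_pos (Lam * t)).
    apply Rmult_le_pos; [apply Rmult_le_pos; lra|nra].
  - intros t. apply is_derive_Rscal, is_derive_Rplus; [|apply is_derive_Rscal]; apply is_derive_expk.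
  - intros t. set (a := exp (nu * t)). set (b := C * exp (Lam * t)).
    assert (Ha : 0 < a) by apply exp_pos.
    assert (Hb : 0 < b) by (apply Rmult_lt_0_compat; auto; apply exp_pos).
    replace (k0 * M * (nu * a + C * (Lam * exp (Lam * t))) + 1 * (k0 * M * (a + b)))
      with (M * (k0 * (1 + nu) * a + k0 * (1 + Lam) * b)) by (unfold b; ring).
    assert (Hsh : Rabs (y (t - h)) <= M * (exp (- nu * h) * a + exp (- Lam * h) * b)).
    { eapply Rle_trans; [apply Hyb|]. right. f_equal. unfold a, b.
      replace (nu * (t - h)) with (- nu * h + nu * t) by ring.
      replace (Lam * (t - h)) with (- Lam * h + Lam * t) by ring. rewrite !exp_plus. ring. }
    assert (E1 : exp (- nu * h) <= 1) by (rewrite <- exp_0; apply exp_mono; nra).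
    assert (E2 : exp (- Lam * h) <= exp (- nu * h)) by (apply exp_mono; nra).
    pose proof (exp_pos (- nu * h)). pose proof (exp_pos (- Lam * h)).
    destruct (Rle_dec t T) as [Ht|Ht].
    + assert (Hqt : Rabs (q t) <= p * exp ((nu - lam) * h)).
      { replace (q t) with ((q t - p) + p) by ring. eapply Rle_trans; [apply Rabs_triang|].
        rewrite (Rabs_right p) by lra. specialize (HT t Ht). lra. }
      assert (E3 : p * exp ((nu - lam) * h) * exp (- nu * h) = k0 * (1 + nu)).
      { rewrite Rmult_assoc, <- exp_plus. replace ((nu - lam) * h + - nu * h) with (- lam * h) by ring.
        rewrite <- Hchar. unfold k0. field. unfold nu. lra. }
      eapply Rle_trans; [apply Rabs_mult_le; [exact Hqt|exact Hsh]|].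
      set (X := p * exp ((nu - lam) * h)) in *. assert (0 < X) by (unfold X; nra).
      replace (X * (M * (exp (- nu * h) * a + exp (- Lam * h) * b))) with
        (M * (X * exp (- nu * h) * a + X * exp (- Lam * h) * b)) by ring.
      apply Rmult_le_compat_l; auto. rewrite E3. apply Rplus_le_compat_l. apply Rmult_le_compat_r; [lra|].
      apply Rle_trans with (X * exp (- nu * h)); [apply Rmult_le_compat_l; lra|]. rewrite E3.
      apply Rmult_le_compat_l; lra.
    + assert (Hab : a <= b).
      { unfold a, b, C. rewrite <- exp_plus. apply exp_mono. nra. }
      eapply Rle_trans; [apply Rabs_mult_le; [apply HQ|exact Hsh]|].
      replace (Q * (M * (exp (- nu * h) * a + exp (- Lam * h) * b))) with
        (M * (Q * (exp (- nu * h) * a + exp (- Lam * h) * b))) by ring.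
      apply Rmult_le_compat_l; auto.
      apply Rle_trans with (2 * Q * b).
      * replace (2 * Q * b) with (Q * (2 * b)) by ring. apply Rmult_le_compat_l; auto. nra.
      * assert (0 <= k0 * (1 + nu) * a) by (apply Rmult_le_pos; [apply Rmult_le_pos|]; lra).
        assert (2 * Q * b <= k0 * (1 + Lam) * b) by (apply Rmult_le_compat_r; lra). lra.
Qed.

Lemma Bop_minus y y' t : ladm 0 (fun s => q s * y (s - h)) -> ladm 0 (fun s => q s * y' (s - h)) ->
  Bop y t - Bop y' t = Bop (fun s => y s - y' s) t.
Proof.
  intros L1 L2. unfold Bop.
  replace (fun s => q s * (y (s - h) - y' (s - h))) with (fun s => q s * y (s - h) + (-1) * (q s * y' (s - h))).
  - rewrite (J_plus 1 0), (J_scal 1 0); auto; try lra. now apply ladm_scal.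
  - apply functional_extensionality. intros; ring.
Qed.

(** The contraction in the growing weight yields a solution [y] without control at [+oo]. There
    [v = Bop y] solves [v' = - v + q y (. - h)] with [y - v = r] bounded, the very shape of
    [stable_lin], which restores boundedness. *)
Lemma linear_inverse : exists CA, 0 <= CA /\ forall M r, wb nu M r ->
  exists y, wb nu (CA * M) y /\ forall t, y t - Bop y t = r t.
Proof.
  destruct weight_exists as [C [Lam [HC [HL Hcontr]]]].
  set (w := fun t => exp (nu * t) + C * exp (Lam * t)) in *.
  assert (Hnu0 : 0 < nu) by (unfold nu; lra).
  pose proof k0_bounds as Hk.
  destruct Hstab as [L0 [Cs [i [_ [HCs [Hi Hst]]]]]].
  destruct (Hqp i Hi) as [T0 HT0]. set (T1 := Rmax T0 h).
  assert (HT1 : T0 <= T1 /\ h <= T1) by (split; [apply Rmax_l|apply Rmax_r]).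
  assert (Hw : forall t, 0 < w t).
  { intros t. unfold w. pose proof (exp_pos (nu * t)). pose proof (exp_pos (Lam * t)). nra. }
  assert (Hwc : forall t, continuous w t).
  { intros t. apply cont_Rplus; [|apply cont_Rscal]; apply cont_expk. }
  assert (Hwm : forall s t, s <= t -> w s <= w t).
  { intros s t Hst'. unfold w. assert (exp (nu * s) <= exp (nu * t)) by (apply exp_mono; nra).
    assert (exp (Lam * s) <= exp (Lam * t)) by (apply exp_mono; nra). nra. }
  set (A := / (1 - k0)). assert (HA : 0 < A) by (apply Rinv_0_lt_compat; lra).
  set (W := A * w T1). assert (HW : 0 < W) by (apply Rmult_lt_0_compat; auto).
  set (CA := A * (1 + C) + W + (Cs * (W + 2) + 1)).
  assert (HCs2 : 0 <= Cs * (W + 2)) by (apply Rmult_le_pos; lra).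
  assert (HAC : 0 < A * (1 + C)) by nra.
  exists CA. split; [unfold CA; lra|]. intros M r Hr.
  assert (HM := wb_pos _ _ _ Hr).
  assert (Hlad : forall eta s y, inball w eta s y -> ladm 0 (fun s => q s * y (s - h))).
  { intros eta s y [_ [Hc Hb]]. apply (Bop_ladm y (Rabs eta * w 0)); auto. intros t Ht.
    eapply Rle_trans; [apply Hb|]. pose proof (Hw t). pose proof (Hwm t 0 Ht). pose proof (Rle_abs eta).
    pose proof (Rabs_pos eta).
    apply Rle_trans with (Rabs eta * w t); [apply Rmult_le_compat_r; lra|apply Rmult_le_compat_l; lra]. }
  (* The scalar component is frozen at [0]. With [A = / (1 - k0)] the image of the zero function,
     which is [r], fits exactly into the ball. *)
  destruct (contraction_exists w Hw Hwc k0 (A * M)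
    (fun z => (0, fun t => r t + Bop (snd z) t))) as [s [y [By Fy]]].
  - lra.
  - apply Rmult_le_pos; lra.
  - intros s y s' y' L B B' [N1 N2]. simpl.
    assert (HL0 : 0 <= L) by (pose proof (Rabs_pos (s - s')); lra). split.
    + rewrite Rminus_diag, Rabs_R0. apply Rmult_le_pos; lra.
    + intros t. replace (r t + Bop y t - (r t + Bop y' t)) with (Bop y t - Bop y' t) by ring.
      rewrite Bop_minus; eauto. apply (Hcontr (fun s => y s - y' s)); auto.
      intros x. apply cont_Rminus; [apply B|apply B'].
  - intros s y B t. simpl. apply cont_Rplus; [apply Hr|].
    eapply is_derive_continuous, is_derive_J. apply (Hlad _ _ _ B).
  - simpl. split.
    + rewrite Rminus_diag, Rabs_R0. apply Rmult_le_pos; [lra|]. apply Rmult_le_pos; lra.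
    + intros t. rewrite Rminus_0_r.
      assert (Z : Bop (fun _ => 0) t = 0).
      { assert (Rabs (Bop (fun _ => 0) t) <= k0 * 0 * w t).
        { apply (Hcontr (fun _ => 0)); [intros; apply continuous_const|].
          intros x. rewrite Rabs_R0. lra. }
        rewrite Rmult_0_r, Rmult_0_l in H. destruct (Req_dec (Bop (fun _ => 0) t) 0); auto.
        apply Rabs_pos_lt in H0. lra. }
      rewrite Z, Rplus_0_r. replace ((1 - k0) * (A * M)) with M by (unfold A; field; lra).
      eapply Rle_trans; [apply (wb_exp nu M); auto; lra|]. apply Rmult_le_compat_l; auto.
      unfold w. pose proof (exp_pos (Lam * t)). nra.
  - injection Fy as _ Fy. simpl in Fy.
    assert (Feq : forall t, r t + Bop y t = y t) by (intros t; exact (f_equal (fun f => f t) Fy)).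
    exists y. split; [|intros t; rewrite <- (Feq t) at 1; ring].
    destruct By as [_ [Hyc Hyb]].
    assert (Hyleft : forall t, t <= T1 -> Rabs (y t) <= W * M).
    { intros t Ht. eapply Rle_trans; [apply Hyb|]. unfold W.
      replace (A * w T1 * M) with (A * M * w T1) by ring. apply Rmult_le_compat_l; auto.
      apply Rmult_le_pos; lra. }
    assert (Hright : forall t, T1 - h <= t -> Rabs (Bop y t) <= Cs * (W * M + M + M)).
    { intros t Ht.
      replace (W * M + M + M) with ((/ 4) ^ 0 * (W * M + M) + M) by (simpl; ring).
      apply (Hst T1 (W * M + M) M (Bop y) y q) with (j := 0%nat); auto.
      - apply Rplus_le_le_0_compat; auto. apply Rmult_le_pos; lra.
      - intros x. eapply is_derive_continuous, is_derive_J.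
        intros x'. apply cont_Rmult; auto. now apply cont_shift.
      - intros x Hx. apply HT0; lra.
      - intros x _. eapply is_derive_eq; [apply is_derive_J|].
        + intros x'. apply cont_Rmult; auto. now apply cont_shift.
        + unfold Bop; cbv beta; ring.
      - intros x _. rewrite <- (Feq x). replace (r x + Bop y x - Bop y x) with (r x) by ring.
        apply (wb_bd nu); auto; lra.
      - intros x Hx. replace (Bop y x) with (y x + - r x) by (rewrite <- Feq; ring).
        eapply Rle_trans; [apply Rabs_triang|]. rewrite Rabs_Ropp.
        pose proof (Hyleft x ltac:(lra)). pose proof (wb_bd nu M r ltac:(lra) Hr x). lra.
      - simpl. lra. }
    assert (HWM : 0 <= W * M) by (apply Rmult_le_pos; lra).
    assert (HCM : 0 <= Cs * (W + 2) * M) by (apply Rmult_le_pos; lra).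
    assert (HAM : 0 <= A * (1 + C) * M) by (apply Rmult_le_pos; lra).
    assert (Hybd : forall t, Rabs (y t) <= (W + (Cs * (W + 2) + 1)) * M).
    { intros t. destruct (Rle_dec t T1).
      - specialize (Hyleft t ltac:(lra)). lra.
      - rewrite <- (Feq t). eapply Rle_trans; [apply Rabs_triang|].
        pose proof (wb_bd nu M r ltac:(lra) Hr t). specialize (Hright t ltac:(lra)). lra. }
    apply wb_intro; auto.
    + intros t. destruct (Rle_dec t 0).
      * eapply Rle_trans; [apply Hyb|].
        assert (w t <= (1 + C) * exp (nu * t)).
        { unfold w. assert (exp (Lam * t) <= exp (nu * t)) by (apply exp_mono; nra). nra. }
        apply Rle_trans with (A * M * ((1 + C) * exp (nu * t))).
        { apply Rmult_le_compat_l; auto. apply Rmult_le_pos; lra. }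
        replace (A * M * ((1 + C) * exp (nu * t))) with (A * (1 + C) * M * exp (nu * t)) by ring.
        apply Rmult_le_compat_r; [left; apply exp_pos|]. unfold CA. lra.
      * eapply Rle_trans; [apply Hybd|].
        assert (1 <= exp (nu * t)) by (rewrite <- exp_0; apply exp_mono; nra).
        rewrite <- (Rmult_1_r ((W + (Cs * (W + 2) + 1)) * M)). apply Rmult_le_compat; try lra.
        unfold CA. lra.
    + intros t. eapply Rle_trans; [apply Hybd|]. unfold CA. lra.
Qed.

Lemma linear_unique M y : wb nu M y -> (forall t, y t = Bop y t) -> forall t, y t = 0.
Proof.
  intros Hy E. destruct weight_exists as [C [Lam [HC [HL Hcontr]]]].
  assert (Hnu0 : 0 < nu) by (unfold nu; lra).
  pose proof k0_bounds as Hk.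
  assert (Hn : forall n t, Rabs (y t) <= M * k0 ^ n * (exp (nu * t) + C * exp (Lam * t))).
  { induction n as [|n IH]; intros t.
    - simpl. rewrite Rmult_1_r. eapply Rle_trans; [apply (wb_exp nu M); auto; lra|].
      apply Rmult_le_compat_l; [apply (wb_pos _ _ _ Hy)|]. pose proof (exp_pos (Lam * t)). nra.
    - rewrite E. replace (M * k0 ^ S n) with (k0 * (M * k0 ^ n)) by (simpl; ring).
      apply Hcontr; auto. apply Hy. }
  intros t. assert (Rabs (y t) <= 0).
  { apply (small_all _ (M * (exp (nu * t) + C * exp (Lam * t))) k0); [lra|]. intros n.
    eapply Rle_trans; [apply (Hn n)|]. right. ring. }
  destruct (Req_dec (y t) 0); auto. apply Rabs_pos_lt in H0. lra.
Qed.
End LinearInverse.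

(** * The perturbed leading exponent *)

(** The bracket [5 / 4 * lam] keeps the perturbed rate away from [nu = 3 / 2 * lam], uniformly in
    small [e]. *)
Definition lambda1_fun (h lam p : R) (l1 : R -> R) : Prop :=
  l1 0 = lam /\
  (forall e, small (2 * lam) e -> lam <= l1 e <= 5 / 4 * lam /\
     1 + l1 e - e ^ 2 * l1 e ^ 2 = p * exp (- l1 e * h) /\ is_lambda1 e p h (l1 e)) /\
  (forall e e', small (2 * lam) e -> small (2 * lam) e' ->
     Rabs (l1 e - l1 e') <= 4 * lam ^ 2 * Rabs (e ^ 2 - e' ^ 2)).

(** For small [e] the characteristic function [Z e] has slope at least [/ 2] on [[0, 2 lam]] and
    changes sign between [lam] and [5 / 4 * lam]. The slope gives minimality of the root and its
    Lipschitz dependence on [e ^ 2]. *)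
Lemma lambda1_exists (h lam p : R) : 0 < h -> 0 < lam -> 0 < p -> lam + 1 = p * exp (- lam * h) ->
  exists l1, lambda1_fun h lam p l1.
Proof.
  intros Hh Hl Hp Hchar.
  set (Z := fun e z => 1 + z - e ^ 2 * z ^ 2 - p * exp (- z * h)).
  assert (Hpm : forall z z', z' <= z -> p * exp (- z * h) <= p * exp (- z' * h)).
  { intros z z' Hz. apply Rmult_le_compat_l; [lra|]. apply exp_mono. nra. }
  assert (Hsm : forall e, small (2 * lam) e -> 0 <= e ^ 2 /\ 8 * lam * e ^ 2 <= 1).
  { intros e He. unfold small in He. pose proof (pow2_ge_0 e). split; auto. nra. }
  assert (Hinc : forall e z z', small (2 * lam) e -> 0 <= z' -> z' <= z -> z <= 2 * lam ->
    (z - z') / 2 <= Z e z - Z e z').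
  { intros e z z' He Hz' Hzz Hz. destruct (Hsm e He) as [S1 S2]. specialize (Hpm z z' Hzz). unfold Z.
    assert (e ^ 2 * (z + z') <= / 2) by nra.
    replace (1 + z - e ^ 2 * z ^ 2 - p * exp (- z * h) - (1 + z' - e ^ 2 * z' ^ 2 - p * exp (- z' * h)))
      with ((z - z') - (e ^ 2 * (z + z')) * (z - z') + (p * exp (- z' * h) - p * exp (- z * h))) by ring.
    nra. }
  assert (Hex : forall e, exists z, small (2 * lam) e -> lam <= z <= 5 / 4 * lam /\ Z e z = 0).
  { intros e. destruct (excluded_middle_informative (small (2 * lam) e)) as [He|He]; [|exists 0; tauto].
    destruct (Hsm e He) as [S1 S2].
    assert (Z1 : Z e lam <= 0).
    { unfold Z. rewrite <- Hchar. assert (0 <= e ^ 2 * lam ^ 2) by (apply Rmult_le_pos; nra). lra. }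
    assert (Z2 : 0 <= Z e (5 / 4 * lam)).
    { unfold Z. pose proof (Hpm (5 / 4 * lam) lam ltac:(lra)). rewrite <- Hchar in H.
      assert (e ^ 2 * (5 / 4 * lam) ^ 2 <= lam / 4); [|lra].
      replace (e ^ 2 * (5 / 4 * lam) ^ 2) with ((8 * lam * e ^ 2) * (25 / 128 * lam)) by field. nra. }
    destruct (IVT_cor (Z e) lam (5 / 4 * lam)) as [z [Hz1 Hz2]]; [|lra|nra|].
    - intros x. apply continuity_pt_filterlim. unfold Z.
      apply (is_derive_continuous (fun z => 1 + z - e ^ 2 * z ^ 2 - p * exp (- z * h)) x
        (1 - e ^ 2 * (2 * x) + p * h * exp (- x * h))). auto_derive; auto. ring.
    - exists z. auto. }
  destruct (fun_choice _ _ _ Hex) as [l1 Hl1].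
  assert (Hlip : forall e e', small (2 * lam) e -> small (2 * lam) e' ->
     Rabs (l1 e - l1 e') <= 4 * lam ^ 2 * Rabs (e ^ 2 - e' ^ 2)).
  { assert (main : forall e e', small (2 * lam) e -> small (2 * lam) e' -> l1 e' <= l1 e ->
      l1 e - l1 e' <= 4 * lam ^ 2 * Rabs (e ^ 2 - e' ^ 2)).
    { intros e e' He He' Hle. destruct (Hl1 e He) as [R1 E1]. destruct (Hl1 e' He') as [R2 E2].
      pose proof (Hinc e (l1 e) (l1 e') He ltac:(lra) Hle ltac:(lra)) as Hi.
      assert (Z e (l1 e') = (e' ^ 2 - e ^ 2) * l1 e' ^ 2).
      { unfold Z in *. lra. }
      assert (l1 e' ^ 2 <= 2 * lam ^ 2) by nra.
      assert (- ((e' ^ 2 - e ^ 2) * l1 e' ^ 2) <= Rabs (e ^ 2 - e' ^ 2) * (2 * lam ^ 2)).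
      { replace (- ((e' ^ 2 - e ^ 2) * l1 e' ^ 2)) with ((e ^ 2 - e' ^ 2) * l1 e' ^ 2) by ring.
        apply Rle_trans with (Rabs (e ^ 2 - e' ^ 2) * l1 e' ^ 2).
        - apply Rmult_le_compat_r; [apply pow2_ge_0|apply Rle_abs].
        - apply Rmult_le_compat_l; [apply Rabs_pos|auto]. }
      rewrite E1, H in Hi. lra. }
    intros e e' He He'. destruct (Rle_dec (l1 e') (l1 e)).
    - rewrite Rabs_right by lra. now apply main.
    - rewrite Rabs_left1 by lra. rewrite (Rabs_minus_sym (e ^ 2)). replace (- (l1 e - l1 e')) with (l1 e' - l1 e) by ring.
      apply main; auto; lra. }
  exists l1. split; [|split]; auto.
  - destruct (Hl1 0 (small_0 _)) as [R1 E1].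
    pose proof (Hinc 0 (l1 0) lam (small_0 _) ltac:(lra) ltac:(lra) ltac:(lra)).
    assert (Z 0 lam = 0) by (unfold Z; lra). lra.
  - intros e He. destruct (Hl1 e He) as [R1 E1]. split; auto. split; [unfold Z in E1; lra|].
    split; [lra|]. split; [unfold char_eq; unfold Z in E1; lra|].
    intros z Hz Hc. pose proof (Hinc e (l1 e) z He ltac:(lra) ltac:(lra) ltac:(lra)).
    unfold char_eq in Hc. unfold Z in *. lra.
Qed.

(** * The defect of the truncated leading exponential *)

Section Rho.
Variables (h lam p : R) (l1 : R -> R).
Hypothesis Hh : 0 < h.
Hypothesis Hlam : 0 < lam.
Hypothesis Hp : 0 < p.
Hypothesis Hl1 : lambda1_fun h lam p l1.
Let N := 2 * lam.
Let nu := 3 / 2 * lam.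

(** The defect of [wt (l1 e)] in the linear fixed-point equation [x = p * Iop e (x (. - h))]. *)
Definition rho (e t : R) : R := p * Iop e (fun s => wt (l1 e) (s - h)) t - wt (l1 e) t.

Let tht (z t : R) : R := exp (z * t) - wt z t.

Lemma tht_cont z t : continuous (tht z) t.
Proof. apply cont_Rminus; [apply cont_expk|apply wt_cont]. Qed.

Lemma tht_bound z t : lam <= z <= 5 / 4 * lam -> Rabs (tht z t) <= 1 * exp (nu * t).
Proof.
  intros Hz. unfold tht. destruct (Rle_dec t 0).
  - rewrite wt_neg, Rminus_diag, Rabs_R0 by auto. pose proof (exp_pos (nu * t)). lra.
  - rewrite wt_nonneg by lra.
    assert (1 <= exp (z * t)) by (rewrite <- exp_0; apply exp_mono; nra).
    assert (exp (z * t) <= exp (nu * t)) by (apply exp_mono; unfold nu; nra).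
    rewrite Rabs_right; lra.
Qed.

(** For [t > 0] the factor [t] from varying the rate is absorbed by [exp (lam / 4 * t)], the gap
    between [5 / 4 * lam] and [nu]. *)
Lemma tht_diff z z' t : lam <= z <= 5 / 4 * lam -> lam <= z' <= 5 / 4 * lam ->
  Rabs (tht z t - tht z' t) <= 4 / lam * Rabs (z - z') * exp (nu * t).
Proof.
  assert (main : forall z z', lam <= z <= 5 / 4 * lam -> lam <= z' <= 5 / 4 * lam -> z' <= z ->
    Rabs (tht z t - tht z' t) <= 4 / lam * Rabs (z - z') * exp (nu * t)).
  { clear z z'. intros z z' Hz Hz' Hzz. unfold tht. 
    assert (0 < 4 / lam) by (apply Rdiv_lt_0_compat; lra).
    destruct (Rle_dec t 0).
    - rewrite !wt_neg by auto. replace (exp (z * t) - exp (z * t) - (exp (z' * t) - exp (z' * t))) with 0 by ring.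
      rewrite Rabs_R0. pose proof (exp_pos (nu * t)). pose proof (Rabs_pos (z - z')).
      apply Rmult_le_pos; [apply Rmult_le_pos|]; lra.
    - rewrite !wt_nonneg by lra. replace (exp (z * t) - 1 - (exp (z' * t) - 1)) with (exp (z * t) - exp (z' * t)) by ring.
      assert (exp (z' * t) <= exp (z * t)) by (apply exp_mono; nra).
      rewrite !Rabs_right by lra.
      replace (z' * t) with (z * t + - ((z - z') * t)) by ring. rewrite exp_plus.
      pose proof (exp_ineq1_le (- ((z - z') * t))). pose proof (exp_pos (z * t)).
      assert (exp (z * t) * (1 - exp (- ((z - z') * t))) <= exp (z * t) * ((z - z') * t)) by (apply Rmult_le_compat_l; lra).
      assert (Hx : lam / 4 * t * exp (- (lam / 4 * t)) <= 1) by (apply xexp_bound; nra).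
      assert (exp (z * t) <= exp (nu * t) * exp (- (lam / 4 * t))).
      { rewrite <- exp_plus. apply exp_mono. unfold nu. nra. }
      apply Rle_trans with (exp (nu * t) * exp (- (lam / 4 * t)) * ((z - z') * t)).
      + apply Rle_trans with (exp (z * t) * ((z - z') * t)); [lra|]. apply Rmult_le_compat_r; auto. nra.
      + replace (exp (nu * t) * exp (- (lam / 4 * t)) * ((z - z') * t)) with
          (4 / lam * (z - z') * exp (nu * t) * (lam / 4 * t * exp (- (lam / 4 * t)))) by (field; lra).
        rewrite <- (Rmult_1_r (4 / lam * (z - z') * exp (nu * t))) at 2.
        apply Rmult_le_compat_l; auto. pose proof (exp_pos (nu * t)).
        apply Rmult_le_pos; [apply Rmult_le_pos|]; lra. }
  intros Hz Hz'. destruct (Rle_dec z' z); [now apply main|].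
  rewrite Rabs_minus_sym, (Rabs_minus_sym z). apply main; auto; lra.
Qed.

Lemma exp_shift_bound f M k : 0 <= k -> (forall t, Rabs (f t) <= M * exp (k * t)) ->
  forall t, Rabs (f (t - h)) <= M * exp (k * t).
Proof.
  intros Hk Hf t. assert (HM := exp_bound_nonneg _ _ _ Hf). eapply Rle_trans; [apply Hf|].
  apply Rmult_le_compat_l; auto. apply exp_mono. nra.
Qed.

Lemma N_pos : 0 <= N. Proof. unfold N; lra. Qed.
Lemma nu_N : 0 <= nu <= N. Proof. unfold N, nu; lra. Qed.

Lemma wt_l1_wb e : small N e -> wb lam 1 (wt (l1 e)).
Proof.
  intros He. destruct Hl1 as [_ [H _]]. destruct (H e He) as [H1 _].
  apply (wb_weak (l1 e) lam 1); try lra. apply wb_wt.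
Qed.

Lemma wt_l1_diff e e' : small N e -> small N e' ->
  wb (lam / 2) (8 * lam * Rabs (e ^ 2 - e' ^ 2)) (fun t => wt (l1 e) t - wt (l1 e') t).
Proof.
  intros He He'. destruct Hl1 as [_ [H HL]]. destruct (H e He) as [H1 _]. destruct (H e' He') as [H2 _].
  split; [intros t; apply cont_Rminus; apply wt_cont|]. intros t.
  eapply Rle_trans; [apply (wt_diff lam (lam / 2)); lra|].
  replace (lam - lam / 2) with (lam / 2) by field.
  apply Rmult_le_compat_r; [left; apply wt_pos|].
  replace (8 * lam * Rabs (e ^ 2 - e' ^ 2)) with (/ (lam / 2) * (4 * lam ^ 2 * Rabs (e ^ 2 - e' ^ 2))) by (field; lra).
  apply Rmult_le_compat_l; [left; apply Rinv_0_lt_compat; lra|]. now apply HL.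
Qed.

Lemma adm_tht e : small N e -> adm N (fun s => tht (l1 e) (s - h)).
Proof.
  intros He. destruct Hl1 as [_ [H _]]. destruct (H e He) as [H1 _].
  apply (adm_exp N nu 1); [apply nu_N| |].
  - intros t. apply cont_shift, tht_cont.
  - apply exp_shift_bound; [apply nu_N|]. intros t. now apply tht_bound.
Qed.

Lemma adm_exps z : 0 <= z <= N -> adm N (fun s => exp (z * (s - h))).
Proof.
  intros Hz. apply (adm_exp N z 1); auto.
  - intros t. apply (cont_shift (fun s => exp (z * s))), cont_expk.
  - apply (exp_shift_bound (fun s => exp (z * s)) 1 z); [lra|]. intros t.
    rewrite Rabs_right; [lra|]. left; apply exp_pos.
Qed.

Lemma Iop_exp_l1 e t : small N e -> p * Iop e (fun s => exp (l1 e * (s - h))) t = exp (l1 e * t).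
Proof.
  intros He. destruct Hl1 as [_ [H _]]. destruct (H e He) as [H1 [H2 _]].
  replace (fun s => exp (l1 e * (s - h))) with (fun s => exp (- l1 e * h) * exp (l1 e * s)).
  2: { apply functional_extensionality. intros s. rewrite <- exp_plus. f_equal. ring. }
  rewrite (Iop_scal N e N_pos He).
  2: { apply (adm_exp N (l1 e) 1); [unfold N; lra|intros; apply cont_expk|].
       intros s. rewrite Rabs_right; [lra|left; apply exp_pos]. }
  rewrite (Iop_expk N e N_pos He) by (unfold N; lra). rewrite H2. field.
  pose proof (exp_pos (- l1 e * h)). lra.
Qed.

(** By the characteristic equation the full exponential has no defect, so the truncated one has the
    opposite defect of the discarded part [tht]. As [tht] vanishes for [t <= 0], this form reveals
    the rate [nu] at [-oo]. *)
Lemma rho_alt e t : small N e -> rho e t = tht (l1 e) t - p * Iop e (fun s => tht (l1 e) (s - h)) t.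
Proof.
  intros He. destruct (proj1 (proj2 Hl1) e He) as [H1 _].
  assert (E : Iop e (fun s => exp (l1 e * (s - h))) t =
    Iop e (fun s => tht (l1 e) (s - h)) t + Iop e (fun s => wt (l1 e) (s - h)) t).
  { rewrite <- (Iop_plus N e N_pos He).
    - f_equal. apply functional_extensionality. intros s. unfold tht. ring.
    - now apply adm_tht.
    - apply (wb_adm N lam 1); [unfold N; lra|]. apply (wb_shift lam 1 (wt (l1 e))); try lra. now apply wt_l1_wb. }
  pose proof (Iop_exp_l1 e t He). rewrite E in H. unfold rho, tht. unfold tht in H. lra.
Qed.

Definition Crho : R := 16 * lam + 64 * p * lam + 40 * p.

(** [rho_alt] gives the rate [nu] but grows at [+oo] with [tht]; the definition of [rho], built from
    bounded functions, gives boundedness. [rho_diff] uses the same pair of representations. *)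
Lemma rho_wb e : small N e -> wb nu (1 + 2 * p) (rho e).
Proof.
  intros He. destruct (proj1 (proj2 Hl1) e He) as [H1 _].
  assert (Hs : wb lam 1 (fun s => wt (l1 e) (s - h))) by (apply (wb_shift lam 1 (wt (l1 e))); try lra; now apply wt_l1_wb).
  apply wb_intro.
  - intros t. apply cont_Rminus; [apply cont_Rscal, Iop_cont, Hs|apply wt_cont].
  - intros t. rewrite rho_alt by auto. eapply Rle_trans; [apply Rabs_sub_le|].
    rewrite Rabs_mult, (Rabs_right p) by lra.
    pose proof (tht_bound (l1 e) t H1).
    assert (Rabs (Iop e (fun s => tht (l1 e) (s - h)) t) <= 2 * 1 * exp (nu * t)).
    { apply (Iop_exp_bound2 N e N_pos He); [pose proof nu_N; lra|now apply adm_tht|].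
      apply exp_shift_bound; [apply nu_N|]. intros s. now apply tht_bound. }
    apply Rmult_le_compat_l with (r := p) in H0; lra.
  - intros t. unfold rho. eapply Rle_trans; [apply Rabs_sub_le|].
    rewrite Rabs_mult, (Rabs_right p) by lra.
    pose proof (wb_bd lam (2 * 1) _ ltac:(lra) (wb_Iop N e lam 1 _ He ltac:(unfold N; lra) Hs) t).
    pose proof (wb_bd lam 1 _ ltac:(lra) (wt_l1_wb e He) t).
    apply Rmult_le_compat_l with (r := p) in H; lra.
Qed.

Lemma rho_diff e e' : small N e -> small N e' ->
  wb nu (Crho * Rabs (e ^ 2 - e' ^ 2)) (fun t => rho e t - rho e' t).
Proof.
  intros He He'. destruct (proj1 (proj2 Hl1) e He) as [H1 _]. destruct (proj1 (proj2 Hl1) e' He') as [H2 _].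
  pose proof (proj2 (proj2 Hl1) e e' He He') as HL.
  set (d := Rabs (e ^ 2 - e' ^ 2)) in *. assert (Hd : 0 <= d) by apply Rabs_pos.
  assert (Hs : wb lam 1 (fun s => wt (l1 e) (s - h))) by (apply (wb_shift lam 1 (wt (l1 e))); try lra; now apply wt_l1_wb).
  assert (Hs' : wb lam 1 (fun s => wt (l1 e') (s - h))) by (apply (wb_shift lam 1 (wt (l1 e'))); try lra; now apply wt_l1_wb).
  assert (Hds := wt_l1_diff e e' He He'). fold d in Hds.
  assert (Hdss : wb (lam / 2) (8 * lam * d) (fun t => wt (l1 e) (t - h) - wt (l1 e') (t - h)))
    by (apply (wb_shift (lam / 2) (8 * lam * d) (fun t => wt (l1 e) t - wt (l1 e') t)); auto; lra).
  assert (Hld : 0 <= lam * d) by nra. assert (Hpd : 0 <= p * d) by nra. assert (Hpld : 0 <= p * (lam * d)) by nra.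
  assert (H4 : 4 / lam * Rabs (l1 e - l1 e') <= 16 * lam * d).
  { replace (16 * lam * d) with (4 / lam * (4 * lam ^ 2 * d)) by (field; lra).
    apply Rmult_le_compat_l; auto. left. apply Rdiv_lt_0_compat; lra. }
  apply wb_intro.
  - intros t. apply cont_Rminus; apply rho_wb; auto.
  - assert (T : forall t, Rabs (tht (l1 e) t - tht (l1 e') t) <= 16 * lam * d * exp (nu * t)).
    { intros t. eapply Rle_trans; [now apply tht_diff|]. apply Rmult_le_compat_r; auto. left; apply exp_pos. }
    assert (Ts := exp_shift_bound (fun t => tht (l1 e) t - tht (l1 e') t) _ nu (proj1 nu_N) T). cbv beta in Ts.
    intros t. rewrite !rho_alt by auto.
    assert (E : Iop e (fun s => tht (l1 e) (s - h)) t - Iop e' (fun s => tht (l1 e') (s - h)) t =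
      Iop e (fun s => tht (l1 e) (s - h) - tht (l1 e') (s - h)) t +
      (Iop e (fun s => tht (l1 e') (s - h)) t - Iop e' (fun s => tht (l1 e') (s - h)) t)).
    { replace (fun s => tht (l1 e) (s - h) - tht (l1 e') (s - h)) with
        (fun s => tht (l1 e) (s - h) + (-1) * tht (l1 e') (s - h)) by (apply functional_extensionality; intros; ring).
      rewrite (Iop_plus N e N_pos He), (Iop_scal N e N_pos He); try apply adm_scal; try (now apply adm_tht). ring. }
    replace (tht (l1 e) t - p * Iop e (fun s => tht (l1 e) (s - h)) t -
      (tht (l1 e') t - p * Iop e' (fun s => tht (l1 e') (s - h)) t)) with
      ((tht (l1 e) t - tht (l1 e') t) + - (p * (Iop e (fun s => tht (l1 e) (s - h)) t - Iop e' (fun s => tht (l1 e') (s - h)) t))) by ring.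
    rewrite E. eapply Rle_trans; [apply Rabs_triang|]. rewrite Rabs_Ropp, Rabs_mult, (Rabs_right p) by lra.
    assert (B1 : Rabs (Iop e (fun s => tht (l1 e) (s - h) - tht (l1 e') (s - h)) t) <= 2 * (16 * lam * d) * exp (nu * t)).
    { apply (Iop_exp_bound2 N e N_pos He); [pose proof nu_N; lra| |auto].
      apply (adm_exp N nu (16 * lam * d)); [apply nu_N| |auto].
      intros s. apply cont_Rminus; apply cont_shift, tht_cont. }
    assert (B2 : Rabs (Iop e (fun s => tht (l1 e') (s - h)) t - Iop e' (fun s => tht (l1 e') (s - h)) t) <=
      20 * d * 1 * exp (nu * t)).
    { apply (Iop_diff N e e' nu 1); auto; [apply N_pos|pose proof nu_N; lra|now apply adm_tht|].
      apply exp_shift_bound; [apply nu_N|]. intros s. now apply tht_bound. }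
    pose proof (Rabs_triang (Iop e (fun s => tht (l1 e) (s - h) - tht (l1 e') (s - h)) t)
      (Iop e (fun s => tht (l1 e') (s - h)) t - Iop e' (fun s => tht (l1 e') (s - h)) t)) as B3.
    specialize (T t). pose proof (exp_pos (nu * t)) as Hx.
    eapply Rle_trans; [apply Rplus_le_compat; [exact T|apply Rmult_le_compat_l; [lra|]; eapply Rle_trans; [exact B3|];
      apply Rplus_le_compat; [exact B1|exact B2]]|].
    unfold Crho.
    replace (16 * lam * d * exp (nu * t) + p * (2 * (16 * lam * d) * exp (nu * t) + 20 * d * 1 * exp (nu * t)))
      with ((16 * (lam * d) + 32 * (p * (lam * d)) + 20 * (p * d)) * exp (nu * t)) by ring.
    apply Rmult_le_compat_r; lra.
  - intros t. unfold rho.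
    assert (E : Iop e (fun s => wt (l1 e) (s - h)) t - Iop e' (fun s => wt (l1 e') (s - h)) t =
      (Iop e (fun s => wt (l1 e) (s - h)) t - Iop e' (fun s => wt (l1 e) (s - h)) t) +
      Iop e' (fun s => wt (l1 e) (s - h) - wt (l1 e') (s - h)) t).
    { replace (fun s => wt (l1 e) (s - h) - wt (l1 e') (s - h)) with
        (fun s => wt (l1 e) (s - h) + (-1) * wt (l1 e') (s - h)) by (apply functional_extensionality; intros; ring).
      rewrite (Iop_plus N e' N_pos He'), (Iop_scal N e' N_pos He'); try apply adm_scal;
        try (eapply (wb_adm N lam); [unfold N; lra|eassumption]). ring. }
    replace (p * Iop e (fun s => wt (l1 e) (s - h)) t - wt (l1 e) t - (p * Iop e' (fun s => wt (l1 e') (s - h)) t - wt (l1 e') t))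
      with (p * (Iop e (fun s => wt (l1 e) (s - h)) t - Iop e' (fun s => wt (l1 e') (s - h)) t) + - (wt (l1 e) t - wt (l1 e') t)) by ring.
    rewrite E. eapply Rle_trans; [apply Rabs_triang|]. rewrite Rabs_Ropp, Rabs_mult, (Rabs_right p) by lra.
    pose proof (wb_bd lam _ _ ltac:(lra) (wb_Iop_diff N e e' lam 1 _ He He' ltac:(unfold N; lra) Hs) t) as B1. fold d in B1.
    pose proof (wb_bd (lam / 2) _ _ ltac:(lra) (wb_Iop N e' (lam / 2) _ _ He' ltac:(unfold N; lra) Hdss) t) as B2.
    pose proof (wb_bd (lam / 2) _ _ ltac:(lra) Hds t) as B3. cbv beta in B1, B2, B3.
    eapply Rle_trans; [apply Rplus_le_compat; [apply Rmult_le_compat_l; [lra|]; eapply Rle_trans; [apply Rabs_triang|];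
      apply Rplus_le_compat; [exact B1|exact B2]|exact B3]|].
    unfold Crho. lra.
Qed.
End Rho.

(** * Convergence at plus infinity *)

Lemma cont_Rmin (f g : R -> R) t : continuous f t -> continuous g t -> continuous (fun x => Rmin (f x) (g x)) t.
Proof.
  intros Hf Hg. apply (continuous_ext (fun x => g x + Rmin (f x - g x) 0)).
  - intros x. change (g x + Rmin (f x - g x) 0 = Rmin (f x) (g x)).
    unfold Rmin. destruct (Rle_dec (f x - g x) 0), (Rle_dec (f x) (g x)); lra.
  - apply cont_Rplus; auto. apply (continuous_comp (fun x => f x - g x) (fun x => Rmin x 0)).
    + now apply cont_Rminus.
    + apply cont_min0.
Qed.

Lemma cont_Ropp (f : R -> R) t : continuous f t -> continuous (fun x => - f x) t.
Proof. intros H. apply (continuous_opp f); auto. Qed.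

(** [f1] is [f] clipped to [[-a, a]]. The splitting lets estimates for one exponential serve for a
    sum of two, while [f1] and [f2] stay continuous. *)
Lemma split_bound (f a b : R -> R) : (forall t, continuous f t) -> (forall t, continuous a t) ->
  (forall t, 0 <= a t) -> (forall t, 0 <= b t) -> (forall t, Rabs (f t) <= a t + b t) ->
  exists f1 f2, (forall t, f t = f1 t + f2 t) /\ (forall t, continuous f1 t) /\ (forall t, continuous f2 t) /\
    (forall t, Rabs (f1 t) <= a t) /\ (forall t, Rabs (f2 t) <= b t).
Proof.
  intros Hf Ha Ha0 Hb0 Hb.
  set (f1 := fun t => - Rmin (- Rmin (f t) (a t)) (a t)).
  assert (H1 : forall t, continuous f1 t).
  { intros t. apply cont_Ropp, (cont_Rmin (fun t => - Rmin (f t) (a t)) a); auto.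
    apply cont_Ropp. now apply cont_Rmin. }
  exists f1, (fun t => f t - f1 t). split; [intros; ring|]. split; [auto|].
  split; [intros t; now apply cont_Rminus|].
  assert (E : forall t, Rabs (f1 t) <= a t /\ Rabs (f t - f1 t) <= b t).
  { intros t. specialize (Ha0 t). specialize (Hb0 t). specialize (Hb t). apply Rabs_le_between in Hb.
    unfold f1. unfold Rmin at 2 4. destruct (Rle_dec (f t) (a t)) as [L1|L1].
    - unfold Rmin. destruct (Rle_dec (- f t) (a t)); split; apply Rabs_le; lra.
    - unfold Rmin. destruct (Rle_dec (- a t) (a t)); split; apply Rabs_le; lra. }
  split; intros t; apply E.
Qed.

Lemma Iop_two N e nu nu' A B f : 0 <= N -> small N e -> 0 <= nu <= N -> 0 <= nu' <= N ->
  0 <= A -> 0 <= B -> (forall t, continuous f t) ->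
  (forall t, Rabs (f t) <= A * exp (nu * t) + B * exp (nu' * t)) ->
  forall t, Rabs (Iop e f t) <= A / (1 + nu - e ^ 2 * nu ^ 2) * exp (nu * t) +
     B / (1 + nu' - e ^ 2 * nu' ^ 2) * exp (nu' * t).
Proof.
  intros HN He Hnu Hnu' HA HB Hc Hb t.
  destruct (split_bound f (fun t => A * exp (nu * t)) (fun t => B * exp (nu' * t))) as [f1 [f2 [E [C1 [C2 [B1 B2]]]]]]; auto.
  - intros x. apply cont_Rscal, cont_expk.
  - intros x. apply Rmult_le_pos; auto. left; apply exp_pos.
  - intros x. apply Rmult_le_pos; auto. left; apply exp_pos.
  - replace f with (fun t => f1 t + f2 t) by (apply functional_extensionality; intros; now rewrite E).
    assert (A1 : adm N f1) by (apply (adm_exp N nu A); auto).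
    assert (A2 : adm N f2) by (apply (adm_exp N nu' B); auto).
    rewrite (Iop_plus N e HN He) by auto. eapply Rle_trans; [apply Rabs_triang|].
    apply Rplus_le_compat; apply (Iop_exp_bound N e); auto; lra.
Qed.

Lemma wt0 t : wt 0 t = 1.
Proof. unfold wt. now rewrite Rmult_0_l, exp_0. Qed.

Lemma Iop_const N e c t : 0 <= N -> small N e -> Iop e (fun _ => c) t = c.
Proof.
  intros HN He.
  replace (fun _ : R => c) with (fun s => c * exp (0 * s))
    by (apply functional_extensionality; intros; rewrite Rmult_0_l, exp_0; ring).
  rewrite (Iop_scal N e HN He).
  - rewrite (Iop_expk N e HN He) by lra. rewrite Rmult_0_l, exp_0. field.
  - apply (adm_exp N 0 1); [lra|intros; apply cont_expk|].
    intros s. rewrite Rabs_right; [lra|left; apply exp_pos].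
Qed.

(** Self-improvement: a bound [m] on [x - K] valid for large times is halved at later times. Compare
    [x - K] with [v = J 1 (f - K)]: they differ by [Iop e - Iop 0] applied to [f - K], which is
    small with [e ^ 2], and [v] decays by [stable_lin]. *)
Lemma limit_at_plus (N h K : R) (G dG : R -> R) : 0 <= N -> 0 < h ->
  (forall u, is_derive G u (dG u)) -> (forall u, continuous dG u) -> G K = K -> stable_lin h (dG K) ->
  exists r e2, 0 < r /\ 0 < e2 /\ forall e x, small N e -> Rabs e <= e2 -> (forall t, continuous x t) ->
    (exists B, forall t, Rabs (x t) <= B) -> (forall t, x t = Iop e (fun s => G (x (s - h))) t) ->
    (exists T, forall t, T <= t -> Rabs (x t - K) <= r) -> is_lim x p_infty K.
Proof.
  intros HN Hh HGd HdGc HK [L [Cs [i [HL [HCs [Hi Hst]]]]]].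
  set (k := dG K) in *.
  destruct (eps_cont dG K (HdGc K) i Hi) as [d [Hd Hcd]].
  set (Q := Rabs k + i). assert (HQ : 0 < Q) by (unfold Q; pose proof (Rabs_pos k); lra).
  (* The budget of the halving step: [2 * th0 * m] for [x - K - v] and [(Cs + 1) * th0 * (4 * m)]
     for [v], together at most [6 / 16 * m]. *)
  set (th0 := / (16 * (Cs + 1))). assert (Hth : 0 < th0) by (apply Rinv_0_lt_compat; lra).
  assert (Hth2 : (Cs + 1) * th0 = / 16) by (unfold th0; field; lra).
  set (q2 := th0 / (20 * Q)). assert (Hq2 : 0 < q2) by (apply Rdiv_lt_0_compat; lra).
  exists (d / 2), (sqrt q2). split; [lra|]. split; [now apply sqrt_lt_R0|].
  intros e x He He2 Hxc [B HB] Hfix [T0 HT0].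
  assert (Heq : 0 <= e ^ 2 <= q2).
  { split; [apply pow2_ge_0|]. rewrite <- (sqrt_sqrt q2) by lra. rewrite <- pow2_abs.
    pose proof (Rabs_pos e). pose proof (sqrt_pos q2). simpl. nra. }
  assert (HeQ : 20 * e ^ 2 * Q <= th0).
  { apply Rle_trans with (20 * q2 * Q); [apply Rmult_le_compat_r; lra|]. right. unfold q2. field. lra. }
  assert (HGc : forall u, continuous G u) by (intros; eapply is_derive_continuous, HGd).
  set (f := fun s => G (x (s - h))).
  assert (Hfc : forall t, continuous f t).
  { intros t. apply (continuous_comp (fun s => x (s - h)) G); auto. now apply cont_shift. }
  destruct (cont_bounded (fun u => G u - K) (- B) B) as [FB [HFB HFb]].
  { intros u. apply cont_Rminus; auto. apply continuous_const. }
  assert (Hf0 : forall t, Rabs (f t - K) <= FB).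
  { intros t. apply HFb. apply Rabs_le_between, HB. }
  assert (HF0 : wb 0 FB (fun t => f t - K)).
  { split; [intros t; apply cont_Rminus; auto; apply continuous_const|]. intros t. rewrite wt0, Rmult_1_r. auto. }
  assert (HFa : adm N (fun t => f t - K)) by (apply (wb_adm N 0 FB); auto; lra).
  assert (HFl : ladm 0 (fun t => f t - K)) by now apply (adm_ladm0 N).
  set (v := J 1 (fun t => f t - K)).
  assert (Hyv : forall t, (x t - K) - v t = Iop e (fun s => f s - K) t - Iop 0 (fun s => f s - K) t).
  { intros t. rewrite Iop_0. fold v. assert (E : x t - K = Iop e (fun s => f s - K) t); [|lra].
    rewrite (Hfix t) at 1. fold f.
    replace f with (fun s => (f s - K) + K) at 1 by (apply functional_extensionality; intros; ring).
    rewrite (Iop_plus N e HN He); auto.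
    - rewrite (Iop_const N e K t HN He). ring.
    - apply (adm_exp N 0 (Rabs K)); [lra|intros; apply continuous_const|].
      intros s. rewrite Rmult_0_l, exp_0. lra. }
  (* Difference quotients of [G] at [K] make the nonlinear equation an exactly linear one, with a
     coefficient [q] close to [k] once [x] is close to [K]. *)
  assert (Hslope : forall u, exists s, G u - K = s * (u - K) /\ (Rabs (u - K) <= d / 2 -> Rabs (s - k) <= i)).
  { intros u. destruct (mvt_between G dG u K HGd) as [c [H1 H2]]. rewrite HK in H2. exists (dG c). split; auto.
    intros Hu. left. apply Hcd. apply Rabs_le_between in Hu.
    apply Rle_lt_trans with (d / 2); [|lra]. apply Rabs_le.
    destruct (Rle_dec u K).
    - rewrite Rmin_left, Rmax_right in H1 by lra. lra.
    - rewrite Rmin_right, Rmax_left in H1 by lra. lra. }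
  destruct (fun_choice _ _ _ Hslope) as [sl Hsl].
  set (q := fun t => sl (x (t - h))).
  assert (Hfq : forall t, f t - K = q t * (x (t - h) - K)) by (intros t; apply Hsl).
  assert (halve : forall m T, 0 < m <= d / 2 -> (forall t, T <= t -> Rabs (x t - K) <= m) ->
    exists T', forall t, T' <= t -> Rabs (x t - K) <= m / 2).
  { intros m T Hm HT.
    assert (Hq : forall t, T + h <= t -> Rabs (q t - k) <= i).
    { intros t Ht. apply Hsl. specialize (HT (t - h) ltac:(lra)). lra. }
    assert (HfT : forall t, T + h <= t -> Rabs (f t - K) <= Q * m).
    { intros t Ht. rewrite Hfq. apply Rabs_mult_le; [|apply HT; lra].
      replace (q t) with ((q t - k) + k) by ring. eapply Rle_trans; [apply Rabs_triang|].
      specialize (Hq t Ht). unfold Q. lra. }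
    (* [Iop e] sees the whole past, where only the bound [FB] is known. [A * exp (- / 4 * t)]
       dominates it to the left of [T + h] and fades later, whence the exponent [- / 4] in the
       operator bounds. *)
    set (A := FB * exp (/ 4 * (T + h))). assert (HA : 0 <= A) by (apply Rmult_le_pos; auto; left; apply exp_pos).
    destruct (split_bound (fun t => f t - K) (fun _ => Q * m) (fun t => A * exp (- / 4 * t)))
      as [f1 [f2 [E [C1 [C2 [B1 B2]]]]]].
    - apply HF0.
    - intros; apply continuous_const.
    - intros; apply Rmult_le_pos; lra.
    - intros t; apply Rmult_le_pos; auto. left; apply exp_pos.
    - intros t. destruct (Rle_dec (T + h) t).
      + specialize (HfT t ltac:(lra)). assert (0 <= A * exp (- / 4 * t)) by (apply Rmult_le_pos; auto; left; apply exp_pos). lra.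
      + assert (FB <= A * exp (- / 4 * t)).
        { unfold A. rewrite Rmult_assoc, <- exp_plus. rewrite <- (Rmult_1_r FB) at 1.
          apply Rmult_le_compat_l; auto. rewrite <- exp_0. apply exp_mono. lra. }
        assert (0 <= Q * m) by (apply Rmult_le_pos; lra). specialize (Hf0 t). lra.
    - assert (B1' : forall t, Rabs (f1 t) <= Q * m * exp (0 * t)) by (intros t; rewrite Rmult_0_l, exp_0, Rmult_1_r; auto).
      assert (A1 : adm N f1) by (apply (adm_exp N 0 (Q * m)); auto; lra).
      assert (A2 : adm N f2).
      { replace f2 with (fun t => (f t - K) + (-1) * f1 t).
        - apply adm_plus; auto. now apply adm_scal.
        - apply functional_extensionality. intros t. rewrite E. ring. }
      assert (Hr : forall t, Rabs ((x t - K) - v t) <= th0 * m + 20 * e ^ 2 * A * exp (- / 4 * t)).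
      { intros t. rewrite Hyv.
        replace (fun s => f s - K) with (fun s => f1 s + f2 s) by (apply functional_extensionality; intros; now rewrite E).
        rewrite (Iop_plus N e HN He), (Iop_plus N 0 HN (small_0 N)) by auto.
        replace (Iop e f1 t + Iop e f2 t - (Iop 0 f1 t + Iop 0 f2 t)) with
          ((Iop e f1 t - Iop 0 f1 t) + (Iop e f2 t - Iop 0 f2 t)) by ring.
        assert (Esq : Rabs (e ^ 2 - 0 ^ 2) = e ^ 2)
          by (replace (e ^ 2 - 0 ^ 2) with (e ^ 2) by ring; apply Rabs_right, Rle_ge, pow2_ge_0).
        pose proof (Iop_diff N e 0 0 (Q * m) f1 HN He (small_0 N) ltac:(lra) A1 B1' t) as D1.
        pose proof (Iop_diff N e 0 (- / 4) A f2 HN He (small_0 N) ltac:(lra) A2 B2 t) as D2.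
        rewrite Esq in D1, D2. rewrite Rmult_0_l, exp_0, Rmult_1_r in D1.
        eapply Rle_trans; [apply Rabs_triang|]. apply Rplus_le_compat; auto.
        eapply Rle_trans; [exact D1|].
        replace (20 * e ^ 2 * (Q * m)) with (20 * e ^ 2 * Q * m) by ring. apply Rmult_le_compat_r; lra. }
      destruct (exp_neg_small (/ 4) (th0 * m / (20 * e ^ 2 * A + 1))) as [T2 HT2]; [lra| |].
      { apply Rdiv_lt_0_compat; [nra|]. assert (0 <= 20 * e ^ 2 * A) by (apply Rmult_le_pos; lra). lra. }
      set (T3 := Rmax T (- T2)).
      assert (HT3 : T <= T3 /\ - T2 <= T3) by (split; [apply Rmax_l|apply Rmax_r]).
      assert (Hr2 : forall t, T3 <= t -> Rabs ((x t - K) - v t) <= 2 * th0 * m).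
      { intros t Ht. eapply Rle_trans; [apply Hr|].
        specialize (HT2 (- t) ltac:(lra)). replace (/ 4 * - t) with (- / 4 * t) in HT2 by ring.
        assert (H0 : 0 <= 20 * e ^ 2 * A) by (apply Rmult_le_pos; lra).
        pose proof (exp_pos (- / 4 * t)).
        apply Rmult_lt_compat_l with (r := 20 * e ^ 2 * A + 1) in HT2; [|lra].
        replace ((20 * e ^ 2 * A + 1) * (th0 * m / (20 * e ^ 2 * A + 1))) with (th0 * m) in HT2 by (field; lra). lra. }
      destruct (pow_small (/ 4) (/ (16 * (Cs + 1)))) as [j Hj]; [lra|apply Rinv_0_lt_compat; lra|].
      specialize (Hj j (Nat.le_refl j)). fold th0 in Hj.
      assert (Hth1 : th0 <= / 16).
      { unfold th0. apply Rinv_le_contravar; lra. }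
      assert (Hthm : 0 <= th0 * m <= / 16 * m) by (split; [apply Rmult_le_pos; lra|apply Rmult_le_compat_r; lra]).
      set (tau := T3 + h).
      exists (tau + INR j * L - h). intros t Ht.
      assert (HjL : 0 <= INR j * L) by (apply Rmult_le_pos; [apply pos_INR|lra]).
      assert (Hv : Rabs (v t) <= Cs * ((/ 4) ^ j * (2 * m) + 2 * th0 * m)).
      { apply (Hst tau (2 * m) (2 * th0 * m) v (fun t => x t - K) q); try lra; unfold tau.
        - intros s. eapply is_derive_continuous, is_derive_J, HF0.
        - intros s Hs. apply Hq. lra.
        - intros s _. eapply is_derive_eq; [apply is_derive_J, HF0|]. cbv beta. rewrite Hfq. unfold v. ring.
        - intros s Hs. apply Hr2. lra.
        - intros s Hs. replace (v s) with ((x s - K) - ((x s - K) - v s)) by ring.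
          eapply Rle_trans; [apply Rabs_sub_le|]. pose proof (HT s ltac:(lra)). pose proof (Hr2 s ltac:(lra)). lra. }
      replace (x t - K) with (((x t - K) - v t) + v t) by ring. eapply Rle_trans; [apply Rabs_triang|].
      pose proof (Hr2 t ltac:(unfold tau in Ht; lra)).
      assert (Cs * ((/ 4) ^ j * (2 * m) + 2 * th0 * m) <= (Cs + 1) * (th0 * (2 * m) + 2 * th0 * m)).
      { assert (0 <= (/ 4) ^ j) by (apply pow_le; lra).
        assert ((/ 4) ^ j * (2 * m) <= th0 * (2 * m)) by (apply Rmult_le_compat_r; lra).
        apply Rmult_le_compat; try lra. apply Rplus_le_le_0_compat; [apply Rmult_le_pos; lra|lra]. }
      replace ((Cs + 1) * (th0 * (2 * m) + 2 * th0 * m)) with ((Cs + 1) * th0 * (4 * m)) in H0 by ring.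
      rewrite Hth2 in H0. lra. }
  assert (all : forall n : nat, exists T, forall t, T <= t -> Rabs (x t - K) <= d / 2 * (/ 2) ^ n).
  { induction n as [|n [T IH]].
    - exists T0. simpl. rewrite Rmult_1_r. auto.
    - assert (Hp : 0 < (/ 2) ^ n) by (apply pow_lt; lra).
      assert (Hp1 : (/ 2) ^ n <= 1) by (pose proof (pow_incr (/ 2) 1 n ltac:(lra)); rewrite pow1 in H; auto).
      destruct (halve (d / 2 * (/ 2) ^ n) T) as [T' HT']; auto.
      + split; [apply Rmult_lt_0_compat; lra|]. rewrite <- (Rmult_1_r (d / 2)) at 2. apply Rmult_le_compat_l; lra.
      + exists T'. intros t Ht. simpl. specialize (HT' t Ht). lra. }
  apply is_lim_spec. intros [eps Heps].
  destruct (pow_small (/ 2) (eps / d)) as [n Hn]; [lra|now apply Rdiv_lt_0_compat|].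
  specialize (Hn n (Nat.le_refl n)). destruct (all n) as [T HT]. exists T. intros t Ht. simpl.
  eapply Rle_lt_trans; [apply HT; lra|].
  apply Rmult_lt_compat_l with (r := d) in Hn; auto. replace (d * (eps / d)) with eps in Hn by (field; lra). lra.
Qed.

(** * The perturbed fronts *)

Lemma wb_ladm k M f : 0 <= k -> wb k M f -> ladm 0 f.
Proof. intros Hk H. apply (adm_ladm0 k); auto. apply (wb_adm k k M); auto; lra. Qed.

Lemma wb_zero k : wb k 0 (fun _ => 0).
Proof. split; [intros; apply continuous_const|]. intros t. rewrite Rabs_R0. lra. Qed.

Lemma J1_zero t : J 1 (fun _ => 0) t = 0.
Proof.
  assert (wb 0 0 (J 1 (fun _ => 0))) by (apply wb_J1; [lra|apply wb_zero]).
  pose proof (wb_bd 0 0 _ (Rle_refl 0) H t). destruct (Req_dec (J 1 (fun _ => 0) t) 0); auto.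
  apply Rabs_pos_lt in H1. lra.
Qed.

Lemma Iop_minus N e f g t : 0 <= N -> small N e -> adm N f -> adm N g ->
  Iop e (fun s => f s - g s) t = Iop e f t - Iop e g t.
Proof.
  intros HN He Hf Hg.
  replace (fun s => f s - g s) with (fun s => f s + (-1) * g s) by (apply functional_extensionality; intros; ring).
  rewrite (Iop_plus N e), (Iop_scal N e); auto; [ring|now apply adm_scal].
Qed.

Section Branch.
Variables (h lam p c0 Y1 Y2 CN : R) (l1 G dG psi psi1 : R -> R).
Hypothesis Hh : 0 < h.
Hypothesis Hlam : 0 < lam.
Hypothesis Hp : 0 < p.
Hypothesis Hc0 : 0 < c0.
Hypothesis Hl1 : lambda1_fun h lam p l1.
Hypothesis HGd : forall u, is_derive G u (dG u).
Hypothesis HdGc : forall u, continuous dG u.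
Hypothesis HG0 : G 0 = 0.
Hypothesis Hpsi : forall t, is_derive psi t (- psi t + G (psi (t - h))).
Hypothesis Hpsi1 : forall t, is_derive psi1 t (- psi1 t + dG (psi (t - h)) * psi1 (t - h)).
Let nu := 3 / 2 * lam.
Let N := 2 * lam.
(** [XB] bounds every trial function in the weight of rate [lam], and [XD] is the Lipschitz constant
    of [ansatz] in [(s, y)] there. *)
Let XB := 2 * c0 + Y1 + Y2 + 1.
Let XD := c0 * lam + Y2 + 1.
Definition psi_rem (t : R) : R := psi t - c0 * wt lam t.
Definition dpsi_rem (t : R) : R := psi1 t - c0 * lam * wt lam t.
Hypothesis Hy1 : wb nu Y1 psi_rem.
Hypothesis Hy2 : wb nu Y2 dpsi_rem.
Hypothesis HCN0 : 0 <= CN.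
Hypothesis HCN : forall u, Rabs u <= XB -> Rabs (dG u - p) <= CN * Rabs u.

Definition nonlin (u : R) : R := G u - p * u.
(** The coefficient [c0 * exp (lam s)] of the translate [psi (t + s)], to first order in [s].
    Together with [s * dpsi_rem] it makes the [s]-derivative of [ansatz] at [e = 0] equal to
    [psi1]. *)
Definition lead (s : R) : R := c0 * (1 + lam * s).
Definition ansatz_rem (s : R) (y : R -> R) (t : R) : R := psi_rem t + s * dpsi_rem t + y t.
(** [s] moves [psi] along its translates, [y] is the correction decaying at the rate [nu];
    the leading exponential carries the rate [l1 e] demanded by the perturbed equation. *)
Definition ansatz (e s : R) (y : R -> R) (t : R) : R := lead s * wt (l1 e) t + ansatz_rem s y t.
(** What [G (ansatz e s y (t - h))] leaves after removal of [lead s * p * wt (l1 e) (t - h)]. The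
    removed part has only the rate [lam] and is handled through [rho]; the rest decays at the rate
    [nu]. *)
Definition forcing (e s : R) (y : R -> R) (t : R) : R := p * ansatz_rem s y (t - h) + nonlin (ansatz e s y (t - h)).
Definition lin_coef (t : R) : R := dG (psi (t - h)).
(** The defect [Iop e (G (x (. - h))) - x] of [x := ansatz e s y], plus [y - Bop h lin_coef y]. *)
Definition residual (e s : R) (y : R -> R) (t : R) : R :=
  lead s * rho h p l1 e t + Iop e (forcing e s y) t - (psi_rem t + s * dpsi_rem t) - Bop h lin_coef y t.

Definition unit_ball (s : R) (y : R -> R) : Prop :=
  Rabs s <= 1 /\ lam * Rabs s <= 1 /\ wb nu 1 y.

Lemma Y_pos : 0 <= Y1 /\ 0 <= Y2.
Proof. split; [apply (wb_pos _ _ _ Hy1)|apply (wb_pos _ _ _ Hy2)]. Qed.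

Lemma XB_pos : 0 < XB.
Proof. pose proof Y_pos. unfold XB. lra. Qed.

Lemma lead_bound s : lam * Rabs s <= 1 -> Rabs (lead s) <= 2 * c0.
Proof.
  intros H. unfold lead. rewrite Rabs_mult, (Rabs_right c0) by lra. rewrite (Rmult_comm 2).
  apply Rmult_le_compat_l; [lra|]. eapply Rle_trans; [apply Rabs_triang|].
  rewrite Rabs_R1, Rabs_mult, (Rabs_right lam) by lra. lra.
Qed.

Lemma psi_wb : wb lam (c0 + Y1) psi.
Proof.
  pose proof Y_pos. apply (wb_ext _ _ (fun t => c0 * wt lam t + psi_rem t)); [intros; unfold psi_rem; ring|].
  apply wb_plus.
  - replace c0 with (Rabs c0 * 1) at 1 by (rewrite Rabs_right; lra). apply wb_scal, wb_wt.
  - apply (wb_weak nu lam Y1); auto; [unfold nu; lra|lra].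
Qed.

Lemma psi1_wb : wb lam (c0 * lam + Y2) psi1.
Proof.
  pose proof Y_pos. apply (wb_ext _ _ (fun t => c0 * lam * wt lam t + dpsi_rem t)); [intros; unfold dpsi_rem; ring|].
  apply wb_plus.
  - replace (c0 * lam) with (Rabs (c0 * lam) * 1) at 1 by (rewrite Rabs_right; nra). apply wb_scal, wb_wt.
  - apply (wb_weak nu lam Y2); auto; [unfold nu; lra|lra].
Qed.

Lemma psi_XB t : Rabs (psi t) <= XB * wt lam t.
Proof.
  eapply Rle_trans; [apply psi_wb|]. pose proof Y_pos. apply Rmult_le_compat_r; [left; apply wt_pos|].
  unfold XB. lra.
Qed.

Lemma ansatz_rem_wb s y : unit_ball s y -> wb nu (Y1 + Y2 + 1) (ansatz_rem s y).
Proof.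
  intros [B1 [_ B2]]. unfold ansatz_rem. apply wb_plus; auto. apply wb_plus; auto.
  apply (wb_weak nu nu (Rabs s * Y2)); [lra| |now apply wb_scal].
  pose proof Y_pos. pose proof (Rabs_pos s). nra.
Qed.

Lemma ansatz_wb e s y : small N e -> unit_ball s y -> wb lam XB (ansatz e s y).
Proof.
  intros He B. unfold ansatz. replace XB with (2 * c0 + (Y1 + Y2 + 1)) by (unfold XB; ring). apply wb_plus.
  - apply (wb_weak lam lam (Rabs (lead s) * 1)); [lra| |].
    + rewrite Rmult_1_r. apply lead_bound, B.
    + apply wb_scal. now apply (wt_l1_wb h lam p l1).
  - apply (wb_weak nu lam (Y1 + Y2 + 1)); [unfold nu; lra|lra|now apply ansatz_rem_wb].
Qed.

Lemma nonlin_derive u : is_derive nonlin u (dG u - p).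
Proof.
  unfold nonlin. eapply is_derive_eq; [apply is_derive_Rminus; [apply HGd|]|].
  - instantiate (1 := p). auto_derive; auto; ring.
  - ring.
Qed.

(** The mean value theorem: [dG - p] at the intermediate point is of the size of the functions
    themselves, so the decay improves by the rate [lam]. *)
Lemma nonlin_wb_diff f f' a L : wb lam XB f -> wb lam XB f' -> wb a L (fun t => f t - f' t) ->
  wb (lam + a) (CN * XB * L) (fun t => nonlin (f t) - nonlin (f' t)).
Proof.
  intros Hf Hf' Hd. split.
  - intros t. apply cont_Rminus.
    + apply (continuous_comp f nonlin); [apply Hf|]. eapply is_derive_continuous, nonlin_derive.
    + apply (continuous_comp f' nonlin); [apply Hf'|]. eapply is_derive_continuous, nonlin_derive.
  - intros t. destruct (mvt_between nonlin (fun u => dG u - p) (f t) (f' t) nonlin_derive) as [xi [H1 H2]].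
    rewrite H2, <- wt_mult.
    replace (CN * XB * L * (wt lam t * wt a t)) with ((CN * (XB * wt lam t)) * (L * wt a t)) by ring.
    assert (Hxi : Rabs xi <= XB * wt lam t) by (apply (between_abs (f t) (f' t)); [auto|apply Hf|apply Hf']).
    apply Rabs_mult_le; [|apply Hd].
    pose proof XB_pos. pose proof (wt_le1 lam t ltac:(lra)). pose proof (wt_pos lam t).
    eapply Rle_trans; [apply HCN; nra|]. apply Rmult_le_compat_l; auto.
Qed.

Lemma nonlin_0 : nonlin 0 = 0.
Proof. unfold nonlin. rewrite HG0. ring. Qed.

Lemma nonlin_wb f : wb lam XB f -> wb (2 * lam) (CN * XB * XB) (fun t => nonlin (f t)).
Proof.
  intros Hf. apply (wb_ext _ _ (fun t => nonlin (f t) - nonlin 0)); [intros; rewrite nonlin_0; ring|].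
  replace (2 * lam) with (lam + lam) by ring.
  apply (nonlin_wb_diff f (fun _ => 0) lam XB); auto.
  - apply (wb_weak lam lam 0); [lra|pose proof XB_pos; lra|apply wb_zero].
  - apply (wb_ext _ _ f); auto. intros; ring.
Qed.

Let HB := p * (Y1 + Y2 + 1) + CN * XB * XB.

Lemma forcing_wb e s y : small N e -> unit_ball s y -> wb nu HB (forcing e s y).
Proof.
  intros He B. unfold forcing, HB.
  apply (wb_shift nu HB (fun t => p * ansatz_rem s y t + nonlin (ansatz e s y t))); [unfold nu; lra|lra|].
  apply wb_plus.
  - replace p with (Rabs p) at 1 by (apply Rabs_right; lra). apply wb_scal. now apply ansatz_rem_wb.
  - apply (wb_weak (2 * lam) nu (CN * XB * XB)); [unfold nu; lra|lra|]. apply nonlin_wb. now apply ansatz_wb.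
Qed.

Lemma nuN : 0 <= nu <= N.
Proof. unfold nu, N; lra. Qed.
Lemma NN0 : 0 <= N.
Proof. unfold N; lra. Qed.

Lemma forcing_adm e s y : small N e -> unit_ball s y -> adm N (forcing e s y).
Proof. intros. apply (wb_adm N nu HB); [apply nuN|now apply forcing_wb]. Qed.

Let QB := p + CN * XB.

Lemma dGpsi_wb : wb lam (CN * XB) (fun t => dG (psi t) - p).
Proof.
  split.
  - intros t. apply cont_Rminus; [|apply continuous_const].
    apply (continuous_comp psi dG); auto. apply psi_wb.
  - intros t. pose proof (psi_XB t). pose proof (wt_le1 lam t ltac:(lra)). pose proof (wt_pos lam t). pose proof XB_pos.
    eapply Rle_trans; [apply HCN; nra|]. rewrite Rmult_assoc. apply Rmult_le_compat_l; auto.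
Qed.

Lemma lin_coef_wb : wb 0 QB lin_coef.
Proof.
  apply (wb_ext 0 QB (fun t => p * wt 0 t + (dG (psi (t - h)) - p))).
  { intros t. unfold lin_coef, wt. rewrite Rmult_0_l, exp_0. ring. }
  unfold QB. apply wb_plus.
  - replace p with (Rabs p * 1) at 1 by (rewrite Rabs_right; lra). apply wb_scal, wb_wt.
  - apply (wb_weak lam 0 (CN * XB)); [lra|lra|].
    apply (wb_shift lam (CN * XB) (fun t => dG (psi t) - p)); [lra|lra|apply dGpsi_wb].
Qed.

Lemma qy_wb k M y : 0 <= k -> wb k M y -> wb k (QB * M) (fun s => lin_coef s * y (s - h)).
Proof.
  intros Hk Hy. replace k with (0 + k) by ring. apply wb_mult; [apply lin_coef_wb|].
  apply wb_shift; auto; lra.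
Qed.

(** The derivative of [forcing] with respect to [s] at [e = 0], [s = 0], [y = 0]. *)
Definition ker_forcing (t : R) : R := p * dpsi_rem (t - h) + (dG (psi (t - h)) - p) * psi1 (t - h).

Lemma wt_sh_wb : wb lam 1 (fun s => wt lam (s - h)).
Proof. apply (wb_shift lam 1 (wt lam)); try lra. apply wb_wt. Qed.

Lemma ker_forcing_wb : wb lam (p * Y2 + CN * XB * (c0 * lam + Y2)) ker_forcing.
Proof.
  unfold ker_forcing. apply (wb_shift lam _ (fun t => p * dpsi_rem t + (dG (psi t) - p) * psi1 t)); [lra|lra|].
  apply wb_plus.
  - replace p with (Rabs p) at 1 by (apply Rabs_right; lra). apply wb_scal.
    apply (wb_weak nu lam Y2); auto; [unfold nu; lra|lra].
  - apply (wb_weak (lam + lam) lam (CN * XB * (c0 * lam + Y2))); [lra|lra|].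
    apply wb_mult; [apply dGpsi_wb|apply psi1_wb].
Qed.

Lemma rho_0 t : rho h p l1 0 t = p * J 1 (fun s => wt lam (s - h)) t - wt lam t.
Proof. unfold rho. rewrite Iop_0, (proj1 Hl1). reflexivity. Qed.

(** Translation invariance: [psi1] solves the equation linearized at [psi]. *)
Lemma kernel_identity t : c0 * lam * rho h p l1 0 t + J 1 ker_forcing t - dpsi_rem t = 0.
Proof.
  assert (Hl : lam <> 0) by lra.
  assert (L1 := wb_ladm lam 1 _ ltac:(lra) wt_sh_wb). assert (L2 := wb_ladm lam _ _ ltac:(lra) ker_forcing_wb).
  assert (E : J 1 (fun s => lin_coef s * psi1 (s - h)) t = c0 * lam * p * J 1 (fun s => wt lam (s - h)) t + J 1 ker_forcing t).
  { rewrite <- (J_scal 1 0), <- (J_plus 1 0); auto; try lra; [|now apply ladm_scal].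
    f_equal. apply functional_extensionality. intros s. unfold ker_forcing, lin_coef, dpsi_rem. ring. }
  assert (E2 : psi1 t = J 1 (fun s => lin_coef s * psi1 (s - h)) t).
  { revert t E. intros t _. revert t. apply (J_unique 1 0); [lra| | |].
    - eapply wb_ladm; [|apply qy_wb; [|apply psi1_wb]]; lra.
    - eapply wb_ladm; [|apply psi1_wb]. lra.
    - intros t. eapply is_derive_eq; [apply Hpsi1|]. unfold lin_coef. ring. }
  rewrite rho_0. unfold dpsi_rem. lra.
Qed.

Lemma zero_ok : unit_ball 0 (fun _ => 0).
Proof.
  split; [rewrite Rabs_R0; lra|]. split; [rewrite Rabs_R0; lra|].
  apply (wb_weak nu nu 0); [lra|lra|apply wb_zero].
Qed.

Lemma ansatz_0 t : ansatz 0 0 (fun _ => 0) t = psi t.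
Proof. unfold ansatz, lead, ansatz_rem, psi_rem. rewrite (proj1 Hl1). ring. Qed.

Lemma residual_0 t : residual 0 0 (fun _ => 0) t = 0.
Proof.
  unfold residual, Bop. replace (fun s => lin_coef s * 0) with (fun _ : R => 0) by (apply functional_extensionality; intros; ring).
  rewrite J1_zero, rho_0, Iop_0.
  assert (L1 := wb_ladm lam 1 _ ltac:(lra) wt_sh_wb).
  assert (L2 := wb_ladm nu HB _ (proj1 nuN) (forcing_wb 0 0 _ (small_0 N) zero_ok)).
  assert (E : J 1 (fun s => G (psi (s - h))) t = c0 * p * J 1 (fun s => wt lam (s - h)) t + J 1 (forcing 0 0 (fun _ => 0)) t).
  { rewrite <- (J_scal 1 0), <- (J_plus 1 0); auto; try lra; [|now apply ladm_scal].
    f_equal. apply functional_extensionality. intros s. unfold forcing. rewrite ansatz_0. unfold nonlin, ansatz_rem, psi_rem. ring. }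
  assert (E2 : psi t = J 1 (fun s => G (psi (s - h))) t).
  { revert t E. intros t _. revert t. apply (J_unique 1 0); [lra| | |].
    - apply (wb_ladm lam (p * XB + CN * XB * XB)); [lra|].
      apply (wb_shift lam _ (fun t => G (psi t))); [lra|lra|].
      apply (wb_ext _ _ (fun t => p * psi t + nonlin (psi t))); [intros; unfold nonlin; ring|].
      assert (HP : wb lam XB psi) by (split; [apply psi_wb|apply psi_XB]).
      apply wb_plus.
      + replace p with (Rabs p) at 1 by (apply Rabs_right; lra). now apply wb_scal.
      + apply (wb_weak (2 * lam) lam (CN * XB * XB)); [lra|lra|]. now apply nonlin_wb.
    - eapply wb_ladm; [|apply psi_wb]. lra.
    - intros t. eapply is_derive_eq; [apply Hpsi|]. ring. }
  unfold lead, psi_rem. lra.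
Qed.

(** * Lipschitz estimates for the residual *)

Definition taylor_rem (e s : R) (y : R -> R) (s' : R) (y' : R -> R) (t : R) : R :=
  nonlin (ansatz e s y (t - h)) - nonlin (ansatz e s' y' (t - h)) -
  (dG (psi (t - h)) - p) * ((y (t - h) - y' (t - h)) + (s - s') * psi1 (t - h)).

Section Difference.
Variables (e s s' L : R) (y y' : R -> R).
Hypothesis He : small N e.
Hypothesis HB1 : unit_ball s y.
Hypothesis HB2 : unit_ball s' y'.
Hypothesis Hs : Rabs (s - s') <= L.
Hypothesis Hy : wb nu L (fun t => y t - y' t).

Lemma ansatz_diff : wb lam (XD * L) (fun t => ansatz e s y t - ansatz e s' y' t).
Proof.
  assert (HL := wb_pos _ _ _ Hy). pose proof Y_pos.
  apply (wb_ext _ _ (fun t => (c0 * lam * (s - s')) * wt (l1 e) t + ((s - s') * dpsi_rem t + (y t - y' t)))).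
  { intros t. unfold ansatz, lead, ansatz_rem. ring. }
  apply (wb_weak lam lam (c0 * lam * L + (Y2 * L + L))); [lra|unfold XD; lra|].
  apply wb_plus.
  - apply (wb_weak lam lam (Rabs (c0 * lam * (s - s')) * 1)); [lra| |apply wb_scal; now apply (wt_l1_wb h lam p l1)].
    rewrite Rmult_1_r, Rabs_mult, (Rabs_right (c0 * lam)) by nra. apply Rmult_le_compat_l; nra.
  - apply (wb_weak nu lam (Y2 * L + L)); [unfold nu; lra|lra|]. apply wb_plus; auto.
    apply (wb_weak nu nu (Rabs (s - s') * Y2)); [lra|nra|now apply wb_scal].
Qed.

Let HD := p * (Y2 + 1) + CN * XB * XD.

Lemma forcing_diff : wb nu (HD * L) (fun t => forcing e s y t - forcing e s' y' t).
Proof.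
  assert (HL := wb_pos _ _ _ Hy). pose proof Y_pos.
  apply (wb_shift nu (HD * L) (fun t => p * ansatz_rem s y t + nonlin (ansatz e s y t) - (p * ansatz_rem s' y' t + nonlin (ansatz e s' y' t))));
    [unfold nu; lra|lra|].
  apply (wb_ext _ _ (fun t => p * ((s - s') * dpsi_rem t + (y t - y' t)) + (nonlin (ansatz e s y t) - nonlin (ansatz e s' y' t)))).
  { intros t. unfold ansatz_rem. ring. }
  apply (wb_weak nu nu (p * (Y2 * L + L) + CN * XB * (XD * L))); [lra|unfold HD; lra|].
  apply wb_plus.
  - replace p with (Rabs p) at 1 by (apply Rabs_right; lra). apply wb_scal. apply wb_plus; auto.
    apply (wb_weak nu nu (Rabs (s - s') * Y2)); [lra|nra|now apply wb_scal].
  - apply (wb_weak (lam + lam) nu (CN * XB * (XD * L))); [unfold nu; lra|lra|].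
    apply nonlin_wb_diff; [now apply ansatz_wb|now apply ansatz_wb|apply ansatz_diff].
Qed.

Lemma taylor_rem_ladm : ladm 0 (taylor_rem e s y s' y').
Proof.
  assert (Hb : exists M, wb lam M (fun t => nonlin (ansatz e s y t) - nonlin (ansatz e s' y' t) -
     (dG (psi t) - p) * ((y t - y' t) + (s - s') * psi1 t))).
  { eexists. apply wb_minus.
    - apply (wb_weak (lam + lam) lam _ _ _ ltac:(lra) (Rle_refl _)).
      apply nonlin_wb_diff; [now apply ansatz_wb|now apply ansatz_wb|apply ansatz_diff].
    - apply (wb_weak (lam + lam) lam _ _ _ ltac:(lra) (Rle_refl _)). apply wb_mult; [apply dGpsi_wb|].
      apply wb_plus; [apply (wb_weak nu lam L L); [unfold nu; lra|lra|auto]|apply wb_scal, psi1_wb]. }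
  destruct Hb as [M HM]. apply (wb_ladm lam M); [lra|]. unfold taylor_rem.
  apply (wb_shift lam M (fun t => nonlin (ansatz e s y t) - nonlin (ansatz e s' y' t) -
     (dG (psi t) - p) * ((y t - y' t) + (s - s') * psi1 t))); auto; lra.
Qed.

(** All first-order terms cancel: those in [y] because [residual] subtracts [Bop], those in [s] by
    [kernel_identity]. What remains carries the difference between [e] and [0] or is a Taylor
    remainder at [psi]. *)
Lemma residual_diff_eq t : residual e s y t - residual e s' y' t =
  c0 * lam * (s - s') * (rho h p l1 e t - rho h p l1 0 t) +
  (Iop e (fun x => forcing e s y x - forcing e s' y' x) t - Iop 0 (fun x => forcing e s y x - forcing e s' y' x) t) +
  J 1 (taylor_rem e s y s' y') t.
Proof.
  assert (A1 := forcing_adm e s y He HB1). assert (A2 := forcing_adm e s' y' He HB2).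
  rewrite (Iop_minus N e _ _ t NN0 He A1 A2), Iop_0.
  assert (Ld := wb_ladm nu L _ (proj1 nuN) Hy).
  assert (Lq : ladm 0 (fun x => lin_coef x * (y (x - h) - y' (x - h)))).
  { apply (wb_ladm nu (QB * L)); [apply nuN|]. apply (qy_wb nu L (fun t => y t - y' t)); auto. apply nuN. }
  assert (LK := wb_ladm lam _ _ ltac:(lra) ker_forcing_wb).
  assert (E : J 1 (fun x => forcing e s y x - forcing e s' y' x) t =
    (Bop h lin_coef y t - Bop h lin_coef y' t) + (s - s') * J 1 ker_forcing t + J 1 (taylor_rem e s y s' y') t).
  { rewrite (Bop_minus h lin_coef y y' t).
    2: { apply (wb_ladm nu (QB * 1)); [apply nuN|]. apply qy_wb; [apply nuN|apply HB1]. }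
    2: { apply (wb_ladm nu (QB * 1)); [apply nuN|]. apply qy_wb; [apply nuN|apply HB2]. }
    unfold Bop. rewrite <- (J_scal 1 0) by (auto; lra).
    rewrite <- (J_plus 1 0) by (auto; try lra; now apply ladm_scal).
    rewrite <- (J_plus 1 0 (fun s0 => lin_coef s0 * (y (s0 - h) - y' (s0 - h)) + (s - s') * ker_forcing s0)).
    - f_equal. apply functional_extensionality. intros x. unfold forcing, taylor_rem, ker_forcing, lin_coef, ansatz_rem. ring.
    - lra.
    - apply ladm_plus; auto. now apply ladm_scal.
    - apply taylor_rem_ladm. }
  rewrite E. pose proof (kernel_identity t) as KI.
  unfold residual, lead.
  assert (KI2 : (s - s') * (c0 * lam * rho h p l1 0 t + J 1 ker_forcing t - dpsi_rem t) = 0) by (rewrite KI; ring).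
  lra.
Qed.

(** The rate [lam / 2] of the oscillation of [dG] and the rate [lam] of the difference of trial
    functions add up to [nu]. The term in [e ^ 2] appears because the [s]-derivative of [ansatz] is
    [psi1] only at [e = 0]. *)
Lemma taylor_rem_bound z : (forall t xi, Rmin (ansatz e s y t) (ansatz e s' y' t) <= xi <= Rmax (ansatz e s y t) (ansatz e s' y' t) ->
    Rabs (dG xi - dG (psi t)) <= z * wt (lam / 2) t) ->
  wb nu ((z * XD + CN * XB * (8 * c0 * lam ^ 2 * e ^ 2)) * L) (taylor_rem e s y s' y').
Proof.
  intros Hz. assert (HL := wb_pos _ _ _ Hy).
  unfold taylor_rem. apply (wb_shift nu _ (fun t => nonlin (ansatz e s y t) - nonlin (ansatz e s' y' t) -
     (dG (psi t) - p) * ((y t - y' t) + (s - s') * psi1 t))); [apply nuN|lra|].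
  apply (wb_ext _ _ (fun t => (nonlin (ansatz e s y t) - nonlin (ansatz e s' y' t) - (dG (psi t) - p) * (ansatz e s y t - ansatz e s' y' t)) +
     (dG (psi t) - p) * ((c0 * lam * (s - s')) * (wt (l1 e) t - wt (l1 0) t)))).
  { intros t. unfold ansatz, lead, ansatz_rem, dpsi_rem. rewrite (proj1 Hl1). ring. }
  rewrite Rmult_plus_distr_r. apply wb_plus.
  - split.
    + intros t. apply cont_Rminus.
      * assert (HW := nonlin_wb_diff _ _ lam (XD * L) (ansatz_wb e s y He HB1) (ansatz_wb e s' y' He HB2) ansatz_diff). apply HW.
      * apply cont_Rmult; [apply dGpsi_wb|apply ansatz_diff].
    + intros t. destruct (mvt_between nonlin (fun u => dG u - p) (ansatz e s y t) (ansatz e s' y' t) nonlin_derive) as [xi [H1 H2]].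
      rewrite H2.
      replace ((dG xi - p) * (ansatz e s y t - ansatz e s' y' t) - (dG (psi t) - p) * (ansatz e s y t - ansatz e s' y' t))
        with ((dG xi - dG (psi t)) * (ansatz e s y t - ansatz e s' y' t)) by ring.
      replace nu with (lam / 2 + lam) by (unfold nu; field). rewrite <- wt_mult.
      replace (z * XD * L * (wt (lam / 2) t * wt lam t)) with ((z * wt (lam / 2) t) * (XD * L * wt lam t)) by ring.
      apply Rabs_mult_le; [now apply Hz|apply ansatz_diff].
  - replace nu with (lam + lam / 2) by (unfold nu; field).
    replace (CN * XB * (8 * c0 * lam ^ 2 * e ^ 2) * L) with (CN * XB * (c0 * lam * L * (8 * lam * e ^ 2))) by ring.
    apply wb_mult; [apply dGpsi_wb|].
    assert (Hw := wt_l1_diff h lam p l1 Hlam Hl1 e 0 He (small_0 _)).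
    replace (Rabs (e ^ 2 - 0 ^ 2)) with (e ^ 2) in Hw
      by (replace (e ^ 2 - 0 ^ 2) with (e ^ 2) by ring; symmetry; apply Rabs_right, Rle_ge, pow2_ge_0).
    eapply wb_weak; [apply Rle_refl| |exact (wb_scal (lam / 2) _ (c0 * lam * (s - s')) _ Hw)].
    rewrite Rabs_mult, (Rabs_right (c0 * lam)) by nra.
    apply Rmult_le_compat_r; [pose proof (pow2_ge_0 e); apply Rmult_le_pos; lra|].
    apply Rmult_le_compat_l; nra.
Qed.

Lemma residual_lip_const z : (forall t xi, Rmin (ansatz e s y t) (ansatz e s' y' t) <= xi <= Rmax (ansatz e s y t) (ansatz e s' y' t) ->
    Rabs (dG xi - dG (psi t)) <= z * wt (lam / 2) t) ->
  wb nu ((z * XD + (CN * XB * (8 * c0 * lam ^ 2) + c0 * lam * Crho lam p + 20 * HD) * e ^ 2) * L)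
    (fun t => residual e s y t - residual e s' y' t).
Proof.
  intros Hz. assert (HL := wb_pos _ _ _ Hy).
  assert (Ee : Rabs (e ^ 2 - 0 ^ 2) = e ^ 2)
    by (replace (e ^ 2 - 0 ^ 2) with (e ^ 2) by ring; apply Rabs_right, Rle_ge, pow2_ge_0).
  apply (wb_ext _ _ (fun t => (c0 * lam * (s - s') * (rho h p l1 e t - rho h p l1 0 t) +
    (Iop e (fun x => forcing e s y x - forcing e s' y' x) t - Iop 0 (fun x => forcing e s y x - forcing e s' y' x) t)) +
    J 1 (taylor_rem e s y s' y') t)).
  { intros t. now rewrite residual_diff_eq. }
  replace ((z * XD + (CN * XB * (8 * c0 * lam ^ 2) + c0 * lam * Crho lam p + 20 * HD) * e ^ 2) * L)
    with ((c0 * lam * L * (Crho lam p * e ^ 2) + 20 * e ^ 2 * (HD * L)) + (z * XD + CN * XB * (8 * c0 * lam ^ 2 * e ^ 2)) * L) by ring.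
  apply wb_plus; [apply wb_plus|].
  - assert (Hr := rho_diff h lam p l1 Hh Hlam Hp Hl1 e 0 He (small_0 _)). rewrite Ee in Hr.
    eapply wb_weak; [apply Rle_refl| |apply wb_scal; exact Hr].
    rewrite Rabs_mult, (Rabs_right (c0 * lam)) by nra.
    apply Rmult_le_compat_r; [apply (wb_pos _ _ _ Hr)|]. apply Rmult_le_compat_l; nra.
  - rewrite <- Ee. apply (wb_Iop_diff N); [auto|apply small_0|apply nuN|apply forcing_diff].
  - apply wb_J1; [apply nuN|]. now apply taylor_rem_bound.
Qed.
End Difference.

Lemma ansatz_minus_psi e s y t : ansatz e s y t - psi t = s * psi1 t + lead s * (wt (l1 e) t - wt (l1 0) t) + y t.
Proof. unfold ansatz, ansatz_rem, psi_rem, dpsi_rem, lead. rewrite (proj1 Hl1). ring. Qed.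

Lemma ansatz_close e s y eta : small N e -> lam * Rabs s <= 1 -> Rabs s <= eta -> wb nu eta y ->
  forall t, Rabs (ansatz e s y t - psi t) <= eta * (c0 * lam + Y2 + 1) + 16 * c0 * lam * e ^ 2.
Proof.
  intros He Hs Heta Hy t. rewrite ansatz_minus_psi. pose proof Y_pos.
  assert (Hw := wt_l1_diff h lam p l1 Hlam Hl1 e 0 He (small_0 _)).
  replace (Rabs (e ^ 2 - 0 ^ 2)) with (e ^ 2) in Hw
    by (replace (e ^ 2 - 0 ^ 2) with (e ^ 2) by ring; symmetry; apply Rabs_right, Rle_ge, pow2_ge_0).
  pose proof (wb_bd (lam / 2) _ _ ltac:(lra) Hw t) as B1. cbv beta in B1.
  pose proof (wb_bd nu _ _ (proj1 nuN) Hy t) as B2.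
  pose proof (wb_bd lam _ _ ltac:(lra) psi1_wb t) as B3.
  eapply Rle_trans; [apply Rabs_triang|].
  replace (eta * (c0 * lam + Y2 + 1) + 16 * c0 * lam * e ^ 2) with
    ((eta * (c0 * lam + Y2) + 2 * c0 * (8 * lam * e ^ 2)) + eta) by ring.
  apply Rplus_le_compat; auto. eapply Rle_trans; [apply Rabs_triang|].
  apply Rplus_le_compat; apply Rabs_mult_le; auto. now apply lead_bound.
Qed.

(** Near [0] the bound [CN |u|] on the oscillation of [dG] is used, elsewhere uniform continuity. *)
Lemma dG_modulus z : 0 < z -> exists r, 0 < r /\ forall a b w, 0 < w <= 1 ->
  Rabs a <= XB * (w * w) -> Rabs b <= XB * (w * w) -> Rabs (a - b) <= r -> Rabs (dG a - dG b) <= z * w.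
Proof.
  intros Hz. pose proof XB_pos as HX.
  (* Below [w0] the quadratic bound [2 * CN * XB * w * w] is already at most [z * w]; above it,
     uniform continuity with tolerance [z * w0] suffices. *)
  set (w0 := z / (2 * (CN * XB + 1))).
  assert (HCX : 0 <= CN * XB) by (apply Rmult_le_pos; lra).
  assert (Hw0 : 0 < w0) by (apply Rdiv_lt_0_compat; lra).
  assert (Hzw : 0 < z * w0) by (apply Rmult_lt_0_compat; auto).
  destruct (Heine_cor2 (f := dG) (a := - XB) (b := XB)) with (eps := mkposreal _ Hzw) as [d Hd].
  { intros x _. apply continuity_pt_filterlim, HdGc. }
  exists (d / 2). split; [pose proof (cond_pos d); lra|].
  intros a b w Hw Ha Hb Hab.
  assert (HXw : XB * (w * w) <= XB * 1) by (apply Rmult_le_compat_l; nra).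
  destruct (Rle_dec w w0) as [Hle|Hle].
  - replace (dG a - dG b) with ((dG a - p) - (dG b - p)) by ring.
    eapply Rle_trans; [apply Rabs_sub_le|].
    pose proof (HCN a ltac:(lra)). pose proof (HCN b ltac:(lra)).
    assert (CN * Rabs a <= CN * (XB * (w * w))) by (apply Rmult_le_compat_l; auto).
    assert (CN * Rabs b <= CN * (XB * (w * w))) by (apply Rmult_le_compat_l; auto).
    assert (2 * (CN * XB) * w <= z).
    { apply Rle_trans with (2 * (CN * XB + 1) * w0); [|right; unfold w0; field; lra].
      apply Rmult_le_compat; lra. }
    assert (2 * (CN * XB) * w * w <= z * w) by (apply Rmult_le_compat_r; lra). lra.
  - assert (Rabs (dG a - dG b) < z * w0).
    { apply Hd; [apply Rabs_le_between; lra|apply Rabs_le_between; lra|pose proof (cond_pos d); lra]. }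
    assert (z * w0 <= z * w) by (apply Rmult_le_compat_l; lra). lra.
Qed.

(** The Lipschitz constant can be made any [kap > 0]: shrinking [e] and the ball makes both [e ^ 2]
    and the oscillation of [dG] around [psi] small, while [z * XD] takes one half of [kap]. *)
Lemma residual_lip kap : 0 < kap -> exists e0 eta0, 0 < e0 /\ 0 < eta0 <= 1 /\ lam * eta0 <= 1 /\
  forall e s s' y y' L, small N e -> Rabs e <= e0 -> Rabs s <= eta0 -> Rabs s' <= eta0 ->
    wb nu eta0 y -> wb nu eta0 y' -> Rabs (s - s') <= L -> wb nu L (fun t => y t - y' t) ->
    wb nu (kap * L) (fun t => residual e s y t - residual e s' y' t).
Proof.
  intros Hk. pose proof Y_pos as [HY1 HY2].
  assert (HXD : 0 < XD) by (unfold XD; assert (0 < c0 * lam) by (apply Rmult_lt_0_compat; auto); lra).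
  set (z := kap / (2 * XD)). assert (Hz : 0 < z) by (apply Rdiv_lt_0_compat; lra).
  destruct (dG_modulus z Hz) as [r [Hr Hmod]].
  pose proof XB_pos as HX.
  set (K1 := CN * XB * (8 * c0 * lam ^ 2) + c0 * lam * Crho lam p + 20 * (p * (Y2 + 1) + CN * XB * XD) + 16 * c0 * lam + 1).
  assert (HK1 : 0 < K1 /\ 16 * c0 * lam <= K1 /\
    CN * XB * (8 * c0 * lam ^ 2) + c0 * lam * Crho lam p + 20 * (p * (Y2 + 1) + CN * XB * XD) <= K1).
  { assert (0 <= CN * XB) by (apply Rmult_le_pos; lra).
    assert (0 < c0 * lam) by nra.
    assert (0 <= Crho lam p) by (unfold Crho; nra).
    assert (0 <= CN * XB * (8 * c0 * lam ^ 2)) by (apply Rmult_le_pos; auto; nra).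
    assert (0 <= c0 * lam * Crho lam p) by (apply Rmult_le_pos; lra).
    assert (0 <= CN * XB * XD) by (apply Rmult_le_pos; lra).
    assert (0 <= p * (Y2 + 1)) by (apply Rmult_le_pos; lra).
    unfold K1. lra. }
  set (q := Rmin (kap / 2) (r / 2) / K1).
  assert (Hq : 0 < q) by (apply Rdiv_lt_0_compat; [apply Rmin_pos; lra|lra]).
  assert (HqK : K1 * q = Rmin (kap / 2) (r / 2)) by (unfold q; field; lra).
  pose proof (Rmin_l (kap / 2) (r / 2)) as M1. pose proof (Rmin_r (kap / 2) (r / 2)) as M2.
  set (eta0 := Rmin (Rmin 1 (/ lam)) (r / (2 * XD))).
  assert (Heta : 0 < eta0) by (repeat apply Rmin_pos; try lra; [apply Rinv_0_lt_compat|apply Rdiv_lt_0_compat]; lra).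
  assert (Heta1 : eta0 <= 1) by (unfold eta0; eapply Rle_trans; [apply Rmin_l|apply Rmin_l]).
  assert (Heta2 : eta0 <= / lam) by (unfold eta0; eapply Rle_trans; [apply Rmin_l|apply Rmin_r]).
  assert (Heta3 : eta0 * XD <= r / 2).
  { apply Rle_trans with (r / (2 * XD) * XD); [apply Rmult_le_compat_r; [lra|apply Rmin_r]|right; field; lra]. }
  assert (Hl : lam * eta0 <= 1).
  { apply Rle_trans with (lam * / lam); [apply Rmult_le_compat_l; lra|right; field; lra]. }
  exists (sqrt q), eta0. split; [now apply sqrt_lt_R0|]. split; [lra|]. split; auto.
  intros e s s' y y' L He He0 Hs Hs' Hy Hy' Hss Hyy.
  assert (HL := wb_pos _ _ _ Hyy).
  assert (Heq : e ^ 2 <= q).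
  { rewrite <- (sqrt_sqrt q) by lra. rewrite <- pow2_abs. pose proof (Rabs_pos e). pose proof (sqrt_pos q). simpl. nra. }
  pose proof (pow2_ge_0 e) as He2.
  assert (HKe : K1 * e ^ 2 <= Rmin (kap / 2) (r / 2)) by (rewrite <- HqK; apply Rmult_le_compat_l; lra).
  assert (Hls : forall x, Rabs x <= eta0 -> lam * Rabs x <= 1).
  { intros x Hx. apply Rle_trans with (lam * eta0); auto. apply Rmult_le_compat_l; lra. }
  assert (HB1 : unit_ball s y) by (split; [lra|]; split; [auto|apply (wb_weak nu nu eta0); auto; lra]).
  assert (HB2 : unit_ball s' y') by (split; [lra|]; split; [auto|apply (wb_weak nu nu eta0); auto; lra]).
  assert (Hclose : 16 * c0 * lam * e ^ 2 <= r / 2).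
  { apply Rle_trans with (K1 * e ^ 2); [apply Rmult_le_compat_r; lra|lra]. }
  eapply wb_weak; [apply Rle_refl| |apply (residual_lip_const e s s' L y y' He HB1 HB2 Hss Hyy z)].
  - apply Rmult_le_compat_r; auto.
    assert (z * XD = kap / 2) by (unfold z; field; lra).
    assert ((CN * XB * (8 * c0 * lam ^ 2) + c0 * lam * Crho lam p + 20 * (p * (Y2 + 1) + CN * XB * XD)) * e ^ 2 <= K1 * e ^ 2)
      by (apply Rmult_le_compat_r; lra).
    lra.
  - intros t xi Hxi.
    assert (E : wt (lam / 2) t * wt (lam / 2) t = wt lam t) by (rewrite wt_mult; f_equal; field).
    apply Hmod.
    + split; [apply wt_pos|apply wt_le1; lra].
    + rewrite E. apply (between_abs _ _ _ _ Hxi); [apply (ansatz_wb e s y He HB1)|apply (ansatz_wb e s' y' He HB2)].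
    + rewrite E. apply psi_XB.
    + assert (C1 := ansatz_close e s y eta0 He (Hls s Hs) Hs Hy t).
      assert (C2 := ansatz_close e s' y' eta0 He (Hls s' Hs') Hs' Hy' t).
      fold XD in C1, C2.
      apply (between_abs (ansatz e s y t - psi t) (ansatz e s' y' t - psi t)); [|lra|lra].
      destruct (Rle_dec (ansatz e s y t) (ansatz e s' y' t)).
      * rewrite Rmin_left, Rmax_right in * by lra. lra.
      * rewrite Rmin_right, Rmax_left in * by lra. lra.
Qed.

Lemma residual_eps : exists CE, 0 <= CE /\ forall e e' s y, small N e -> small N e' -> unit_ball s y ->
  wb nu (CE * Rabs (e ^ 2 - e' ^ 2)) (fun t => residual e s y t - residual e' s y t).
Proof.
  pose proof XB_pos as HX. pose proof Y_pos as [HY1 HY2].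
  assert (HCX : 0 <= CN * XB) by (apply Rmult_le_pos; lra).
  assert (HHB : 0 <= HB).
  { unfold HB. apply Rplus_le_le_0_compat; [apply Rmult_le_pos; lra|apply Rmult_le_pos; lra]. }
  assert (HCr : 0 <= Crho lam p) by (unfold Crho; nra).
  exists (2 * c0 * Crho lam p + 20 * HB + 2 * (CN * XB * (2 * c0 * (8 * lam)))).
  split.
  { assert (0 <= CN * XB * (2 * c0 * (8 * lam))) by (apply Rmult_le_pos; nra).
    assert (0 <= 2 * c0 * Crho lam p) by (apply Rmult_le_pos; lra). lra. }
  intros e e' s y He He' B. set (d := Rabs (e ^ 2 - e' ^ 2)). assert (Hd : 0 <= d) by apply Rabs_pos.
  assert (Hcc := lead_bound s (proj1 (proj2 B))).
  assert (A1 := forcing_adm e s y He B). assert (A2 := forcing_adm e' s y He' B).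
  apply (wb_ext _ _ (fun t => lead s * (rho h p l1 e t - rho h p l1 e' t) + (Iop e (forcing e s y) t - Iop e' (forcing e s y) t)
     + Iop e' (fun x => forcing e s y x - forcing e' s y x) t)).
  { intros t. rewrite (Iop_minus N e' _ _ t NN0 He' A1 A2). unfold residual. ring. }
  replace ((2 * c0 * Crho lam p + 20 * HB + 2 * (CN * XB * (2 * c0 * (8 * lam)))) * d) with
    ((2 * c0 * (Crho lam p * d) + 20 * d * HB) + 2 * (CN * XB * (2 * c0 * (8 * lam * d)))) by ring.
  apply wb_plus; [apply wb_plus|].
  - assert (Hr := rho_diff h lam p l1 Hh Hlam Hp Hl1 e e' He He'). fold d in Hr.
    eapply wb_weak; [apply Rle_refl| |apply wb_scal; exact Hr].
    apply Rmult_le_compat_r; auto. apply (wb_pos _ _ _ Hr).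
  - apply (wb_Iop_diff N); auto; [apply nuN|now apply forcing_wb].
  - apply (wb_Iop N); auto; [apply nuN|].
    apply (wb_ext _ _ (fun t => nonlin (ansatz e s y (t - h)) - nonlin (ansatz e' s y (t - h)))); [intros t; unfold forcing; ring|].
    apply (wb_shift nu _ (fun t => nonlin (ansatz e s y t) - nonlin (ansatz e' s y t))); [apply nuN|lra|].
    replace nu with (lam + lam / 2) by (unfold nu; field).
    apply nonlin_wb_diff; [now apply ansatz_wb|now apply ansatz_wb|].
    apply (wb_ext _ _ (fun t => lead s * (wt (l1 e) t - wt (l1 e') t))); [intros t; unfold ansatz; ring|].
    assert (Hw := wt_l1_diff h lam p l1 Hlam Hl1 e e' He He'). fold d in Hw.
    eapply wb_weak; [apply Rle_refl| |apply wb_scal; exact Hw].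
    apply Rmult_le_compat_r; auto. apply (wb_pos _ _ _ Hw).
Qed.

Lemma residual_wb e s y : small N e -> unit_ball s y -> exists M, wb nu M (residual e s y).
Proof.
  intros He B. unfold residual. eexists. apply wb_minus; [apply wb_minus; [apply wb_plus|apply wb_plus]|].
  - apply wb_scal. now apply (rho_wb h lam p l1 Hh Hlam Hp Hl1).
  - apply (wb_Iop N); [auto|apply nuN|now apply forcing_wb].
  - exact Hy1.
  - apply wb_scal. exact Hy2.
  - apply wb_J1; [apply nuN|]. apply qy_wb; [apply nuN|apply B].
Qed.

Lemma residual_fixed e s y : small N e -> unit_ball s y -> (forall t, y t - Bop h lin_coef y t = residual e s y t) ->
  forall t, ansatz e s y t = Iop e (fun x => G (ansatz e s y (x - h))) t.
Proof.
  intros He B E t.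
  assert (E1 : ansatz_rem s y t = lead s * rho h p l1 e t + Iop e (forcing e s y) t).
  { specialize (E t). unfold residual in E. unfold ansatz_rem. lra. }
  assert (Aw : adm N (fun x => wt (l1 e) (x - h))).
  { apply (wb_adm N lam 1); [unfold N; lra|]. apply (wb_shift lam 1 (wt (l1 e))); try lra.
    now apply (wt_l1_wb h lam p l1). }
  assert (A1 := forcing_adm e s y He B).
  replace (fun x => G (ansatz e s y (x - h))) with (fun x => (lead s * p) * wt (l1 e) (x - h) + forcing e s y x).
  2: { apply functional_extensionality. intros x. unfold forcing, nonlin, ansatz. ring. }
  rewrite (Iop_plus N e NN0 He), (Iop_scal N e NN0 He); auto; [|now apply adm_scal].
  unfold ansatz at 1. rewrite E1. unfold rho. ring.
Qed.

(** * The integral condition and the fixed point in [(s, y)] *)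

Let P1 := c0 * lam + Y2.

(** The exponential cancels the one inside [J (lam / 2)], so that the improper integral becomes a
    value of [J] and inherits its linearity and bounds; half of the decay of [psi1] is spent on
    it. *)
Definition ell_integrand (f : R -> R) (s : R) : R := exp (- (lam / 2) * s) * (f s * psi1 s).
(** [ell f] is the integral of [f psi1] over the negative half-line. *)
Definition ell (f : R -> R) : R := J (lam / 2) (ell_integrand f) 0.

Lemma P1_pos : 0 < P1.
Proof. pose proof Y_pos. unfold P1. assert (0 < c0 * lam) by nra. lra. Qed.

Lemma ell_integrand_bound f M : wb 0 M f -> wb 0 (M * P1) (ell_integrand f).
Proof.
  intros Hf. assert (HM := wb_pos _ _ _ Hf). pose proof P1_pos as HP. split.
  - intros t. apply cont_Rmult; [apply cont_expk|]. apply cont_Rmult; [apply Hf|apply psi1_wb].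
  - intros t. unfold wt. rewrite Rmult_0_l, exp_0, Rmult_1_r. unfold ell_integrand.
    replace (exp (- (lam / 2) * t) * (f t * psi1 t)) with (f t * (exp (- (lam / 2) * t) * psi1 t)) by ring.
    apply Rabs_mult_le; [apply (wb_bd 0 M); auto; lra|].
    rewrite Rabs_mult, (Rabs_right (exp _)) by (left; apply exp_pos).
    apply Rle_trans with (exp (- (lam / 2) * t) * (P1 * wt lam t)).
    { apply Rmult_le_compat_l; [left; apply exp_pos|apply psi1_wb]. }
    rewrite <- (Rmult_1_r P1) at 2.
    replace (exp (- (lam / 2) * t) * (P1 * wt lam t)) with (P1 * (exp (- (lam / 2) * t) * wt lam t)) by ring.
    apply Rmult_le_compat_l; [lra|]. destruct (Rle_dec t 0).
    + rewrite wt_neg, <- exp_plus, <- exp_0 by auto. apply exp_mono. nra.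
    + rewrite wt_nonneg, Rmult_1_r, <- exp_0 by lra. apply exp_mono. nra.
Qed.

Lemma ell_integrand_ladm f M : wb 0 M f -> ladm 0 (ell_integrand f).
Proof. intros Hf. exact (wb_ladm 0 _ _ (Rle_refl 0) (ell_integrand_bound f M Hf)). Qed.

Let Cl := P1 / (lam / 2).

Lemma Jellf_bound f M : wb 0 M f -> forall t, Rabs (J (lam / 2) (ell_integrand f) t) <= Cl * M.
Proof.
  intros Hf t. replace (Cl * M) with (M * P1 / (lam / 2 + 0) * exp (0 * t)).
  2: { rewrite Rmult_0_l, exp_0. unfold Cl. field. lra. }
  apply (J_exp_bound (lam / 2) 0 0); [lra|exact (ell_integrand_ladm f M Hf)|lra|].
  intros s. rewrite Rmult_0_l, exp_0, Rmult_1_r. apply (wb_bd 0); [lra|now apply ell_integrand_bound].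
Qed.

Lemma ell_bound f M : wb 0 M f -> Rabs (ell f) <= Cl * M.
Proof. intros Hf. now apply Jellf_bound. Qed.

Lemma ell_plus f g M M' : wb 0 M f -> wb 0 M' g -> ell (fun t => f t + g t) = ell f + ell g.
Proof.
  intros Hf Hg. unfold ell.
  rewrite <- (J_plus (lam / 2) 0); [|lra|now apply (ell_integrand_ladm f M)|now apply (ell_integrand_ladm g M')].
  f_equal. apply functional_extensionality. intros s. unfold ell_integrand. ring.
Qed.

Lemma ell_scal c f M : wb 0 M f -> ell (fun t => c * f t) = c * ell f.
Proof.
  intros Hf. unfold ell.
  rewrite <- (J_scal (lam / 2) 0); [|lra|now apply (ell_integrand_ladm f M)].
  f_equal. apply functional_extensionality. intros s. unfold ell_integrand. ring.
Qed.

Lemma ell_primitive f M : wb 0 M f ->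
  exists F, F 0 = ell f /\ (forall t, is_derive F t (f t * psi1 t)) /\
    forall t, Rabs (F t) <= Cl * M * exp (lam / 2 * t).
Proof.
  intros Hf. exists (fun t => exp (lam / 2 * t) * J (lam / 2) (ell_integrand f) t). split; [|split].
  - rewrite Rmult_0_r, exp_0. unfold ell. ring.
  - intros t. eapply is_derive_eq.
    + apply is_derive_Rmult; [apply is_derive_expk|apply is_derive_J]. intros x. apply (ell_integrand_ladm f M Hf).
    + cbv beta. unfold ell_integrand at 3.
      assert (E : exp (lam / 2 * t) * exp (- (lam / 2) * t) = 1).
      { rewrite <- exp_plus. replace (lam / 2 * t + - (lam / 2) * t) with 0 by ring. apply exp_0. }
      transitivity (exp (lam / 2 * t) * exp (- (lam / 2) * t) * (f t * psi1 t)); [ring|rewrite E; ring].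
  - intros t. rewrite Rabs_mult, (Rabs_right (exp _)) by (left; apply exp_pos).
    rewrite Rmult_comm. apply Rmult_le_compat_r; [left; apply exp_pos|]. now apply Jellf_bound.
Qed.

Hypothesis Hpsipos : forall t, 0 < psi t.
Hypothesis Hpsi01 : forall t, is_derive psi t (psi1 t).

Lemma wb_lam0 k M f : 0 <= k -> wb k M f -> wb 0 M f.
Proof. intros Hk. apply wb_weak; lra. Qed.

(** This integral of [psi1 ^ 2] is the coefficient of [s] in the integral condition, so its
    positivity is what allows the condition to be solved for [s]. *)
Lemma ell_psi1_pos : 0 < ell psi1.
Proof.
  assert (W : wb 0 P1 psi1) by (apply (wb_lam0 lam); [lra|apply psi1_wb]).
  destruct (ell_primitive psi1 P1 W) as [F [F0 [FD FB]]].
  pose proof P1_pos as HP. assert (HCl : 0 < Cl) by (apply Rdiv_lt_0_compat; lra).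
  assert (Fmono : forall s t, s <= t -> F s <= F t).
  { intros s t Hst. apply (derive_ge0_le_all F (fun t => psi1 t * psi1 t)); auto.
    intros x _. split; [apply FD|nra]. }
  assert (Fpos : forall t, 0 <= F t).
  { intros t. apply Rnot_lt_le. intros Hneg.
    destruct (exp_neg_small (lam / 2) (- F t / (Cl * P1))) as [T HT]; [lra|apply Rdiv_lt_0_compat; nra|].
    set (s := Rmin t T). pose proof (Fmono s t (Rmin_l t T)). specialize (HT s (Rmin_r t T)).
    specialize (FB s). apply Rabs_le_between in FB.
    assert (HCP : 0 < Cl * P1) by (apply Rmult_lt_0_compat; lra).
    apply Rmult_lt_compat_l with (r := Cl * P1) in HT; auto.
    replace (Cl * P1 * (- F t / (Cl * P1))) with (- F t) in HT by (field; split; lra). lra. }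
  rewrite <- F0. destruct (Fpos 0) as [H|H]; auto. exfalso.
  (* otherwise [psi1 = 0] on the negative half-line and [psi] is constant there *)
  assert (Hz : forall t, t < 0 -> psi1 t = 0).
  { intros t Ht. assert (is_derive F t 0).
    { apply (is_derive_ext_loc (fun _ => 0)); [|apply @is_derive_const].
      assert (Hp0 : 0 < - t) by lra. exists (mkposreal _ Hp0). intros x Hx.
      change (Rabs (x - t) < - t) in Hx. apply Rabs_def2 in Hx.
      pose proof (Fmono x 0 ltac:(lra)). pose proof (Fpos x). lra. }
    pose proof (is_derive_unique _ _ _ H0). rewrite (is_derive_unique _ _ _ (FD t)) in H1. nra. }
  assert (Hc : forall t, t <= -1 -> psi t = psi (-1)).
  { intros t Ht. destruct (MVT_gen psi t (-1) psi1) as [c [Hc1 Hc2]].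
    - intros; apply Hpsi01.
    - intros x _. apply continuity_pt_filterlim. eapply is_derive_continuous, Hpsi01.
    - rewrite Rmin_left, Rmax_right in Hc1 by lra. rewrite Hz in Hc2 by lra. lra. }
  pose proof (Hpsipos (-1)) as Hp1.
  assert (HX := XB_pos).
  destruct (exp_neg_small lam (psi (-1) / XB)) as [T HT]; [lra|apply Rdiv_lt_0_compat; lra|].
  set (t := Rmin T (-1)). specialize (HT t (Rmin_l _ _)). specialize (Hc t (Rmin_r _ _)).
  pose proof (psi_XB t) as B. rewrite wt_neg in B by (pose proof (Rmin_r T (-1)); unfold t; lra).
  rewrite Hc, Rabs_right in B by lra.
  apply Rmult_lt_compat_l with (r := XB) in HT; auto.
  replace (XB * (psi (-1) / XB)) with (psi (-1)) in HT by (field; lra). lra.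
Qed.

Variable CA : R.
Hypothesis HCA0 : 0 <= CA.
Hypothesis Hinv : forall M r, wb nu M r -> exists y, wb nu (CA * M) y /\ forall t, y t - Bop h lin_coef y t = r t.
Hypothesis Huniq : forall M y, wb nu M y -> (forall t, y t = Bop h lin_coef y t) -> forall t, y t = 0.

Lemma Bop_nu_minus M M' y y' t : wb nu M y -> wb nu M' y' ->
  Bop h lin_coef y t - Bop h lin_coef y' t = Bop h lin_coef (fun s => y s - y' s) t.
Proof.
  intros H H'. apply Bop_minus; (eapply wb_ladm; [|apply qy_wb; [apply nuN|eassumption]]; apply nuN).
Qed.

Lemma inverse_unique M M' y y' : wb nu M y -> wb nu M' y' ->
  (forall t, y t - Bop h lin_coef y t = y' t - Bop h lin_coef y' t) -> forall t, y t = y' t.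
Proof.
  intros H H' E t.
  assert (Z : y t - y' t = 0); [|lra].
  apply (Huniq (M + M') (fun t => y t - y' t)); [now apply wb_minus|].
  intros x. rewrite <- (Bop_nu_minus M M') by auto. specialize (E x). lra.
Qed.

(** A single function has to serve all bounds [M] at once; uniqueness identifies the solutions
    obtained for different [M]. *)
Lemma inverse_fun : exists Ainv : (R -> R) -> R -> R, forall M r, wb nu M r ->
  wb nu (CA * M) (Ainv r) /\ forall t, Ainv r t - Bop h lin_coef (Ainv r) t = r t.
Proof.
  destruct (fun_choice (R -> R) (R -> R) (fun r y => forall M, wb nu M r ->
     wb nu (CA * M) y /\ forall t, y t - Bop h lin_coef y t = r t)) as [A HA].
  - intros r. destruct (classic (exists M, wb nu M r)) as [[M0 H0]|H0].
    + destruct (Hinv M0 r H0) as [y [W E]]. exists y. intros M HM. split; auto.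
      destruct (Hinv M r HM) as [y' [W' E']].
      apply (wb_ext _ _ y'); auto. apply (inverse_unique (CA * M) (CA * M0)); auto.
      intros t. now rewrite E, E'.
    + exists r. intros M HM. elim H0. now exists M.
  - exists A. intros M r. apply HA.
Qed.

Lemma near_wb w_L s y s' y' : (forall t, continuous y t) -> (forall t, continuous y' t) ->
  near (wt nu) w_L s y s' y' -> Rabs (s - s') <= w_L /\ wb nu w_L (fun t => y t - y' t).
Proof. intros Hc Hc' [H1 H2]. split; auto. split; auto. intros t; now apply cont_Rminus. Qed.

Lemma branch_exists : exists e1 CC (S : R -> R) (Yf : R -> R -> R),
  0 < e1 /\ 0 <= CC /\ (forall e, Rabs e <= e1 -> small N e) /\ S 0 = 0 /\ (forall t, Yf 0 t = 0) /\
  forall e, Rabs e <= e1 -> unit_ball (S e) (Yf e) /\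
    (forall t, Yf e t - Bop h lin_coef (Yf e) t = residual e (S e) (Yf e) t) /\
    ell (fun t => ansatz e (S e) (Yf e) t - psi t) = 0 /\
    forall e', Rabs e' <= e1 -> Rabs (S e - S e') <= CC * Rabs (e ^ 2 - e' ^ 2) /\
      wb nu (CC * Rabs (e ^ 2 - e' ^ 2)) (fun t => Yf e t - Yf e' t).
Proof.
  destruct inverse_fun as [Ainv HAinv].
  set (m := ell psi1). assert (Hm : 0 < m) by apply ell_psi1_pos.
  assert (HCl : 0 < Cl) by (apply Rdiv_lt_0_compat; [apply P1_pos|lra]).
  set (cm := Cl / m). assert (Hcm : 0 < cm) by (apply Rdiv_lt_0_compat; auto).
  (* The contraction factor [3 / 4] is made of three quarters: [CA * kap] for the function,
     [cm * (CA * kap)] for its effect on the scalar, and [K2 * e ^ 2] for the moving rate. *)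
  set (kap := / (4 * (CA + 1) * (1 + cm))).
  assert (Hkap : 0 < kap) by (apply Rinv_0_lt_compat; nra).
  assert (Hk1 : CA * kap <= / 4 /\ cm * (CA * kap) <= / 4).
  { assert (E : (CA + 1) * (1 + cm) * kap = / 4) by (unfold kap; field; lra).
    assert (0 <= CA * kap) by (apply Rmult_le_pos; lra).
    assert (0 <= cm * kap) by (apply Rmult_le_pos; lra).
    assert (0 <= cm * (CA * kap)) by (apply Rmult_le_pos; lra). lra. }
  destruct Hk1 as [Hk1 Hk2].
  destruct (residual_lip kap Hkap) as [e0 [eta0 [He0 [Heta [Hleta Hlip]]]]].
  destruct residual_eps as [CE [HCE Hpe]].
  set (w := wt nu).
  assert (Hw : forall t, 0 < w t) by (intros; apply wt_pos).
  assert (Hwc : forall t, continuous w t) by (intros; apply wt_cont).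
  set (dl := fun e e' t => wt (l1 e) t - wt (l1 e') t).
  assert (Hdl : forall e e', small N e -> small N e' -> wb 0 (8 * lam * Rabs (e ^ 2 - e' ^ 2)) (dl e e')).
  { intros e e' He He'. apply (wb_lam0 (lam / 2)); [lra|]. now apply (wt_l1_diff h lam p l1). }
  (* As [ansatz - psi = s psi1 + lead s * dl e 0 + y], the condition [ell (ansatz - psi) = 0] reads
     [s * m + lead s * ell (dl e 0) + ell y = 0]; the first component solves it for [s], with the
     new correction [y'] inserted. *)
  set (T := fun e (z : R * (R -> R)) => let y' := Ainv (residual e (fst z) (snd z)) in
     (- / m * (lead (fst z) * ell (dl e 0) + ell y'), y')).
  set (K2 := 8 * lam * lam * c0 * cm).
  assert (HK2 : 0 < K2) by (unfold K2; repeat (apply Rmult_lt_0_compat; [|assumption]); lra).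
  assert (Hls : forall x, Rabs x <= eta0 -> lam * Rabs x <= 1).
  { intros x Hx. apply Rle_trans with (lam * eta0); auto. apply Rmult_le_compat_l; lra. }
  assert (Hok : forall s y, inball w eta0 s y -> unit_ball s y /\ wb nu eta0 y).
  { intros s y [B1 [B2 B3]]. assert (wb nu eta0 y) by (split; auto).
    split; auto. split; [lra|]. split; auto. apply (wb_weak nu nu eta0); auto; lra. }
  assert (HT2 : forall e s y, small N e -> unit_ball s y ->
    (exists M, wb nu M (snd (T e (s, y)))) /\
    forall t, snd (T e (s, y)) t - Bop h lin_coef (snd (T e (s, y))) t = residual e s y t).
  { intros e s y He B. destruct (residual_wb e s y He B) as [M HM]. destruct (HAinv M _ HM) as [A1 A2].
    split; [exists (CA * M)|]; auto. }
  assert (Hdiff : forall e e' s y s' y' L M0, small N e -> small N e' -> unit_ball s y -> unit_ball s' y' ->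
    wb nu L (fun t => residual e s y t - residual e' s' y' t) ->
    Rabs (lead s * ell (dl e 0) - lead s' * ell (dl e' 0)) <= Cl * M0 ->
    near w (CA * L + cm * (M0 + CA * L)) (fst (T e (s, y))) (snd (T e (s, y))) (fst (T e' (s', y'))) (snd (T e' (s', y')))).
  { intros e e' s y s' y' L M0 He He' B B' HL HM0.
    destruct (HT2 e s y He B) as [[M1 W1] E1]. destruct (HT2 e' s' y' He' B') as [[M2 W2] E2].
    destruct (HAinv L _ HL) as [W3 E3].
    (* Additivity of the chosen inverse, recovered from uniqueness. *)
    assert (Ed : forall t, snd (T e (s, y)) t - snd (T e' (s', y')) t =
      Ainv (fun t => residual e s y t - residual e' s' y' t) t).
    { apply (inverse_unique (M1 + M2) (CA * L)); auto; [now apply wb_minus|].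
      intros t. rewrite E3, <- (Bop_nu_minus M1 M2) by auto. rewrite <- E1, <- E2. ring. }
    assert (Wd : wb nu (CA * L) (fun t => snd (T e (s, y)) t - snd (T e' (s', y')) t)).
    { apply (wb_ext _ _ (Ainv (fun t => residual e s y t - residual e' s' y' t))); auto. }
    assert (HLp := wb_pos _ _ _ Wd).
    assert (HM0p : 0 <= M0).
    { pose proof (Rabs_pos (lead s * ell (dl e 0) - lead s' * ell (dl e' 0))).
      apply Rmult_le_reg_l with Cl; lra. }
    assert (0 <= cm * (M0 + CA * L)) by (apply Rmult_le_pos; lra).
    split.
    - assert (Ee : fst (T e (s, y)) - fst (T e' (s', y')) =
        - / m * ((lead s * ell (dl e 0) - lead s' * ell (dl e' 0)) + ell (fun t => snd (T e (s, y)) t - snd (T e' (s', y')) t))).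
      { replace (fun t => snd (T e (s, y)) t - snd (T e' (s', y')) t) with
          (fun t => snd (T e (s, y)) t + (-1) * snd (T e' (s', y')) t) by (apply functional_extensionality; intros; ring).
        rewrite (ell_plus _ _ M1 (Rabs (-1) * M2)), (ell_scal _ _ M2).
        - simpl. ring.
        - apply (wb_lam0 nu); [apply nuN|auto].
        - apply (wb_lam0 nu); [apply nuN|auto].
        - apply wb_scal. apply (wb_lam0 nu); [apply nuN|auto]. }
      rewrite Ee, Rabs_mult, Rabs_Ropp, Rabs_right by (apply Rle_ge; left; now apply Rinv_0_lt_compat).
      apply Rle_trans with (/ m * (Cl * M0 + Cl * (CA * L))).
      + apply Rmult_le_compat_l; [left; now apply Rinv_0_lt_compat|].
        eapply Rle_trans; [apply Rabs_triang|]. apply Rplus_le_compat; auto.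
        apply ell_bound. apply (wb_lam0 nu); [apply nuN|auto].
      + replace (/ m * (Cl * M0 + Cl * (CA * L))) with (cm * (M0 + CA * L)) by (unfold cm; field; lra). lra.
    - intros t. eapply Rle_trans; [apply Wd|]. apply Rmult_le_compat_r; [left; apply Hw|]. lra. }
  assert (Hsq0 : forall e, Rabs (e ^ 2 - 0 ^ 2) = e ^ 2).
  { intros e. replace (e ^ 2 - 0 ^ 2) with (e ^ 2) by ring. apply Rabs_right, Rle_ge, pow2_ge_0. }
  (* A Lipschitz constant of [T] in [e ^ 2]. Requiring [D0 * e ^ 2 <= eta0 / 4] fits the image of
     the centre into the quarter of the radius left by the factor [3 / 4]. *)
  set (D0 := CA * CE + cm * (16 * lam * c0 + CA * CE) + 1).
  assert (HD0 : 0 < D0).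
  { unfold D0. assert (0 <= CA * CE) by (apply Rmult_le_pos; auto).
    assert (0 <= cm * (16 * lam * c0 + CA * CE)) by (apply Rmult_le_pos; [lra|]; nra). lra. }
  set (q1 := Rmin (Rmin (/ (4 * (N + 1))) (/ (4 * K2))) (eta0 / (4 * D0))).
  assert (HN1 : 0 < N + 1) by (unfold N; lra).
  assert (Hq1 : 0 < q1).
  { unfold q1. repeat apply Rmin_pos; [apply Rinv_0_lt_compat; lra|apply Rinv_0_lt_compat; lra|apply Rdiv_lt_0_compat; lra]. }
  set (e1 := Rmin e0 (sqrt q1)).
  assert (He1 : 0 < e1) by (apply Rmin_pos; auto; now apply sqrt_lt_R0).
  assert (Hsq : forall e, Rabs e <= e1 -> 0 <= e ^ 2 <= q1).
  { intros e He. split; [apply pow2_ge_0|]. rewrite <- (sqrt_sqrt q1) by lra. rewrite <- pow2_abs.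
    pose proof (Rabs_pos e). pose proof (sqrt_pos q1). pose proof (Rmin_r e0 (sqrt q1)). fold e1 in H1. simpl. nra. }
  assert (Hq1a : q1 <= / (4 * (N + 1))) by (unfold q1; eapply Rle_trans; [apply Rmin_l|apply Rmin_l]).
  assert (Hq1b : q1 <= / (4 * K2)) by (unfold q1; eapply Rle_trans; [apply Rmin_l|apply Rmin_r]).
  assert (Hq1c : q1 <= eta0 / (4 * D0)) by (unfold q1; apply Rmin_r).
  assert (Hsm : forall e, Rabs e <= e1 -> small N e).
  { intros e He. destruct (Hsq e He) as [S1 S2]. unfold small.
    apply Rle_trans with (4 * (N + 1) * / (4 * (N + 1))); [apply Rmult_le_compat_l; lra|]. right. field. lra. }
  assert (HKe : forall e, Rabs e <= e1 -> K2 * e ^ 2 <= / 4).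
  { intros e He. destruct (Hsq e He) as [S1 S2].
    apply Rle_trans with (K2 * / (4 * K2)); [apply Rmult_le_compat_l; lra|]. right. field. lra. }
  assert (HDe : forall e, Rabs e <= e1 -> D0 * e ^ 2 <= eta0 / 4).
  { intros e He. destruct (Hsq e He) as [S1 S2].
    apply Rle_trans with (D0 * (eta0 / (4 * D0))); [apply Rmult_le_compat_l; lra|]. right. field. lra. }
  assert (HTlip : forall e, Rabs e <= e1 -> lip_on w (3 / 4) eta0 (T e)).
  { intros e He s y s' y' L B B' Hn. destruct (Hok s y B) as [O1 O2]. destruct (Hok s' y' B') as [O1' O2'].
    destruct (near_wb L s y s' y' (proj1 O2) (proj1 O2') Hn) as [N1 N2].
    assert (HL0 := wb_pos _ _ _ N2).
    assert (He' : Rabs e <= e0) by (eapply Rle_trans; [exact He|apply Rmin_l]).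
    assert (HP := Hlip e s s' y y' L (Hsm e He) He' (proj1 B) (proj1 B') O2 O2' N1 N2).
    assert (HNr := Hdiff e e s y s' y' (kap * L) (c0 * lam * L * (8 * lam * e ^ 2)) (Hsm e He) (Hsm e He) O1 O1' HP).
    assert (HNr' := HNr ltac:(
      replace (lead s * ell (dl e 0) - lead s' * ell (dl e 0)) with ((c0 * lam * (s - s')) * ell (dl e 0)) by (unfold lead; ring);
      replace (Cl * (c0 * lam * L * (8 * lam * e ^ 2))) with ((c0 * lam * L) * (Cl * (8 * lam * e ^ 2))) by ring;
      apply Rabs_mult_le; [rewrite Rabs_mult, (Rabs_right (c0 * lam)) by nra; apply Rmult_le_compat_l; nra|];
      rewrite <- (Hsq0 e); apply ell_bound, Hdl; [auto|apply small_0])).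
    assert (Hle : CA * (kap * L) + cm * (c0 * lam * L * (8 * lam * e ^ 2) + CA * (kap * L)) <= 3 / 4 * L).
    { replace (CA * (kap * L) + cm * (c0 * lam * L * (8 * lam * e ^ 2) + CA * (kap * L))) with
        ((CA * kap + K2 * e ^ 2 + cm * (CA * kap)) * L) by (unfold K2; ring).
      apply Rmult_le_compat_r; auto. pose proof (HKe e He). lra. }
    destruct HNr' as [R1 R2]. split; [lra|]. intros t. eapply Rle_trans; [apply R2|].
    apply Rmult_le_compat_r; [left; apply Hw|auto]. }
  assert (HTe : forall e e' s y, Rabs e <= e1 -> Rabs e' <= e1 -> inball w eta0 s y ->
    near w (D0 * Rabs (e ^ 2 - e' ^ 2)) (fst (T e (s, y))) (snd (T e (s, y))) (fst (T e' (s, y))) (snd (T e' (s, y)))).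
  { intros e e' s y He He' B. destruct (Hok s y B) as [O1 O2]. set (d := Rabs (e ^ 2 - e' ^ 2)).
    assert (Hd : 0 <= d) by apply Rabs_pos.
    assert (Edl : ell (dl e 0) - ell (dl e' 0) = ell (dl e e')).
    { assert (W1 := Hdl e 0 (Hsm e He) (small_0 N)). assert (W2 := Hdl e' 0 (Hsm e' He') (small_0 N)).
      replace (dl e e') with (fun t => dl e 0 t + (-1) * dl e' 0 t)
        by (apply functional_extensionality; intros; unfold dl; ring).
      rewrite (ell_plus _ _ _ _ W1 (wb_scal _ _ (-1) _ W2)), (ell_scal _ _ _ W2). ring. }
    destruct (Hdiff e e' s y s y (CE * d) (2 * c0 * (8 * lam * d)) (Hsm e He) (Hsm e' He') O1 O1) as [R1 R2].
    - now apply Hpe; auto.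
    - rewrite <- Rmult_minus_distr_l, Edl.
      replace (Cl * (2 * c0 * (8 * lam * d))) with ((2 * c0) * (Cl * (8 * lam * d))) by ring.
      apply Rabs_mult_le; [apply lead_bound, O1|]. apply ell_bound, Hdl; auto.
    - assert (Hle : CA * (CE * d) + cm * (2 * c0 * (8 * lam * d) + CA * (CE * d)) <= D0 * d).
      { replace (CA * (CE * d) + cm * (2 * c0 * (8 * lam * d) + CA * (CE * d))) with ((D0 - 1) * d) by (unfold D0; ring).
        apply Rmult_le_compat_r; lra. }
      split; [lra|]. intros t. eapply Rle_trans; [apply R2|]. apply Rmult_le_compat_r; [left; apply Hw|auto]. }
  assert (B00 : inball w eta0 0 (fun _ => 0)).
  { split; [rewrite Rabs_R0; lra|]. split; [intros; apply continuous_const|].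
    intros t. rewrite Rabs_R0. apply Rmult_le_pos; [lra|left; apply Hw]. }
  assert (Hz1 : Rabs 0 <= e1) by (rewrite Rabs_R0; lra).
  assert (Ez : ell (fun _ => 0) = 0).
  { assert (W := wb_zero 0). pose proof (ell_scal 0 _ _ W) as Q. cbv beta in Q.
    transitivity (ell (fun _ => 0 * 0)); [f_equal; apply functional_extensionality; intros; ring|].
    rewrite Q. ring. }
  assert (E00 : T 0 (0, fun _ => 0) = (0, fun _ => 0)).
  { destruct (HT2 0 0 (fun _ => 0) (small_0 N) zero_ok) as [[M W] E].
    assert (Es : snd (T 0 (0, fun _ => 0)) = (fun _ => 0)).
    { apply functional_extensionality. apply (Huniq M); auto. intros t. specialize (E t).
      rewrite residual_0 in E. lra. }
    rewrite (surjective_pairing (T 0 (0, fun _ => 0))), Es. f_equal.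
    change (- / m * (lead 0 * ell (dl 0 0) + ell (snd (T 0 (0, fun _ => 0)))) = 0). rewrite Es, Ez.
    replace (dl 0 0) with (fun _ : R => 0) by (apply functional_extensionality; intros; unfold dl; ring).
    rewrite Ez. ring. }
  assert (Hfix : forall e, exists z, Rabs e <= e1 -> inball w eta0 (fst z) (snd z) /\ T e z = z).
  { intros e. destruct (Rle_dec (Rabs e) e1) as [He|He]; [|exists (0, fun _ => 0); tauto].
    destruct (contraction_exists w Hw Hwc (3 / 4) eta0 (T e)) as [s [y [B F]]]; [lra|lra|now apply HTlip| | |].
    - intros s y B t. destruct (Hok s y B) as [O1 O2]. destruct (HT2 e s y (Hsm e He) O1) as [[M W] _]. apply W.
    - pose proof (HTe e 0 0 (fun _ => 0) He Hz1 B00) as Q. rewrite E00, Hsq0 in Q.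
      destruct Q as [Q1 Q2]. pose proof (HDe e He). split; [eapply Rle_trans; [exact Q1|lra]|].
      intros t. eapply Rle_trans; [apply Q2|].
      apply Rmult_le_compat_r; [left; apply Hw|lra].
    - exists (s, y). auto. }
  destruct (fun_choice _ _ _ Hfix) as [z Hz].
  assert (Hz0 : fst (z 0) = 0 /\ snd (z 0) = (fun _ => 0)).
  { destruct (Hz 0 Hz1) as [B F].
    destruct (contraction_unique w (3 / 4) eta0 (T 0) (fst (z 0)) (snd (z 0)) 0 (fun _ => 0)) as [E1 E2]; auto; [lra|].
    now rewrite <- surjective_pairing. }
  (* Distances of fixed points obey [x <= 3 / 4 * x + D0 * d], whose iteration from the diameter of
     the ball tends to [4 * D0 * d]. *)
  assert (Hgeo : forall e e', Rabs e <= e1 -> Rabs e' <= e1 -> forall n,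
    near w (4 * D0 * Rabs (e ^ 2 - e' ^ 2) + 2 * eta0 * (3 / 4) ^ n) (fst (z e)) (snd (z e)) (fst (z e')) (snd (z e'))).
  { intros e e' He He'. destruct (Hz e He) as [B F]. destruct (Hz e' He') as [B' F'].
    set (d := Rabs (e ^ 2 - e' ^ 2)). assert (Hd : 0 <= d) by apply Rabs_pos.
    assert (HDd : 0 <= D0 * d) by (apply Rmult_le_pos; lra).
    induction n as [|n IH].
    - destruct B as [B1 [_ B2]], B' as [B1' [_ B2']]. simpl. split.
      + eapply Rle_trans; [apply Rabs_sub_le|]. lra.
      + intros t. eapply Rle_trans; [apply Rabs_sub_le|]. specialize (B2 t); specialize (B2' t).
        pose proof (Hw t). assert (0 <= D0 * d * w t) by (apply Rmult_le_pos; lra). lra.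
    - assert (Q1 := HTlip e He _ _ _ _ _ B B' IH). assert (Q2 := HTe e e' _ _ He He' B').
      assert (Q3 := near_trans w _ _ _ _ _ _ _ _ Q1 Q2). fold d in Q3.
      rewrite <- !surjective_pairing, F, F' in Q3.
      replace (4 * D0 * d + 2 * eta0 * (3 / 4) ^ S n) with (3 / 4 * (4 * D0 * d + 2 * eta0 * (3 / 4) ^ n) + D0 * d)
        by (simpl; field). exact Q3. }
  exists e1, (4 * D0), (fun e => fst (z e)), (fun e => snd (z e)).
  split; [auto|]. split; [lra|]. split; [auto|]. split; [apply Hz0|].
  split; [intros t; now rewrite (proj2 Hz0)|].
  intros e He. destruct (Hz e He) as [B F]. destruct (Hok _ _ B) as [O1 O2].
  assert (Fs : snd (T e (fst (z e), snd (z e))) = snd (z e)) by (rewrite <- surjective_pairing, F; reflexivity).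
  assert (Ff : fst (T e (fst (z e), snd (z e))) = fst (z e)) by (rewrite <- surjective_pairing, F; reflexivity).
  split; [auto|]. split; [|split].
  - intros t. destruct (HT2 e _ _ (Hsm e He) O1) as [_ E]. rewrite Fs in E. apply E.
  - replace (fun t => ansatz e (fst (z e)) (snd (z e)) t - psi t) with
      (fun t => (fst (z e) * psi1 t + lead (fst (z e)) * dl e 0 t) + snd (z e) t)
      by (apply functional_extensionality; intros; now rewrite ansatz_minus_psi).
    assert (W1 : wb 0 P1 psi1) by (apply (wb_lam0 lam); [lra|apply psi1_wb]).
    assert (W2 := Hdl e 0 (Hsm e He) (small_0 N)).
    assert (W3 : wb 0 eta0 (snd (z e))) by (apply (wb_lam0 nu); [apply nuN|auto]).
    rewrite (ell_plus _ _ _ _ (wb_plus _ _ _ _ _ (wb_scal _ _ (fst (z e)) _ W1) (wb_scal _ _ (lead (fst (z e))) _ W2)) W3).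
    rewrite (ell_plus _ _ _ _ (wb_scal _ _ (fst (z e)) _ W1) (wb_scal _ _ (lead (fst (z e))) _ W2)).
    rewrite (ell_scal _ _ _ W1), (ell_scal _ _ _ W2). fold m.
    change (- / m * (lead (fst (z e)) * ell (dl e 0) + ell (snd (T e (fst (z e), snd (z e))))) = fst (z e)) in Ff.
    rewrite Fs in Ff. rewrite <- Ff at 1. field. lra.
  - intros e' He'. assert (Q := Hgeo e e' He He'). set (d := Rabs (e ^ 2 - e' ^ 2)) in *.
    destruct (Hz e' He') as [B' _]. split.
    + assert (Rabs (fst (z e) - fst (z e')) - 4 * D0 * d <= 0); [|lra].
      apply (small_all _ (2 * eta0) (3 / 4)); [lra|]. intros n. destruct (Q n) as [Q1 _]. lra.
    + split; [intros t; apply cont_Rminus; [apply B|apply B']|]. intros t.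
      assert (Rabs (snd (z e) t - snd (z e') t) - 4 * D0 * d * w t <= 0); [|unfold w in *; lra].
      apply (small_all _ (2 * eta0 * w t) (3 / 4)); [lra|]. intros n. destruct (Q n) as [_ Q1]. specialize (Q1 t). lra.
Qed.

(** * Asymptotics, positivity and dependence on [e] of the trial functions *)

Lemma ansatz_exp_bound e s y : small N e -> unit_ball s y ->
  forall t, Rabs (ansatz e s y t - lead s * exp (l1 e * t)) <= (2 * c0 + (Y1 + Y2 + 1)) * exp (nu * t).
Proof.
  intros He B t. destruct (proj1 (proj2 Hl1) e He) as [R1 _].
  replace (ansatz e s y t - lead s * exp (l1 e * t)) with (- lead s * (exp (l1 e * t) - wt (l1 e) t) + ansatz_rem s y t)
    by (unfold ansatz; ring).
  rewrite Rmult_plus_distr_r. eapply Rle_trans; [apply Rabs_triang|]. apply Rplus_le_compat.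
  - apply Rabs_mult_le; [rewrite Rabs_Ropp; apply lead_bound, B|].
    rewrite <- (Rmult_1_l (exp (nu * t))). apply (tht_bound lam Hlam); auto.
  - apply wb_exp; [apply nuN|now apply ansatz_rem_wb].
Qed.

Lemma shift_factor k : lam < k -> p * exp (- k * h) <= 1 + lam.
Proof.
  intros Hk. destruct (proj1 (proj2 Hl1) 0 (small_0 _)) as [_ [E _]]. rewrite (proj1 Hl1) in E.
  replace (1 + lam) with (p * exp (- lam * h)) by (rewrite <- E; ring).
  apply Rmult_le_compat_l; [lra|]. apply exp_mono. nra.
Qed.

(** The rate [nu] is improved to [2 lam] by iterating the integral equation for
    [ansatz e s y - lead s * exp (l1 e t)], which is a contraction for both rates. *)
Lemma asym_bound e s y : small N e -> unit_ball s y -> e <> 0 ->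
  (forall t, ansatz e s y t = Iop e (fun x => G (ansatz e s y (x - h))) t) ->
  exists C, forall t, Rabs (ansatz e s y t - lead s * exp (l1 e * t)) <= C * exp (2 * lam * t) /\
    Rabs (Derive (ansatz e s y) t - lead s * l1 e * exp (l1 e * t)) <= C * exp (2 * lam * t).
Proof.
  intros He B Hne Hfix. destruct (proj1 (proj2 Hl1) e He) as [R1 _].
  set (X := ansatz e s y) in *. set (D := fun t => X t - lead s * exp (l1 e * t)).
  set (F := fun t => p * D (t - h) + nonlin (X (t - h))).
  assert (WX : wb lam XB X) by now apply ansatz_wb.
  assert (WN := nonlin_wb X WX).
  set (M := 2 * c0 + (Y1 + Y2 + 1)). pose proof Y_pos as [HY1 HY2].
  assert (HM : 0 < M) by (unfold M; lra).
  assert (HD0 : forall t, Rabs (D t) <= M * exp (nu * t)) by (intros t; now apply ansatz_exp_bound).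
  assert (HDc : forall t, continuous D t).
  { intros t. apply cont_Rminus; [apply WX|]. apply cont_Rscal, cont_expk. }
  assert (HNc : forall t, continuous (fun t => nonlin (X (t - h))) t).
  { intros t. apply (cont_shift (fun t => nonlin (X t))), WN. }
  assert (HFc : forall t, continuous F t).
  { intros t. apply cont_Rplus; auto. apply cont_Rscal, cont_shift, HDc. }
  set (R0 := CN * XB * XB). assert (HR0 : 0 <= R0) by apply (wb_pos _ _ _ WN).
  assert (HNb : forall t, Rabs (nonlin (X (t - h))) <= R0 * exp (2 * lam * t)).
  { intros t. apply (exp_shift_bound h Hh (fun t => nonlin (X t))); [lra|]. apply wb_exp; [lra|exact WN]. }
  assert (A1 : adm N (fun t => p * D (t - h))).
  { apply adm_scal. apply (adm_exp N nu M); [apply nuN|intros t; apply cont_shift, HDc|].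
    apply (exp_shift_bound h Hh D); [apply nuN|auto]. }
  assert (A2 : adm N (fun t => nonlin (X (t - h)))) by (apply (adm_exp N (2 * lam) R0); auto; unfold N; lra).
  assert (AF : adm N F) by (apply adm_plus; auto).
  assert (HDF : forall t, D t = Iop e F t).
  { intros t. unfold D. rewrite (Hfix t).
    replace (fun x => G (X (x - h))) with (fun x => F x + lead s * p * exp (l1 e * (x - h))).
    2: { apply functional_extensionality. intros x. unfold F, D, nonlin. ring. }
    assert (A3 : adm N (fun x => exp (l1 e * (x - h)))) by (apply (adm_exps h lam Hh); lra).
    rewrite (Iop_plus N e NN0 He), (Iop_scal N e NN0 He); auto; [|now apply adm_scal].
    rewrite Rmult_assoc, (Iop_exp_l1 h lam p l1 Hlam Hp Hl1 e t He). ring. }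
  (* For [r] between [3 / 2 * lam] and [2 * lam], smallness gives [e ^ 2 * r <= / 4], so the symbol
     is at least [1 + 3 / 4 * r >= 1 + 9 / 8 * lam]; one factor [k] serves both rates. *)
  set (k := (1 + lam) / (1 + 9 / 8 * lam)).
  assert (Hk : 0 < k < 1).
  { unfold k. split; [apply Rdiv_lt_0_compat; lra|].
    apply Rmult_lt_reg_r with (1 + 9 / 8 * lam); [lra|]. unfold Rdiv. rewrite Rmult_assoc, Rinv_l; lra. }
  assert (Hfac : forall r, 3 / 2 * lam <= r <= 2 * lam -> 0 < 1 + r - e ^ 2 * r ^ 2 /\
     p * exp (- r * h) / (1 + r - e ^ 2 * r ^ 2) <= k).
  { intros r Hr. assert (Hden : 1 + 9 / 8 * lam <= 1 + r - e ^ 2 * r ^ 2).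
    { unfold small in He. fold N in He. pose proof (pow2_ge_0 e).
      assert (e ^ 2 * r <= / 4). { unfold N in He. nra. } nra. }
    split; [lra|]. unfold k, Rdiv. apply Rmult_le_compat.
    - apply Rmult_le_pos; [lra|left; apply exp_pos].
    - left; apply Rinv_0_lt_compat; lra.
    - apply shift_factor; lra.
    - apply Rinv_le_contravar; lra. }
  (* [Rk] solves [Rk = k * Rk + 2 * R0], so the part of rate [2 * lam] reproduces itself while the
     part of rate [nu] is multiplied by [k] at each step. *)
  set (R1' := 2 * R0). set (Rk := R1' / (1 - k)).
  assert (HRk : 0 <= Rk) by (unfold Rk, R1'; apply Rdiv_le_0_compat; lra).
  assert (iter : forall n t, Rabs (D t) <= M * k ^ n * exp (nu * t) + Rk * exp (2 * lam * t)).
  { induction n as [|n IH]; intros t.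
    - simpl. rewrite Rmult_1_r. specialize (HD0 t).
      assert (0 <= Rk * exp (2 * lam * t)) by (apply Rmult_le_pos; auto; left; apply exp_pos). lra.
    - rewrite HDF. unfold F. rewrite (Iop_plus N e NN0 He) by auto.
      eapply Rle_trans; [apply Rabs_triang|].
      assert (HMk : 0 <= M * k ^ n) by (apply Rmult_le_pos; [lra|apply pow_le; lra]).
      destruct (Hfac nu ltac:(unfold nu; lra)) as [F1 F2]. destruct (Hfac (2 * lam) ltac:(lra)) as [F3 F4].
      assert (I1 : Rabs (Iop e (fun t => p * D (t - h)) t) <=
        (p * (M * k ^ n) * exp (- nu * h)) / (1 + nu - e ^ 2 * nu ^ 2) * exp (nu * t) +
        (p * Rk * exp (- (2 * lam) * h)) / (1 + 2 * lam - e ^ 2 * (2 * lam) ^ 2) * exp (2 * lam * t)).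
      { apply (Iop_two N e nu (2 * lam)); auto; try apply NN0; try apply nuN; try (unfold N; lra).
        - apply Rmult_le_pos; [apply Rmult_le_pos; lra|left; apply exp_pos].
        - apply Rmult_le_pos; [apply Rmult_le_pos; lra|left; apply exp_pos].
        - intros x. apply cont_Rscal, cont_shift, HDc.
        - intros x. rewrite Rabs_mult, (Rabs_right p) by lra. specialize (IH (x - h)).
          replace (nu * (x - h)) with (- nu * h + nu * x) in IH by ring.
          replace (2 * lam * (x - h)) with (- (2 * lam) * h + 2 * lam * x) in IH by ring.
          rewrite !exp_plus in IH. apply Rmult_le_compat_l with (r := p) in IH; lra. }
      assert (I2 : Rabs (Iop e (fun t => nonlin (X (t - h))) t) <= 2 * R0 * exp (2 * lam * t)).
      { apply (Iop_exp_bound2 N e NN0 He); auto. unfold N; lra. }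
      assert (J1' : (p * (M * k ^ n) * exp (- nu * h)) / (1 + nu - e ^ 2 * nu ^ 2) <= k * (M * k ^ n)).
      { replace ((p * (M * k ^ n) * exp (- nu * h)) / (1 + nu - e ^ 2 * nu ^ 2)) with
          (p * exp (- nu * h) / (1 + nu - e ^ 2 * nu ^ 2) * (M * k ^ n)) by (field; lra).
        apply Rmult_le_compat_r; auto. }
      assert (J2' : (p * Rk * exp (- (2 * lam) * h)) / (1 + 2 * lam - e ^ 2 * (2 * lam) ^ 2) <= k * Rk).
      { replace ((p * Rk * exp (- (2 * lam) * h)) / (1 + 2 * lam - e ^ 2 * (2 * lam) ^ 2)) with
          (p * exp (- (2 * lam) * h) / (1 + 2 * lam - e ^ 2 * (2 * lam) ^ 2) * Rk) by (field; lra).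
        apply Rmult_le_compat_r; auto. }
      pose proof (exp_pos (nu * t)) as X1. pose proof (exp_pos (2 * lam * t)) as X2.
      apply Rmult_le_compat_r with (r := exp (nu * t)) in J1'; [|lra].
      apply Rmult_le_compat_r with (r := exp (2 * lam * t)) in J2'; [|lra].
      replace (M * k ^ S n * exp (nu * t)) with (k * (M * k ^ n) * exp (nu * t)) by (simpl; ring).
      replace (Rk * exp (2 * lam * t)) with (k * Rk * exp (2 * lam * t) + 2 * R0 * exp (2 * lam * t))
        by (unfold Rk, R1'; field; lra).
      lra. }
  assert (HD2 : forall t, Rabs (D t) <= Rk * exp (2 * lam * t)).
  { intros t. assert (Rabs (D t) - Rk * exp (2 * lam * t) <= 0); [|lra].
    apply (small_all _ (M * exp (nu * t)) k); [lra|]. intros n. specialize (iter n t). lra. }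
  assert (HFb : forall t, Rabs (F t) <= (p * Rk + R0) * exp (2 * lam * t)).
  { intros t. unfold F. eapply Rle_trans; [apply Rabs_triang|]. rewrite Rmult_plus_distr_r.
    apply Rplus_le_compat; auto. rewrite Rabs_mult, (Rabs_right p), Rmult_assoc by lra.
    apply Rmult_le_compat_l; [lra|]. apply (exp_shift_bound h Hh D); [lra|auto]. }
  destruct (Iop1_exp_bound N e NN0 He (2 * lam) (p * Rk + R0) F) as [C1 HC1]; auto; [unfold N; lra|].
  exists (Rmax Rk C1). intros t. pose proof (exp_pos (2 * lam * t)). split.
  - eapply Rle_trans; [apply HD2|]. apply Rmult_le_compat_r; [lra|apply Rmax_l].
  - assert (Hd : is_derive X t (lead s * l1 e * exp (l1 e * t) + Iop1 e F t)).
    { apply (is_derive_ext (fun t => lead s * exp (l1 e * t) + Iop e F t)).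
      - intros x. change (lead s * exp (l1 e * x) + Iop e F x = X x). rewrite <- HDF. unfold D. ring.
      - eapply is_derive_eq; [apply is_derive_Rplus; [apply is_derive_Rscal, is_derive_expk|apply is_derive_Iop; auto]|]. ring. }
    rewrite (is_derive_unique _ _ _ Hd).
    replace (lead s * l1 e * exp (l1 e * t) + Iop1 e F t - lead s * l1 e * exp (l1 e * t)) with (Iop1 e F t) by ring.
    eapply Rle_trans; [apply HC1|]. apply Rmult_le_compat_r; [lra|apply Rmax_r].
Qed.

(** The threshold [T0] is common to all [e] because [l1 e <= 5 / 4 * lam] leaves the fixed gap
    [lam / 4] below [nu], and the leading coefficient stays above [c0 / 2]. *)
Lemma ansatz_pos_left : exists T0, T0 <= 0 /\ forall e s y, small N e -> unit_ball s y -> lam * Rabs s <= / 2 ->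
  forall t, t <= T0 -> 0 < ansatz e s y t.
Proof.
  pose proof Y_pos as [HY1 HY2].
  set (M := 2 * c0 + (Y1 + Y2 + 1)). assert (HM : 0 < M) by (unfold M; lra).
  destruct (exp_neg_small (lam / 4) (c0 / 2 / M)) as [T HT]; [lra|repeat apply Rdiv_lt_0_compat; lra|].
  exists (Rmin T 0). split; [apply Rmin_r|]. intros e s y He B Hs t Ht.
  pose proof (Rmin_l T 0). pose proof (Rmin_r T 0).
  destruct (proj1 (proj2 Hl1) e He) as [R1 _].
  pose proof (ansatz_exp_bound e s y He B t) as HB1. fold M in HB1. apply Rabs_le_between in HB1.
  assert (Hc : c0 / 2 <= lead s).
  { unfold lead. replace (c0 / 2) with (c0 * / 2) by field. apply Rmult_le_compat_l; [lra|].
    assert (Rabs (lam * s) <= / 2) by (rewrite Rabs_mult, (Rabs_right lam); lra).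
    apply Rabs_le_between in H1. lra. }
  assert (E1 : exp (5 / 4 * lam * t) <= exp (l1 e * t)) by (apply exp_mono; nra).
  assert (E2 : exp (nu * t) = exp (lam / 4 * t) * exp (5 / 4 * lam * t)).
  { rewrite <- exp_plus. f_equal. unfold nu. field. }
  specialize (HT t ltac:(lra)).
  pose proof (exp_pos (5 / 4 * lam * t)) as P0.
  assert (M * exp (nu * t) < c0 / 2 * exp (5 / 4 * lam * t)).
  { rewrite E2, <- Rmult_assoc. apply Rmult_lt_compat_r; auto.
    apply Rmult_lt_compat_l with (r := M) in HT; auto. replace (M * (c0 / 2 / M)) with (c0 / 2) in HT by (field; lra). auto. }
  assert (c0 / 2 * exp (5 / 4 * lam * t) <= lead s * exp (l1 e * t)) by (apply Rmult_le_compat; lra).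
  lra.
Qed.

(** Changes of [s] and [y] cost no weight; only the moving exponential does, through [wt_diff],
    which accounts for the factor [/ del]. *)
Lemma ansatz_eps_diff del : 0 < del <= lam -> exists C, 0 <= C /\ forall e e' s s' y y' d, small N e -> small N e' ->
  unit_ball s y -> unit_ball s' y' -> Rabs (s - s') <= d -> wb nu d (fun t => y t - y' t) -> Rabs (e ^ 2 - e' ^ 2) <= d ->
  wb (lam - del) (C * d) (fun t => ansatz e s y t - ansatz e' s' y' t).
Proof.
  intros Hdel. pose proof Y_pos as [HY1 HY2]. pose proof XB_pos.
  exists (XD + 2 * c0 * (/ del * (4 * lam ^ 2))).
  assert (Hid : 0 < / del) by (apply Rinv_0_lt_compat; lra).
  assert (HXD : 0 < XD) by (unfold XD; assert (0 < c0 * lam) by nra; lra).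
  assert (Hl2 : 0 < lam ^ 2) by nra.
  split.
  { assert (0 <= 2 * c0 * (/ del * (4 * lam ^ 2))) by (apply Rmult_le_pos; [lra|apply Rmult_le_pos; lra]). lra. }
  intros e e' s s' y y' d He He' B B' Hs Hy Hd. assert (Hd0 := wb_pos _ _ _ Hy).
  apply (wb_ext _ _ (fun t => (ansatz e s y t - ansatz e s' y' t) + lead s' * (wt (l1 e) t - wt (l1 e') t))).
  { intros t. unfold ansatz. ring. }
  rewrite Rmult_plus_distr_r. apply wb_plus.
  - apply (wb_weak lam _ (XD * d)); [lra|lra|]. now apply ansatz_diff.
  - destruct (proj1 (proj2 Hl1) e He) as [R1 _]. destruct (proj1 (proj2 Hl1) e' He') as [R2 _].
    pose proof (proj2 (proj2 Hl1) e e' He He') as HL.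
    split; [intros t; apply cont_Rscal, cont_Rminus; apply wt_cont|]. intros t.
    rewrite !Rmult_assoc. rewrite <- Rmult_assoc. apply Rabs_mult_le; [apply lead_bound, B'|].
    eapply Rle_trans; [apply (wt_diff lam del); lra|].
    rewrite <- !Rmult_assoc. apply Rmult_le_compat_r; [left; apply wt_pos|]. rewrite !Rmult_assoc.
    apply Rmult_le_compat_l; [lra|]. eapply Rle_trans; [exact HL|]. rewrite Rmult_assoc.
    apply Rmult_le_compat_l; [lra|]. apply Rmult_le_compat_l; lra.
Qed.
End Branch.

(** * Properties of the unperturbed front *)

Lemma lim_m_eps (f : R -> R) (l : R) : is_lim f m_infty l ->
  forall e, 0 < e -> exists T, forall t, t <= T -> Rabs (f t - l) <= e.
Proof.
  intros H e He. apply is_lim_spec in H. destruct (H (mkposreal e He)) as [M HM]. simpl in HM.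
  exists (M - 1). intros t Ht. left. apply HM. lra.
Qed.

Lemma lim_p_eps (f : R -> R) (l : R) : is_lim f p_infty l ->
  forall e, 0 < e -> exists T, forall t, T <= t -> Rabs (f t - l) <= e.
Proof.
  intros H e He. apply is_lim_spec in H. destruct (H (mkposreal e He)) as [M HM]. simpl in HM.
  exists (M + 1). intros t Ht. left. apply HM. lra.
Qed.

Lemma bounded_of_limits (f : R -> R) (l l' : R) : (forall t, continuous f t) ->
  is_lim f m_infty l -> is_lim f p_infty l' -> exists B, 0 <= B /\ forall t, Rabs (f t) <= B.
Proof.
  intros Hc Hm Hp. destruct (lim_m_eps f l Hm 1 Rlt_0_1) as [T1 H1]. destruct (lim_p_eps f l' Hp 1 Rlt_0_1) as [T2 H2].
  destruct (cont_bounded f T1 T2 Hc) as [M [HM0 HM]].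
  exists (M + Rabs l + Rabs l' + 1). pose proof (Rabs_pos l). pose proof (Rabs_pos l'). split; [lra|].
  intros t. destruct (Rle_dec t T1) as [Ht|Ht]; [|destruct (Rle_dec T2 t) as [Ht'|Ht']].
  - replace (f t) with ((f t - l) + l) by ring. eapply Rle_trans; [apply Rabs_triang|]. specialize (H1 t Ht). lra.
  - replace (f t) with ((f t - l') + l') by ring. eapply Rle_trans; [apply Rabs_triang|]. specialize (H2 t Ht'). lra.
  - specialize (HM t ltac:(lra)). lra.
Qed.

Lemma wb_of_left (nu C B T : R) (f : R -> R) : 0 <= nu -> (forall t, continuous f t) ->
  (forall t, Rabs (f t) <= B) -> (forall t, t <= T -> Rabs (f t) <= C * exp (nu * t)) ->
  exists M, wb nu M f.
Proof.
  intros Hnu Hc HB HC. set (T' := Rmin T 0).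
  assert (HT : T' <= T /\ T' <= 0) by (split; [apply Rmin_l|apply Rmin_r]).
  assert (HB0 : 0 <= B) by (specialize (HB 0); pose proof (Rabs_pos (f 0)); lra).
  assert (HC0 : 0 <= C).
  { specialize (HC T (Rle_refl T)). pose proof (Rabs_pos (f T)). pose proof (exp_pos (nu * T)). nra. }
  assert (Hx : 0 <= B * exp (- nu * T')) by (apply Rmult_le_pos; auto; left; apply exp_pos).
  exists (C + B * exp (- nu * T')). split; auto. intros t. pose proof (wt_pos nu t).
  rewrite Rmult_plus_distr_r. destruct (Rle_dec t T').
  - specialize (HC t ltac:(lra)). rewrite <- wt_neg in HC by lra.
    assert (0 <= B * exp (- nu * T') * wt nu t) by (apply Rmult_le_pos; lra). lra.
  - assert (0 <= C * wt nu t) by (apply Rmult_le_pos; lra).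
    assert (1 <= exp (- nu * T') * wt nu t).
    { unfold wt. rewrite <- exp_plus, <- exp_0. apply exp_mono.
      assert (T' <= Rmin t 0) by (apply Rmin_glb; lra). nra. }
    assert (B * 1 <= B * (exp (- nu * T') * wt nu t)) by (apply Rmult_le_compat_l; auto).
    specialize (HB t). lra.
Qed.

(** [exp t * psi t] is nondecreasing, so a zero propagates to the whole past; since [g 0 = 0] it
    then propagates forwards window by window, which contradicts the limit [K]. *)
Lemma psi_positive (g : R -> R) (h K : R) (psi : R -> R) : 0 < h -> 0 < K -> g 0 = 0 ->
  (forall x, 0 <= x -> 0 <= g x) -> (forall t, 0 <= psi t) ->
  (forall t, is_derive psi t (- psi t + g (psi (t - h)))) -> is_lim psi p_infty K -> forall t, 0 < psi t.
Proof.
  intros Hh HK Hg0 Hg Hnn Hd Hlim t0. destruct (Hnn t0) as [H|H]; auto. exfalso.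
  assert (Hback : forall t, t <= t0 -> psi t = 0).
  { intros t Ht. assert (exp (1 * t) * psi t <= exp (1 * t0) * psi t0).
    { apply (derive_ge0_le_all (fun x => exp (1 * x) * psi x) (fun x => exp (1 * x) * g (psi (x - h)))); auto.
      intros x _. split.
      - eapply is_derive_eq; [apply is_derive_Rmult; [apply is_derive_expk|apply Hd]|]. cbv beta. ring.
      - apply Rmult_le_pos; [left; apply exp_pos|auto]. }
    rewrite <- H, Rmult_0_r in H0. pose proof (exp_pos (1 * t)). specialize (Hnn t). nra. }
  assert (Hfwd : forall n t, t <= t0 + INR n * h -> psi t = 0).
  { induction n as [|n IH]; intros t Ht.
    - apply Hback. simpl in Ht. lra.
    - rewrite S_INR in Ht. destruct (Rle_dec t (t0 + INR n * h)) as [|Hgt]; auto.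
      assert (exp (1 * t) * psi t <= exp (1 * (t0 + INR n * h)) * psi (t0 + INR n * h)).
      { assert (- (exp (1 * (t0 + INR n * h)) * psi (t0 + INR n * h)) <= - (exp (1 * t) * psi t)); [|lra].
        apply (derive_ge0_le_all (fun x => - (exp (1 * x) * psi x)) (fun x => - (exp (1 * x) * g (psi (x - h))))); [lra|].
        intros x Hx. split.
        - eapply is_derive_eq; [apply (is_derive_opp (fun x => exp (1 * x) * psi x)), is_derive_Rmult;
            [apply is_derive_expk|apply Hd]|]. cbv beta.
          match goal with |- opp ?x = _ => change (opp x) with (- x) end. ring.
        - rewrite (IH (x - h)) by lra. rewrite Hg0. lra. }
      rewrite (IH (t0 + INR n * h)), Rmult_0_r in H0 by lra.
      pose proof (exp_pos (1 * t)). specialize (Hnn t). nra. }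
  destruct (lim_p_eps psi K Hlim (K / 2) ltac:(lra)) as [T HT].
  destruct (nfloor_ex (Rabs (T - t0) / h)) as [n [_ Hn]]; [apply Rdiv_le_0_compat; auto using Rabs_pos|].
  specialize (HT T (Rle_refl T)). rewrite (Hfwd (S n) T) in HT.
  - rewrite Rminus_0_l, Rabs_Ropp, Rabs_right in HT; lra.
  - rewrite S_INR. apply Rmult_lt_compat_r with (r := h) in Hn; auto.
    replace (Rabs (T - t0) / h * h) with (Rabs (T - t0)) in Hn by (field; lra). pose proof (Rle_abs (T - t0)). lra.
Qed.

Lemma positive_lower_bound (f : R -> R) (K T0 : R) : (forall t, continuous f t) -> (forall t, 0 < f t) -> 0 < K ->
  is_lim f p_infty K -> exists mu, 0 < mu /\ forall t, T0 <= t -> mu <= f t.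
Proof.
  intros Hc Hpos HK Hlim. destruct (lim_p_eps f K Hlim (K / 2) ltac:(lra)) as [T HT].
  set (T1 := Rmax T T0).
  destruct (continuity_ab_min f T0 T1) as [x [Hx1 Hx2]]; [apply Rmax_r| |].
  { intros c _. apply continuity_pt_filterlim, Hc. }
  exists (Rmin (f x) (K / 2)). split; [apply Rmin_pos; auto; lra|]. intros t Ht.
  destruct (Rle_dec t T1).
  - eapply Rle_trans; [apply Rmin_l|]. apply Hx1; lra.
  - pose proof (Rmax_l T T0). fold T1 in H. specialize (HT t ltac:(lra)). apply Rabs_le_between in HT.
    eapply Rle_trans; [apply Rmin_r|]. lra.
Qed.

Lemma front_asymptotics (h lam p : R) (psi G dG : R -> R) (B : R) :
  0 < h -> 0 < lam -> 0 < p -> lam + 1 = p * exp (- lam * h) ->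
  (forall u, is_derive G u (dG u)) -> G 0 = 0 ->
  (exists C, 0 <= C /\ forall u, Rabs u <= B -> Rabs (dG u - p) <= C * Rabs u) ->
  (forall t, 0 < psi t) -> (forall t, 0 <= G (psi t)) -> (forall t, Rabs (psi t) <= B) ->
  (forall t, is_derive psi t (- psi t + G (psi (t - h)))) -> is_lim psi m_infty 0 ->
  exists c0 Y1 Y2, 0 < c0 /\ wb (3 / 2 * lam) Y1 (psi_rem lam c0 psi) /\
    wb (3 / 2 * lam) Y2 (dpsi_rem lam c0 (fun t => - psi t + G (psi (t - h)))).
Proof.
  intros Hh Hl Hp Hchar HGd HG0 [CN [HCN0 HCN]] Hpos HGpos HB Hd Hlim.
  assert (Hpc : forall t, continuous psi t) by (intros t; eapply is_derive_continuous, Hd).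
  assert (Hquad : forall t, Rabs (G (psi t) - p * psi t) <= CN * psi t ^ 2).
  { intros t. destruct (mvt_between G dG (psi t) 0 HGd) as [c [H1 H2]]. rewrite HG0, !Rminus_0_r in H2.
    rewrite H2. replace (dG c * psi t - p * psi t) with ((dG c - p) * psi t) by ring.
    assert (Hc : Rabs c <= Rabs (psi t)).
    { apply (between_abs (psi t) 0); auto; [lra|]. rewrite Rabs_R0. apply Rabs_pos. }
    replace (CN * psi t ^ 2) with (CN * Rabs (psi t) * Rabs (psi t)).
    - apply Rabs_mult_le; [|lra]. specialize (HB t). eapply Rle_trans; [apply HCN; lra|].
      apply Rmult_le_compat_l; auto.
    - rewrite <- (pow2_abs (psi t)). ring. }
  destruct (psi_asym h p lam CN 0 psi G) as [c0 [C [T [Hc0 HC]]]]; auto.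
  set (nu := 3 / 2 * lam).
  destruct (wb_of_left nu C (B + c0) (Rmin T 0) (psi_rem lam c0 psi)) as [Y1 HY1].
  - unfold nu; lra.
  - intros t. apply cont_Rminus; auto. apply cont_Rscal, wt_cont.
  - intros t. unfold psi_rem. eapply Rle_trans; [apply Rabs_sub_le|]. apply Rplus_le_compat; auto.
    rewrite Rabs_mult, (Rabs_right c0), (Rabs_right (wt _ _)) by (try lra; left; apply wt_pos).
    pose proof (wt_le1 lam t ltac:(lra)). nra.
  - intros t Ht. pose proof (Rmin_l T 0). pose proof (Rmin_r T 0).
    unfold psi_rem. rewrite wt_neg by lra. apply HC; lra.
  - assert (HY10 := wb_pos _ _ _ HY1).
    assert (Wpsi : wb lam (c0 + Y1) psi).
    { apply (wb_ext _ _ (fun t => c0 * wt lam t + psi_rem lam c0 psi t)); [intros; unfold psi_rem; ring|].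
      apply wb_plus.
      - replace c0 with (Rabs c0 * 1) at 1 by (rewrite Rabs_right; lra). apply wb_scal, wb_wt.
      - apply (wb_weak nu lam Y1); auto; [unfold nu; lra|lra]. }
    assert (HGc : forall u, continuous G u) by (intros; eapply is_derive_continuous, HGd).
    assert (WN : wb nu (CN * ((c0 + Y1) * (c0 + Y1))) (fun t => G (psi t) - p * psi t)).
    { split.
      - intros t. apply cont_Rminus; [now apply (continuous_comp psi G)|]. now apply cont_Rscal.
      - intros t. eapply Rle_trans; [apply Hquad|]. rewrite Rmult_assoc. apply Rmult_le_compat_l; auto.
        pose proof (proj2 (wb_mult _ _ _ _ _ _ Wpsi Wpsi) t) as Q. cbv beta in Q.
        replace (psi t ^ 2) with (psi t * psi t) by ring.
        eapply Rle_trans; [apply Rle_abs|]. eapply Rle_trans; [exact Q|].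
        apply Rmult_le_compat_l; [apply Rmult_le_pos; lra|]. apply wt_anti. unfold nu; lra. }
    (* The contribution of the truncated exponential to [dpsi_rem] after insertion into the
       equation; for [t <= 0] it vanishes by the characteristic equation, so the derivative keeps
       the rate [nu]. *)
    set (br := fun t => c0 * (p * wt lam (t - h) - (1 + lam) * wt lam t)).
    assert (Wbr : wb nu (c0 * (p + (1 + lam))) br).
    { split.
      - intros t. apply cont_Rscal, cont_Rminus; apply cont_Rscal; [apply cont_shift|]; apply wt_cont.
      - intros t. destruct (Rle_dec t 0).
        + unfold br. rewrite !wt_neg by lra.
          replace (lam * (t - h)) with (- lam * h + lam * t) by ring. rewrite exp_plus.
          replace (c0 * (p * (exp (- lam * h) * exp (lam * t)) - (1 + lam) * exp (lam * t))) with
            (c0 * ((p * exp (- lam * h) - (1 + lam)) * exp (lam * t))) by ring.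
          rewrite <- Hchar. replace (lam + 1 - (1 + lam)) with 0 by ring. rewrite Rmult_0_l, Rmult_0_r, Rabs_R0.
          apply Rmult_le_pos; [apply Rmult_le_pos; lra|left; apply exp_pos].
        + rewrite (wt_nonneg nu), Rmult_1_r by lra. unfold br.
          rewrite Rabs_mult, (Rabs_right c0) by lra. apply Rmult_le_compat_l; [lra|].
          eapply Rle_trans; [apply Rabs_sub_le|].
          pose proof (wt_le1 lam t ltac:(lra)). pose proof (wt_le1 lam (t - h) ltac:(lra)).
          pose proof (wt_pos lam t). pose proof (wt_pos lam (t - h)).
          rewrite !Rabs_mult, (Rabs_right p), (Rabs_right (1 + lam)), !Rabs_right by lra. nra. }
    assert (W2 := wb_plus _ _ _ _ _ (wb_plus _ _ _ _ _ (wb_plus _ _ _ _ _ (wb_scal _ _ (-1) _ HY1)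
      (wb_scal _ _ p _ (wb_shift nu Y1 _ h ltac:(unfold nu; lra) ltac:(lra) HY1))) Wbr)
      (wb_shift nu _ _ h ltac:(unfold nu; lra) ltac:(lra) WN)).
    eexists c0, Y1, _. split; auto. split; auto.
    eapply wb_ext; [|exact W2]. intros t. unfold br, psi_rem, dpsi_rem. ring.
Qed.

Lemma stable_of_exp_stable (g g' : R -> R) (h K : R) : 0 < h -> 0 < K -> exp_stable_eq g h K ->
  (forall x, 0 <= x -> 0 <= g x) -> g 0 = 0 -> g K = K -> C1_nonneg g g' ->
  stable_lin h (dGext g' (g' 0) K).
Proof.
  intros Hh HK Hst Hg Hg0 HgK HC1. set (p := g' 0). set (G := Gext g p). set (dG := dGext g' p).
  assert (HGd : forall u, is_derive G u (dG u)) by (intros u; now apply Gext_derive).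
  assert (HdGc : forall u, continuous dG u) by (intros u; now apply (dGext_cont g g')).
  (* [stab_decay] works with a nonlinearity that is nonnegative on the whole line, hence the
     positive part instead of the linear extension. *)
  apply (stab_decay g (fun x => G (Rmax x 0)) h K (dG K)); auto.
  - intros x. apply (continuous_comp (fun x => Rmax x 0) G); [apply cont_max0|].
    eapply is_derive_continuous, HGd.
  - intros x. unfold G. rewrite Gext_pos by apply Rmax_r. apply Hg, Rmax_r.
  - intros x Hx. unfold G. rewrite Rmax_left by auto. now apply Gext_pos.
  - intros z Hz. destruct (eps_cont dG K (HdGc K) z Hz) as [d [Hd Hcd]].
    exists (d / 2). split; [lra|]. intros u Hu HuK.
    destruct (mvt_between G dG u K HGd) as [c [H1 H2]].
    unfold G in H2. rewrite !Gext_pos, HgK in H2 by lra. rewrite H2.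
    replace (dG c * (u - K) - dG K * (u - K)) with ((dG c - dG K) * (u - K)) by ring.
    apply Rabs_mult_le; [|lra]. left. apply Hcd. apply Rle_lt_trans with (d / 2); [|lra].
    apply Rabs_le_between in HuK. apply Rabs_le. destruct (Rle_dec u K).
    + rewrite Rmin_left, Rmax_right in H1 by lra. lra.
    + rewrite Rmin_right, Rmax_left in H1 by lra. lra.
Qed.

Lemma RInt_gen_primitive (F f : R -> R) : (forall t, is_derive F t (f t)) -> (forall t, continuous f t) ->
  is_lim F m_infty 0 -> is_RInt_gen f (Rbar_locally m_infty) (at_point 0) (F 0).
Proof.
  intros Hd Hc Hl.
  assert (E : forall t, Derive F t = f t) by (intros t; apply is_derive_unique, Hd).
  replace f with (Derive F) by (apply functional_extensionality; auto).
  replace (F 0) with (F 0 - 0) by ring.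
  apply (is_RInt_gen_Derive (Fa := Rbar_locally m_infty) (Fb := at_point 0)).
  - apply filter_forall. intros ab x _. exists (f x). apply Hd.
  - apply filter_forall. intros ab x _. apply (continuous_ext f); auto.
  - exact Hl.
  - intros P [d Hd']. unfold filtermap, at_point. apply Hd', ball_center.
Qed.

Lemma wb_mu_norm (mu M eta : R) (f : R -> R) : 0 <= mu -> wb mu M f -> M <= eta -> mu_norm_le mu f eta.
Proof.
  intros Hmu H HM. split.
  - intros s Hs. pose proof (wb_bd mu M f Hmu H s). lra.
  - intros s Hs. pose proof (proj2 H s) as B. rewrite wt_neg in B by auto.
    pose proof (exp_pos (- mu * s)).
    apply Rle_trans with (exp (- mu * s) * (M * exp (mu * s))); [apply Rmult_le_compat_l; lra|].
    replace (exp (- mu * s) * (M * exp (mu * s))) with (M * (exp (- mu * s) * exp (mu * s))) by ring.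
    rewrite <- exp_plus. replace (- mu * s + mu * s) with 0 by ring. rewrite exp_0. lra.
Qed.

Lemma wb_lim_m (k M : R) (f : R -> R) : 0 < k -> wb k M f -> is_lim f m_infty 0.
Proof.
  intros Hk H. assert (HM := wb_pos _ _ _ H). apply is_lim_spec. intros [eps He]. simpl.
  destruct (exp_neg_small k (eps / (M + 1)) Hk) as [T HT]; [apply Rdiv_lt_0_compat; lra|].
  exists T. intros t Ht. rewrite Rminus_0_r.
  eapply Rle_lt_trans; [apply (wb_exp k M f); auto; lra|]. specialize (HT t ltac:(lra)).
  pose proof (exp_pos (k * t)).
  apply Rmult_lt_compat_l with (r := M + 1) in HT; [|lra].
  replace ((M + 1) * (eps / (M + 1))) with eps in HT by (field; lra). lra.
Qed.

Theorem theorem14 (g g' : R -> R) (h K : R) (psi : R -> R) (lam : R) :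
  hypH g g' h K ->
  glob_attracting g h K ->
  (forall t, 0 <= psi t) ->
  (forall t, is_derive psi t (- psi t + g (psi (t - h)))) ->
  is_lim psi m_infty 0 ->
  is_lim psi p_infty K ->
  0 < lam -> lam = -1 + g' 0 * exp (- lam * h) ->
  forall delta, 0 < delta < lam ->
  exists (eps0 : R) (Psi : R -> R -> R),
    0 < eps0 /\
    (forall eps, Rabs eps < eps0 -> in_C_mu (lam - delta) (Psi eps)) /\
    (forall e1, Rabs e1 < eps0 -> forall eta, 0 < eta ->
       exists rho, 0 < rho /\ forall e2, Rabs e2 < eps0 -> Rabs (e2 - e1) < rho ->
         mu_norm_le (lam - delta) (fun t => Psi e2 t - Psi e1 t) eta) /\
    (forall eps, Rabs eps < eps0 ->
       (forall t, 0 < Psi eps t) /\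
       sol2 g h eps (Psi eps) /\
       is_lim (Psi eps) m_infty 0 /\
       is_lim (Psi eps) p_infty K /\
       is_RInt_gen (fun s => Psi eps s * Derive psi s)
         (Rbar_locally m_infty) (at_point 0) (/ 2 * (psi 0) ^ 2)) /\
    (forall t, Psi 0 t = psi t) /\
    (forall eps, Rabs eps < eps0 -> eps <> 0 ->
       exists t0 l1, is_lambda1 eps (g' 0) h l1 /\
         (exists C T, forall t, t <= T ->
            Rabs (Psi eps (t - t0) - exp (l1 * t)) <= C * exp (2 * lam * t) /\
            Rabs (Derive (Psi eps) (t - t0) - l1 * exp (l1 * t))
              <= C * exp (2 * lam * t)) /\
         (exists z, forall t, t <= z -> 0 < Derive (Psi eps) t)).
Proof.
  intros [Hh [HK [Hgnn [Heq [Hstab [_ [HC1 [[r0 [Hr0 [HC2 _]]] Hp1]]]]]]]] _ Hnn Hde Hlm Hlp Hlam Hchar delta Hdelta.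
  assert (Hg0 : g 0 = 0) by (pose proof (proj2 (Heq 0 (Rle_refl 0)) (or_introl eq_refl)); lra).
  assert (HgK : g K = K) by (pose proof (proj2 (Heq K ltac:(lra)) (or_intror eq_refl)); lra).
  set (p := g' 0) in *. set (G := Gext g p). set (dG := dGext g' p).
  assert (Hp : 0 < p) by lra.
  assert (Hch : lam + 1 = p * exp (- lam * h)) by lra.
  assert (HGd : forall u, is_derive G u (dG u)) by (intros u; now apply Gext_derive).
  assert (HdGc : forall u, continuous dG u) by (intros u; now apply (dGext_cont g g')).
  assert (HG0 : G 0 = 0) by now apply Gext_0.
  assert (HdG0 : dG 0 = p) by (apply dGext_pos; lra).
  assert (HGpos : forall u, 0 <= u -> G u = g u) by (intros; now apply Gext_pos).
  assert (Hquad : forall B, exists C, 0 <= C /\ forall u, Rabs u <= B -> Rabs (dG u - p) <= C * Rabs u)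
    by (apply (dGext_quad g g' HC1 r0); auto).
  assert (Hpos : forall t, 0 < psi t) by now apply (psi_positive g h K).
  assert (Hd : forall t, is_derive psi t (- psi t + G (psi (t - h)))).
  { intros t. rewrite HGpos by auto. apply Hde. }
  assert (Hpc : forall t, continuous psi t) by (intros t; eapply is_derive_continuous, Hd).
  destruct (bounded_of_limits psi 0 K Hpc Hlm Hlp) as [B [HB0 HB]].
  destruct (front_asymptotics h lam p psi G dG B) as [c0 [Y1 [Y2 [Hc0 [HY1 HY2]]]]]; auto.
  { intros t. rewrite HGpos by auto. auto. }
  (* [psi'] is represented by the right-hand side of the equation, which can be differentiated once
     more and yields the linearized equation. *)
  set (psi1 := fun t => - psi t + G (psi (t - h))) in *.
  assert (Hpsi1 : forall t, is_derive psi1 t (- psi1 t + dG (psi (t - h)) * psi1 (t - h))).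
  { intros t. unfold psi1 at 1. eapply is_derive_eq.
    - apply is_derive_Rplus; [apply (is_derive_opp psi), Hd|].
      apply (is_derive_comp G (fun s => psi (s - h))); [apply HGd|]. apply is_derive_shift, Hd.
    - match goal with |- opp ?x + scal ?a ?b = _ => change (- x + a * b = - psi1 t + dG (psi (t - h)) * psi1 (t - h)) end.
      unfold psi1. ring. }
  destruct (Hquad (2 * c0 + Y1 + Y2 + 1)) as [CN [HCN0 HCN]].
  destruct (lambda1_exists h lam p Hh Hlam Hp Hch) as [l1 Hl1].
  assert (HsK := stable_of_exp_stable g g' h K Hh HK Hstab Hgnn Hg0 HgK HC1). fold p dG in HsK.
  set (q := lin_coef h dG psi).
  assert (Hqc : forall t, continuous q t).
  { intros t. apply (continuous_comp (fun s => psi (s - h)) dG); auto. now apply cont_shift. }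
  destruct (cont_bounded dG (- B) B HdGc) as [Q [_ HQ]].
  assert (HqQ : forall t, Rabs (q t) <= Q) by (intros t; apply HQ; apply Rabs_le_between; auto).
  assert (Hqm : forall e, 0 < e -> exists T, forall t, t <= T -> Rabs (q t - p) <= e).
  { intros e He. destruct (eps_cont dG 0 (HdGc 0) e He) as [d [Hd0 Hd1]].
    destruct (lim_m_eps psi 0 Hlm (d / 2)) as [T HT]; [lra|]. exists T. intros t Ht. left. rewrite <- HdG0.
    apply Hd1. eapply Rle_lt_trans; [apply HT; lra|lra]. }
  assert (Hqp : forall e, 0 < e -> exists T, forall t, T <= t -> Rabs (q t - dG K) <= e).
  { intros e He. destruct (eps_cont dG K (HdGc K) e He) as [d [Hd0 Hd1]].
    destruct (lim_p_eps psi K Hlp (d / 2)) as [T HT]; [lra|]. exists (T + h). intros t Ht. left.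
    apply Hd1. eapply Rle_lt_trans; [apply HT; lra|lra]. }
  destruct (linear_inverse h lam p (dG K) Q q) as [CA [HCA0 HCA]]; auto.
  assert (Huniq := linear_unique h lam p Q q Hh Hlam Hp Hch Hqc HqQ Hqm).
  destruct (branch_exists h lam p c0 Y1 Y2 CN l1 G dG psi psi1 Hh Hlam Hp Hc0 Hl1 HGd HdGc HG0 Hd Hpsi1 HY1 HY2
    HCN0 HCN Hpos Hd CA HCA0 HCA Huniq) as [e1 [CC [S0 [Yf [He1 [HCC [Hsm [HS0 [HYf0 Hbr]]]]]]]]].
  set (Psi := fun e => ansatz lam c0 l1 psi psi1 e (S0 e) (Yf e)).
  set (XB := 2 * c0 + Y1 + Y2 + 1) in *.
  assert (Wx : forall e, Rabs e <= e1 -> wb lam XB (Psi e)).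
  { intros e He. apply (ansatz_wb h lam p c0 Y1 Y2 l1); auto. now apply Hbr. }
  assert (Hfix : forall e, Rabs e <= e1 -> forall t, Psi e t = Iop e (fun x => G (Psi e (x - h))) t).
  { intros e He. destruct (Hbr e He) as [O [E _]].
    apply (residual_fixed h lam p c0 Y1 Y2 CN l1 G dG psi psi1); auto. }
  assert (Hz1 : Rabs 0 <= e1) by (rewrite Rabs_R0; lra).
  assert (Hsmall : forall e, Rabs e <= e1 -> Rabs (S0 e) <= CC * e ^ 2 /\ wb (3 / 2 * lam) (CC * e ^ 2) (Yf e)).
  { intros e He. destruct (Hbr e He) as [_ [_ [_ Hl]]]. destruct (Hl 0 Hz1) as [L1 L2].
    replace (Rabs (e ^ 2 - 0 ^ 2)) with (e ^ 2) in *
      by (replace (e ^ 2 - 0 ^ 2) with (e ^ 2) by ring; symmetry; apply Rabs_right, Rle_ge, pow2_ge_0).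
    rewrite HS0, Rminus_0_r in L1. split; auto. apply (wb_ext _ _ (fun t => Yf e t - Yf 0 t)); auto.
    intros t. rewrite HYf0. ring. }
  destruct (ansatz_pos_left h lam p c0 Y1 Y2 l1 psi psi1 Hlam Hc0 Hl1 HY1 HY2) as [T0 [HT0 Hleft]].
  destruct (positive_lower_bound psi K T0 Hpc Hpos HK Hlp) as [mu [Hmu Hlow]].
  destruct (limit_at_plus (2 * lam) h K G dG) as [r [e2 [Hr [He2 Hlimp]]]]; auto; [lra|rewrite HGpos; lra|].
  pose proof (wb_pos _ _ _ HY1) as HY10. pose proof (wb_pos _ _ _ HY2) as HY20.
  (* [A * e ^ 2] dominates both the uniform distance from [Psi e] to [psi] and
     [2 * lam * Rabs (S0 e)]. Its smallness keeps the leading coefficient positive, gives positivity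
     to the right of [T0], and brings [Psi e] eventually within reach of [limit_at_plus]. *)
  set (A := CC * (c0 * lam + Y2 + 1) + 16 * c0 * lam + 2 * lam * CC + 1).
  assert (Hcl : 0 < c0 * lam) by (apply Rmult_lt_0_compat; auto).
  assert (HCCx : 0 <= CC * (c0 * lam + Y2 + 1)) by (apply Rmult_le_pos; lra).
  assert (HlC : 0 <= lam * CC) by (apply Rmult_le_pos; lra).
  assert (HA : 0 < A) by (unfold A; lra).
  set (q3 := Rmin 1 (Rmin (mu / 2) (r / 2)) / A).
  assert (Hq3 : 0 < q3) by (apply Rdiv_lt_0_compat; auto; repeat apply Rmin_pos; lra).
  assert (HAq : A * q3 = Rmin 1 (Rmin (mu / 2) (r / 2))) by (unfold q3; field; lra).
  set (eps0 := Rmin (Rmin 1 e1) (Rmin e2 (sqrt q3))).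
  assert (Heps0 : 0 < eps0) by (repeat apply Rmin_pos; auto; [lra|now apply sqrt_lt_R0]).
  assert (Hin : forall e, Rabs e < eps0 -> Rabs e <= 1 /\ Rabs e <= e1 /\ Rabs e <= e2 /\
     A * e ^ 2 <= 1 /\ A * e ^ 2 <= mu / 2 /\ A * e ^ 2 <= r / 2).
  { intros e He.
    assert (M1 : eps0 <= 1) by (unfold eps0; eapply Rle_trans; [apply Rmin_l|apply Rmin_l]).
    assert (M2 : eps0 <= e1) by (unfold eps0; eapply Rle_trans; [apply Rmin_l|apply Rmin_r]).
    assert (M3 : eps0 <= e2) by (unfold eps0; eapply Rle_trans; [apply Rmin_r|apply Rmin_l]).
    assert (M4 : eps0 <= sqrt q3) by (unfold eps0; eapply Rle_trans; [apply Rmin_r|apply Rmin_r]).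
    assert (Hsq : e ^ 2 <= q3).
    { rewrite <- (sqrt_sqrt q3) by lra. rewrite <- pow2_abs. pose proof (Rabs_pos e). pose proof (sqrt_pos q3). simpl. nra. }
    assert (HAe : A * e ^ 2 <= Rmin 1 (Rmin (mu / 2) (r / 2))) by (rewrite <- HAq; apply Rmult_le_compat_l; lra).
    pose proof (Rmin_l 1 (Rmin (mu / 2) (r / 2))). pose proof (Rmin_r 1 (Rmin (mu / 2) (r / 2))).
    pose proof (Rmin_l (mu / 2) (r / 2)). pose proof (Rmin_r (mu / 2) (r / 2)). repeat split; lra. }
  assert (Hls : forall e, Rabs e < eps0 -> lam * Rabs (S0 e) <= / 2).
  { intros e He. destruct (Hin e He) as [I1 [I2 [I3 [I4 _]]]]. destruct (Hsmall e I2) as [L1 _].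
    pose proof (pow2_ge_0 e).
    assert (lam * Rabs (S0 e) <= lam * (CC * e ^ 2)) by (apply Rmult_le_compat_l; lra).
    assert (2 * lam * CC * e ^ 2 <= A * e ^ 2) by (apply Rmult_le_compat_r; auto; unfold A; lra). lra. }
  assert (Hclose : forall e t, Rabs e < eps0 -> Rabs (Psi e t - psi t) <= A * e ^ 2).
  { intros e t He. destruct (Hin e He) as [I1 [I2 [I3 [I4 _]]]]. destruct (Hsmall e I2) as [L1 L2].
    pose proof (Hls e He). pose proof (pow2_ge_0 e).
    eapply Rle_trans; [apply (ansatz_close h lam p c0 Y1 Y2 l1 psi psi1 Hlam Hc0 Hl1 HY1 HY2 e (S0 e) (Yf e) (CC * e ^ 2)); auto; lra|].
    replace (CC * e ^ 2 * (c0 * lam + Y2 + 1) + 16 * c0 * lam * e ^ 2) with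
      ((CC * (c0 * lam + Y2 + 1) + 16 * c0 * lam) * e ^ 2) by ring.
    apply Rmult_le_compat_r; auto. unfold A. lra. }
  (* To the left of [T0] the leading exponential decides; to the right [psi] is at least [mu] and
     [Psi e] differs from it by at most [mu / 2]. *)
  assert (HPos : forall e, Rabs e < eps0 -> forall t, 0 < Psi e t).
  { intros e He t. destruct (Hin e He) as [I1 [I2 [I3 [I4 [I5 I6]]]]]. destruct (Rle_dec t T0).
    - apply Hleft; auto. now apply Hbr.
    - pose proof (Hclose e t He) as Hc. apply Rabs_le_between in Hc. specialize (Hlow t ltac:(lra)). lra. }
  assert (HlimK : forall e, Rabs e < eps0 -> is_lim (Psi e) p_infty K).
  { intros e He. destruct (Hin e He) as [I1 [I2 [I3 [I4 [I5 I6]]]]].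
    apply (Hlimp e); auto.
    - apply (Wx e I2).
    - exists XB. apply (wb_bd lam XB); [lra|auto].
    - destruct (lim_p_eps psi K Hlp (r / 2)) as [T HT]; [lra|]. exists T. intros t Ht.
      replace (Psi e t - K) with ((Psi e t - psi t) + (psi t - K)) by ring.
      eapply Rle_trans; [apply Rabs_triang|]. specialize (HT t Ht). specialize (Hclose e t He). lra. }
  assert (HPsi0 : forall t, Psi 0 t = psi t).
  { intros t. unfold Psi. rewrite HS0. replace (Yf 0) with (fun _ : R => 0) by (apply functional_extensionality; auto).
    apply (ansatz_0 h lam p); auto. }
  exists eps0, Psi. split; [auto|]. split; [|split; [|split; [|split]]].
  - intros e He. destruct (Hin e He) as [I1 [I2 _]]. split; [apply (Wx e I2)|]. split.
    + exists XB. intros s Hs. 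
      apply (wb_mu_norm (lam - delta) XB XB (Psi e)); auto; [lra| |lra].
      apply (wb_weak lam _ XB); [lra|lra|auto].
    + exists K. auto.
  - intros ea Hea eta Heta. destruct (Hin ea Hea) as [Ia [Ja _]].
    destruct (ansatz_eps_diff h lam p c0 Y1 Y2 l1 psi psi1 Hlam Hc0 Hl1 HY1 HY2 delta ltac:(lra)) as [C [HC0 HC]].
    assert (HQ2 : 0 < 2 * (C + 1) * (CC + 1)) by (apply Rmult_lt_0_compat; lra).
    exists (eta / (2 * (C + 1) * (CC + 1))). split; [apply Rdiv_lt_0_compat; auto|].
    intros eb Heb Hab. destruct (Hin eb Heb) as [Ib [Jb _]].
    destruct (Hbr eb Jb) as [Ob [_ [_ Hl]]]. destruct (Hbr ea Ja) as [Oa _]. destruct (Hl ea Ja) as [L1 L2].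
    set (d := Rabs (eb ^ 2 - ea ^ 2)) in *. assert (Hd0 : 0 <= d) by apply Rabs_pos.
    assert (Hd2 : d <= 2 * Rabs (eb - ea)).
    { unfold d. replace (eb ^ 2 - ea ^ 2) with ((eb + ea) * (eb - ea)) by ring. rewrite Rabs_mult.
      apply Rmult_le_compat_r; [apply Rabs_pos|]. eapply Rle_trans; [apply Rabs_triang|]. lra. }
    assert (Hle : CC * d <= (CC + 1) * d) by (apply Rmult_le_compat_r; lra).
    apply (wb_mu_norm (lam - delta) (C * ((CC + 1) * d))); [lra| |].
    + apply HC; auto; [lra|apply (wb_weak (3 / 2 * lam) (3 / 2 * lam) (CC * d)); auto; lra|].
      fold d. assert (0 <= CC * d) by (apply Rmult_le_pos; lra). lra.
    + apply Rle_trans with ((C + 1) * ((CC + 1) * (2 * (eta / (2 * (C + 1) * (CC + 1)))))).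
      * apply Rmult_le_compat; [lra|apply Rmult_le_pos; lra|lra|]. apply Rmult_le_compat_l; lra.
      * right. field. lra.
  - intros e He. destruct (Hin e He) as [I1 [I2 _]]. split; [auto|]. split; [|split; [|split]]; auto.
    + destruct (Req_dec e 0) as [E0|E0].
      * subst e. exists psi1, (fun _ => 0). intros t. split; [|split].
        -- apply (is_derive_ext psi); [intros; now rewrite HPsi0|apply Hd].
        -- intros Hc. now elim Hc.
        -- rewrite !HPsi0. unfold psi1. rewrite HGpos by auto. ring.
      * set (f := fun x => G (Psi e (x - h))).
        assert (Hfc : forall t, continuous f t).
        { intros t. apply (continuous_comp (fun x => Psi e (x - h)) G); [apply cont_shift, (Wx e I2)|].
          eapply is_derive_continuous, HGd. }
        exists (Iop1 e f), (Iop2 e f). intros t. split; [|split].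
        -- apply (is_derive_ext (Iop e f)); [intros x; symmetry; apply (Hfix e I2)|]. now apply is_derive_Iop.
        -- intros _. now apply is_derive_Iop1.
        -- rewrite <- HGpos by (left; auto). rewrite (Hfix e I2 t).
           apply (Iop_equation (2 * lam) e ltac:(lra) (Hsm e I2) f t E0).
    + apply (wb_lim_m lam XB); auto.
    + destruct (Hbr e I2) as [_ [_ [Hell _]]].
      assert (W0 : exists M, wb 0 M (fun t => Psi e t - psi t)).
      { exists (A * e ^ 2). split; [intros t; apply cont_Rminus; auto; apply (Wx e I2)|].
        intros t. rewrite wt0, Rmult_1_r. auto. }
      destruct W0 as [M W0].
      destruct (ell_primitive lam c0 Y1 Y2 psi psi1 Hlam Hc0 HY1 HY2 _ M W0) as [F [F0 [FD FB]]].
      fold (Psi e) in Hell. rewrite Hell in F0.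
      assert (E : (fun s => Psi e s * Derive psi s) = (fun s => Psi e s * psi1 s)).
      { apply functional_extensionality. intros s. now rewrite (is_derive_unique _ _ _ (Hd s)). }
      (* [F] is the primitive of [(Psi e - psi) * psi1] that vanishes at [-oo], and the condition on
         [ell] says [F 0 = 0]; adding [psi ^ 2 / 2], a primitive of [psi * psi1], gives the
         prescribed value. *)
      rewrite E. replace (/ 2 * psi 0 ^ 2) with (F 0 + / 2 * (psi 0 * psi 0)) by (rewrite F0; ring).
      apply (RInt_gen_primitive (fun t => F t + / 2 * (psi t * psi t))).
      * intros t. eapply is_derive_eq; [apply is_derive_Rplus; [apply FD|apply is_derive_Rscal, is_derive_Rmult; apply Hd]|].
        fold (psi1 t). cbv beta. field.
      * intros t. apply cont_Rmult; [apply (Wx e I2)|]. eapply is_derive_continuous, Hpsi1.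
      * apply is_lim_spec. intros [eps Heps]. simpl.
        destruct (lim_m_eps psi 0 Hlm (Rmin 1 (eps / 4))) as [T1 HT1]; [apply Rmin_pos; lra|].
        set (CF := Rabs ((c0 * lam + Y2) / (lam / 2) * M) + 1).
        assert (HCF : 0 < CF) by (unfold CF; pose proof (Rabs_pos ((c0 * lam + Y2) / (lam / 2) * M)); lra).
        destruct (exp_neg_small (lam / 2) (eps / 2 / CF)) as [T2 HT2]; [lra|repeat apply Rdiv_lt_0_compat; lra|].
        exists (Rmin T1 T2). intros t Ht. pose proof (Rmin_l T1 T2). pose proof (Rmin_r T1 T2).
        rewrite Rminus_0_r. eapply Rle_lt_trans; [apply Rabs_triang|].
        specialize (HT1 t ltac:(lra)). specialize (HT2 t ltac:(lra)). rewrite Rminus_0_r in HT1.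
        pose proof (Rmin_l 1 (eps / 4)). pose proof (Rmin_r 1 (eps / 4)).
        assert (Rabs (/ 2 * (psi t * psi t)) <= eps / 4).
        { rewrite !Rabs_mult, (Rabs_right (/ 2)) by lra. pose proof (Rabs_pos (psi t)). nra. }
        assert (Rabs (F t) <= CF * exp (lam / 2 * t)).
        { eapply Rle_trans; [apply FB|]. apply Rmult_le_compat_r; [left; apply exp_pos|].
          unfold CF. pose proof (Rle_abs ((c0 * lam + Y2) / (lam / 2) * M)). lra. }
        apply Rmult_lt_compat_l with (r := CF) in HT2; auto.
        replace (CF * (eps / 2 / CF)) with (eps / 2) in HT2 by (field; lra). lra.
  - exact HPsi0.
  - intros e He Hne. destruct (Hin e He) as [I1 [I2 _]]. destruct (Hbr e I2) as [O [E _]].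
    destruct (proj1 (proj2 Hl1) e (Hsm e I2)) as [R1 [_ R3]].
    destruct (asym_bound h lam p c0 Y1 Y2 CN l1 G dG psi psi1 Hh Hlam Hp Hc0 Hl1 HGd HG0 HY1 HY2 HCN0 HCN
      e (S0 e) (Yf e) (Hsm e I2) O Hne (Hfix e I2)) as [C HC].
    fold (Psi e) in HC. set (c := lead lam c0 (S0 e)) in *.
    assert (Hc : 0 < c).
    { unfold c, lead. apply Rmult_lt_0_compat; auto. pose proof (Hls e He).
      assert (Rabs (lam * S0 e) <= / 2) by (rewrite Rabs_mult, (Rabs_right lam); lra).
      apply Rabs_le_between in H0. lra. }
    (* The translation normalizes the leading coefficient: [c * exp (- l * t0) = 1]. *)
    set (l := l1 e) in *. set (t0 := ln c / l). exists t0, l. split; [auto|].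
    assert (Hshift : forall t, c * exp (l * (t - t0)) = exp (l * t)).
    { intros t. replace (l * (t - t0)) with (l * t + - ln c) by (unfold t0; field; lra).
      rewrite exp_plus, exp_Ropp, exp_ln by auto. field. lra. }
    split.
    + exists (C * exp (- (2 * lam * t0))), 0. intros t _. destruct (HC (t - t0)) as [H1 H2].
      rewrite Rmult_assoc, <- exp_plus.
      replace (- (2 * lam * t0) + 2 * lam * t) with (2 * lam * (t - t0)) by ring.
      rewrite <- (Hshift t). split; [exact H1|].
      replace (l * (c * exp (l * (t - t0)))) with (c * l * exp (l * (t - t0))) by ring. exact H2.
    + assert (HC0 : 0 <= C).
      { destruct (HC 0) as [H1 _]. rewrite (Rmult_0_r (2 * lam)), exp_0 in H1.
        pose proof (Rabs_pos (Psi e 0 - c * exp (l * 0))). lra. }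
      assert (Hcl2 : 0 < c * l) by (apply Rmult_lt_0_compat; lra).
      (* Since [l <= 5 / 4 * lam], the error of rate [2 * lam] is eventually dominated by
         [c * l * exp (l * t)]. *)
      destruct (exp_neg_small (2 * lam - l) (c * l / (C + 1))) as [z Hz]; [lra|apply Rdiv_lt_0_compat; lra|].
      exists z. intros t Ht. specialize (Hz t Ht). destruct (HC t) as [_ H2]. apply Rabs_le_between in H2.
      assert (Ex : exp (2 * lam * t) = exp ((2 * lam - l) * t) * exp (l * t)) by (rewrite <- exp_plus; f_equal; ring).
      apply Rmult_lt_compat_l with (r := C + 1) in Hz; [|lra].
      replace ((C + 1) * (c * l / (C + 1))) with (c * l) in Hz by (field; lra).
      pose proof (exp_pos (l * t)). pose proof (exp_pos ((2 * lam - l) * t)).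
      assert (C * exp (2 * lam * t) < c * l * exp (l * t)).
      { rewrite Ex, <- Rmult_assoc. apply Rmult_lt_compat_r; auto. lra. }
      lra.
Qed.
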